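(* For every integer $r\ge 2$ there is $n_0=n_0(r)$ and there are constants $C>0$ (for $r=2$) and $c_r>0$ (for $r\ge 3$, depending only on $r$) such that for every $n\ge n_0$ and every difference-isomorphic family $\mathcal{G}$ of $r$-graphs on $[n]$, if $\mathcal{G}$ is not an involution clique then $$|\mathcal{G}|\le \begin{cases}\big(1-n^{-C\sqrt{n}}\big)\cdot 2^{f_2(n)} & \text{if } r=2,\\ e^{-c_r n^{r-2}}\cdot 2^{f_r(n)} & \text{if } r\ge 3.\end{cases}$$
   Context: An $r$-graph on $[n]=\{1,\dots,n\}$ is an $r$-uniform hypergraph with vertex set $[n]$, identified with its edge set, a subset of $\binom{[n]}{r}$. $G_1\setminus G_2$ is the $r$-graph on $[n]$ with edge set $E(G_1)\setminus E(G_2)$. A family $\mathcal{G}$ of $r$-graphs on $[n]$ is difference-isomorphic if $G_1\setminus G_2$ and $G_2\setminus G_1$ are isomorphic for every $G_1,G_2\in\mathcal{G}$. A permutation $\varphi\in S_n$ acts on $\binom{[n]}{r}$ by $\varphi(e)=\{\varphi(x):x\in e\}$ and on $r$-graphs by $\varphi(G)=\{\varphi(e):e\in G\}$. Write $G\overset{\varphi}{\rightarrow}H$ if $\varphi(G\setminus H)=H\setminus G$. An involution is a permutation $\psi\in S_n$ with $\psi^2$ equal to the identity (the identity included). For an involution $\psi$, a set $X$ of $r$-graphs on $[n]$ is a $\psi$-clique if $G\overset{\psi}{\rightarrow}G'$ for all $G,G'\in X$; $X$ is an involution clique if it is a $\psi$-clique for some involution $\psi\in S_n$. Define $f_r(n)=\frac12\binom{n}{r}$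 if $r$ is odd and $n$ is even, and $f_r(n)=\frac12\big(\binom{n}{r}-\binom{\lfloor n/2\rfloor}{\lfloor r/2\rfloor}\big)$ otherwise. *)

(* Defs.v *)
From mathcomp Require Import all_boot all_order all_algebra all_fingroup.
From mathcomp Require Import reals sequences exp.

Set Implicit Arguments.
Unset Strict Implicit.
Unset Printing Implicit Defensive.

Import Order.TTheory GRing.Theory Num.Theory.
Local Open Scope ring_scope.

(* A hypergraph on [n] is identified with its edge set; the vertices are
   0, ..., n-1 instead of 1, ..., n. *)
Definition hypergraph (n : nat) := {set {set 'I_n}}.

Definition uniform (r n : nat) (G : hypergraph n) : Prop :=
  forall e : {set 'I_n}, e \in G -> #|e| = r.

Definition perm_graph (n : nat) (phi : 'S_n) (G : hypergraph n) : hypergraph n :=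
  [set phi @: e | e : {set 'I_n} in G].

Definition isomorphic (n : nat) (G H : hypergraph n) : Prop :=
  exists phi : 'S_n, perm_graph phi G = H.

Definition difference_isomorphic (n : nat) (F : {set hypergraph n}) : Prop :=
  forall G1 G2 : hypergraph n, G1 \in F -> G2 \in F ->
    isomorphic (G1 :\: G2) (G2 :\: G1).

Definition arrow (n : nat) (phi : 'S_n) (G H : hypergraph n) : Prop :=
  perm_graph phi (G :\: H) = H :\: G.

(* The identity counts as an involution. *)
Definition involution (n : nat) (psi : 'S_n) : Prop := (psi * psi = 1)%g.

Definition clique (n : nat) (psi : 'S_n) (X : {set hypergraph n}) : Prop :=
  forall G G' : hypergraph n, G \in X -> G' \in X -> arrow psi G G'.

Definition involution_clique (n : nat) (X : {set hypergraph n}) : Prop :=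
  exists2 psi : 'S_n, involution psi & clique psi X.

(* Real-valued, so that neither the subtraction nor the halving truncates. *)
Definition fexp (R : realType) (r n : nat) : R :=
  if odd r && ~~ odd n then 'C(n, r)%:R / 2
  else ('C(n, r)%:R - 'C(n./2, r./2)%:R) / 2.

(* Main.v *)
Require Import Defs.
From mathcomp Require Import all_boot all_order all_algebra all_fingroup.
From mathcomp Require Import reals sequences exp.
From mathcomp Require Import zify ring lra.

(* Fix a member x of the family. For a permutation phi the graphs K with
   x -> K via phi form a Boolean cube of dimension |phi(x) \ x|, and if phi is
   an involution this cube is a clique. Apart from few exceptions, a member x
   is moved a lot by every permutation moving many points; hence the
   permutations whose cube at x is not negligible are close to each other and
   to their inverses.

   For r >= 3 this already leaves a single permutation psi, an involution: all
   but few members lie in the cube C of psi at x. A member y outside C is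
   related to a member of C only through some phi <> psi, and the edges on
   which phi and psi disagree make C meet each cube at y in few graphs.

   For r = 2 an extremal argument on the pairs of edges that are forced to be
   exchanged produces a popular involution psi, and almost all members lie in
   one of its cliques C. If C is smaller than maximal we are done. Otherwise
   consider y outside C: a permutation phi can relate y to most of C only if it
   agrees with psi outside a polylogarithmic set of vertices nearly isolated in
   y (with nearly complete psi-partners), and prescribing polylogarithmically
   many edges of K in C rules out all these phi simultaneously. *)

Set Implicit Arguments.
Unset Strict Implicit.
Unset Printing Implicit Defensive.

Local Open Scope nat_scope.

(** * Counting *)

(** Sizes are bounded by powers of two, and exponents are compared on a scale multiplied by 6: a
    family inside a cube has at most 2^k members with 6k <= 3N, N = C(n,r), and this bound on 6k
    drops by 3 for each edge known to be constant and by 1 for each edge known to lie in a link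
    class of size at least three. With l the rounded up binary logarithm of n, a union bound over
    all permutations costs n l bits. For r >= 3 a nontrivial permutation moves at least order
    n^(r-1) edges, which outweighs this cost, so rigidity holds with no exceptional permutation. For
    r = 2 a transposition moves only about 2n edges, less than the n log n spent; rigidity then
    holds only up to polylogarithmically many moved vertices, and the permutations that matter form
    a ball of 2^tau elements with tau polylogarithmic. Hence the detour through popularity and a
    potential. Finally, a single graph outside a maximal clique is only shown to exclude a fraction
    2^(-P) of it, with P polylogarithmic; this is why the bound for r = 2 is so close to
    2^f_2(n). *)

Lemma bin_le_exp m k : 'C(m, k) <= m ^ k.
Proof.
apply: (@leq_trans (m ^_ k)); first by rewrite -bin_ffact leq_pmulr ?fact_gt0.
elim: k m => [|k IH] m; first by rewrite ffactn0.
case: m => [|m]; first by rewrite ffact0n.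
rewrite ffactSS expnS leq_mul2l; apply/orP; right.
by apply: (leq_trans (IH m)); case: k {IH} => // k; rewrite leq_exp2r.
Qed.

Lemma card_small_subsets (T : finType) (A : {set T}) E :
  #|[set D : {set T} | (D \subset A) && (#|D| <= E)]| <= (#|A| + 1) ^ E.
Proof.
have -> : [set D : {set T} | (D \subset A) && (#|D| <= E)] =
    \bigcup_(i < E.+1) [set D : {set T} | (D \subset A) & #|D| == i].
  apply/setP => D; rewrite inE; apply/andP/bigcupP => [[DA DE]|[i _]].
    by exists (inord #|D|) => //; rewrite inE DA inordK // eqxx.
  by rewrite inE => /andP[-> /eqP->]; rewrite -ltnS ltn_ord.
apply: (@leq_trans (\sum_(i < E.+1) 'C(E, i) * (1 ^ (E - i) * #|A| ^ i))); last first.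
  by rewrite addnC expnDn.
apply: (@leq_trans (\sum_(i < E.+1) #|[set D : {set T} | (D \subset A) & #|D| == i]|)).
  elim/big_ind2: _ => [|x X y Y hx hy|//]; first by rewrite cards0.
  by rewrite (leq_trans (leq_card_setU _ _)) // leq_add.
apply: leq_sum => i _; rewrite cards_draws exp1n mul1n.
apply: (leq_trans (bin_le_exp _ _)); apply: leq_pmull.
by rewrite bin_gt0 -ltnS.
Qed.

Lemma pigeonhole (T S : finType) (Y : {set T}) (B : {set S}) (f : T -> S) :
  (forall y, y \in Y -> f y \in B) -> Y != set0 ->
  exists2 v, v \in B & #|Y| <= #|B| * #|[set y in Y | f y == v]|.
Proof.
move=> fB Y0.
have [v0 v0B] : exists v, v \in B by have [y yY] := set0Pn _ Y0; exists (f y); apply: fB.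
pose v := [arg max_(v > v0 in B) #|[set y in Y | f y == v]|].
have [vB vmax] : v \in B /\ forall w, w \in B ->
    #|[set y in Y | f y == w]| <= #|[set y in Y | f y == v]|.
  by rewrite /v; case: arg_maxnP.
exists v => //.
rewrite -sum1_card (partition_big f (mem B)) //=.
rewrite -sum_nat_const; apply: leq_sum => w wB.
rewrite (leq_trans _ (vmax w wB)) // -sum1_card.
by apply: eq_leq; apply: eq_bigl => y; rewrite !inE.
Qed.

Lemma sum_divn_exp2 M n : \sum_(1 <= d < n) M %/ 2 ^ d <= M.
Proof.
case: n => [|n]; first by rewrite big_geq.
suff: \sum_(1 <= d < n.+1) M %/ 2 ^ d + M %/ 2 ^ n <= M by apply: leq_trans; apply: leq_addr.
elim: n => [|n IH]; first by rewrite big_geq // expn0 divn1.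
rewrite big_nat_recr //= expnSr divnMA.
apply: leq_trans IH; rewrite -addnA leq_add2l.
by move: (M %/ 2 ^ n) => m; lia.
Qed.

Lemma up_log2_bound n : n <= 2 ^ up_log 2 n.
Proof. by case: n => // n; apply: up_logP. Qed.

Lemma leq_card_bigcup (I T : finType) (P : pred I) (F : I -> {set T}) :
  #|\bigcup_(i | P i) F i| <= \sum_(i | P i) #|F i|.
Proof.
elim/big_ind2: _ => [|x X y Y hx hy|//]; first by rewrite cards0.
by rewrite (leq_trans (leq_card_setU _ _)) // leq_add.
Qed.

Lemma sum_card_incident (T : finType) (A : {set T}) (B : {set {set T}}) m :
  (forall e, e \in B -> #|e| <= m) ->
  \sum_(v in A) #|[set e in B | v \in e]| <= m * #|B|.
Proof.
move=> Bm.
have -> : \sum_(v in A) #|[set e in B | v \in e]| = \sum_(e in B) #|[set v in A | v \in e]|.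
  under eq_bigr do rewrite -sum1_card.
  under [RHS]eq_bigr do rewrite -sum1_card.
  rewrite (exchange_big_dep (mem B)) /=; last by move=> v e _; rewrite inE => /andP[].
  by apply: eq_bigr => e eB; apply: eq_bigl => v; rewrite !inE eB.
rewrite mulnC -sum_nat_const; apply: leq_sum => e eB.
by apply: leq_trans (Bm e eB); apply/subset_leq_card/subsetP => v; rewrite inE => /andP[].
Qed.

Lemma addb_eqF (a b : bool) : a (+) b = false -> a = b.
Proof. by case: a b => [] []. Qed.

(** * Linked coordinates in a family of sets *)

Section Families.
Variable E : finType.
Implicit Types (X Y : {set {set E}}) (G H K x y : {set E}) (e f : E) (p q : {perm E}).

(* The graphs K with x -> K via p: each e in x with p e outside x is either
   kept or replaced by p e. *)
Definition cube p x : {set {set E}} := [set K | p @: (x :\: K) == K :\: x].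

(** On [X] the coordinates of [e] and [f] are equal or complementary; comparing changes between two
    graphs treats both cases at once. *)
Definition linked X e f :=
  [forall K in X, forall K' in X, ((e \in K) (+) (e \in K')) == ((f \in K) (+) (f \in K'))].
Definition const_on X e := [forall K in X, forall K' in X, (e \in K) == (e \in K')].
Definition link_class X e := [set f | linked X e f].

Lemma linkedP X e f :
  reflect {in X &, forall K K', (e \in K) (+) (e \in K') = (f \in K) (+) (f \in K')}
          (linked X e f).
Proof.
apply: (iffP forall_inP) => [h K K' KX K'X | h K KX].
  by move/forall_inP/(_ K' K'X)/eqP: (h K KX).
by apply/forall_inP => K' K'X; apply/eqP/h.
Qed.

Lemma const_onP X e :
  reflect {in X &, forall K K', (e \in K) = (e \in K')} (const_on X e).
Proof.
apply: (iffP forall_inP) => [h K K' KX K'X | h K KX].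
  by move/forall_inP/(_ K' K'X)/eqP: (h K KX).
by apply/forall_inP => K' K'X; apply/eqP/h.
Qed.

Lemma linkedxx X e : linked X e e. Proof. exact/linkedP. Qed.

Lemma linked_sym X e f : linked X e f = linked X f e.
Proof. by apply/linkedP/linkedP => h K K' KX K'X; rewrite h. Qed.

Lemma linked_trans X e f g : linked X e f -> linked X f g -> linked X e g.
Proof.
by move=> /linkedP h /linkedP h'; apply/linkedP => K K' KX K'X; rewrite h // h'.
Qed.

Lemma linked_class X e f : linked X e f -> link_class X e = link_class X f.
Proof.
move=> ef; apply/setP => g; rewrite !inE; apply/idP/idP; apply: linked_trans => //.
by rewrite linked_sym.
Qed.

Lemma linked_const X e f : linked X e f -> const_on X e = const_on X f.
Proof.
move=> /linkedP h; apply/const_onP/const_onP => c K K' KX K'X; apply: addb_eqF.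
  by rewrite -(h K K') // (c K K') // addbb.
by rewrite (h K K') // (c K K') // addbb.
Qed.

Lemma mem_link_class X e : e \in link_class X e. Proof. by rewrite inE linkedxx. Qed.

Lemma linkedS X Y e f : Y \subset X -> linked X e f -> linked Y e f.
Proof.
by move=> /subsetP YX /linkedP h; apply/linkedP => K K' /YX KX /YX K'X; apply: h.
Qed.

Lemma const_onS X Y e : Y \subset X -> const_on X e -> const_on Y e.
Proof.
by move=> /subsetP YX /const_onP h; apply/const_onP => K K' /YX KX /YX K'X; apply: h.
Qed.

Lemma link_classS X Y e : Y \subset X -> link_class X e \subset link_class Y e.
Proof. by move=> YX; apply/subsetP => f; rewrite !inE; apply: linkedS. Qed.

(* Each class of two linked non-constant elements carries one bit; a larger
   class wastes at least a sixth of a bit per element, a constant element half a bit. *)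
Lemma card_linked_family X (Om Cst Bd : {set E}) :
  (forall e, ~~ const_on X e -> e \in Om /\ 1 < #|link_class X e|) ->
  Cst \subset Om -> Bd \subset Om -> [disjoint Cst & Bd] ->
  (forall e, e \in Cst -> const_on X e) ->
  (forall e, e \in Bd -> ~~ const_on X e -> 2 < #|link_class X e|) ->
  exists k, #|X| <= 2 ^ k /\ 6 * k + #|Bd| + 3 * #|Cst| <= 3 * #|Om|.
Proof.
move=> XOm CO BO dCB hC hB.
pose rep e := odflt e [pick f in link_class X e].
have rep_linked e : linked X e (rep e).
  rewrite /rep; case: pickP => [f|_]; last exact: linkedxx.
  by rewrite inE.
have rep_eq e f : linked X e f -> rep e = rep f.
  move=> ef; rewrite /rep (linked_class ef); case: pickP => // /(_ f).
  by rewrite mem_link_class.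
pose NC := [set e | ~~ const_on X e].
pose R := rep @: NC.
exists #|R|; split.
  rewrite -card_powerset.
  have <- : #|[set K :&: R | K in X]| = #|X|; last first.
    by apply/subset_leq_card/subsetP => _ /imsetP[K KX ->]; rewrite inE subsetIr.
  apply: card_in_imset => K K' KX K'X /= /setP KK'; apply/setP => e.
  have [/const_onP c|nc] := boolP (const_on X e); first exact: c.
  have rR : rep e \in R by apply: imset_f; rewrite inE.
  have := KK' (rep e); rewrite !inE rR !andbT => req.
  have /linkedP h := rep_linked e.
  by apply: addb_eqF; rewrite (h K K') // req addbb.
have repNC e : e \in NC -> rep e \in NC.
  by rewrite !inE -(linked_const (rep_linked e)).
(* An element weighs 3, or 2 if it is in [Bd]. A class of size two avoids [Bd] and weighs 6; a
   larger one weighs at least 3 * 2. So every class pays for its 6. *)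
have key : 6 * #|R| <= \sum_(e in NC) (3 - (e \in Bd)).
  rewrite (partition_big rep (mem R)) /=; last by move=> e eN; apply: imset_f.
  rewrite mulnC -sum_nat_const; apply: leq_sum => r rR.
  have /imsetP[e0 e0N re0] := rR.
  have rN : r \in NC by rewrite re0 repNC.
  have rnc : ~~ const_on X r by move: rN; rewrite inE.
  have rr : rep r = r by rewrite re0 -(rep_eq _ _ (rep_linked e0)).
  have eqr e : (e \in NC) && (rep e == r) = (e \in link_class X r).
    rewrite inE; apply/andP/idP => [[eN /eqP <-]|re].
      by rewrite inE linked_sym rep_linked.
    have re' : linked X r e by move: re; rewrite inE.
    by rewrite -(linked_const re') rnc -(rep_eq _ _ re') rr eqxx.
  rewrite (eq_bigl _ _ eqr).
  have [_ c1] := XOm r rnc.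
  case: (ltngtP 2 #|link_class X r|) c1 => [c3 _|c2 c1|c2 _].
  - apply: (@leq_trans (\sum_(e in link_class X r) 2)); first by rewrite sum_nat_const; lia.
    by apply: leq_sum => e _; case: (e \in Bd).
  - by lia.
  - rewrite (eq_bigr (fun=> 3)); first by rewrite sum_nat_const -c2.
    move=> e; rewrite inE => re; have [eB|//] := boolP (e \in Bd).
    have := hB e eB; rewrite -(linked_const re) -(linked_class re) -c2.
    by move/(_ rnc).
have sumE : \sum_(e in NC) (3 - (e \in Bd)) + #|NC :&: Bd| = 3 * #|NC|.
  have -> : #|NC :&: Bd| = \sum_(e in NC) (e \in Bd).
    by rewrite -sum1_card big_mkcond [RHS]big_mkcond; apply: eq_bigr => e _; rewrite inE;
      case: (e \in NC); case: (e \in Bd).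
  rewrite -big_split /= mulnC -sum_nat_const.
  by apply: eq_bigr => e _; case: (e \in Bd).
have sub : #|NC| + #|Bd :\: NC| + #|Cst| <= #|Om|.
  have d1 : [disjoint NC & Bd :\: NC].
    by rewrite -setI_eq0; apply/eqP/setP => e; rewrite !inE; case: const_on.
  have d2 : [disjoint NC :|: (Bd :\: NC) & Cst].
    rewrite -setI_eq0; apply/eqP/setP => e; rewrite !inE.
    case eC : (e \in Cst); last by rewrite andbF.
    by rewrite hC //= (disjointFr dCB eC).
  have e1 : #|NC :|: (Bd :\: NC)| = #|NC| + #|Bd :\: NC|.
    by apply/eqP; rewrite leq_card_setU.
  have e2 : #|NC :|: (Bd :\: NC) :|: Cst| = #|NC :|: (Bd :\: NC)| + #|Cst|.
    by apply/eqP; rewrite leq_card_setU.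
  rewrite -e1 -e2; apply/subset_leq_card; rewrite !subUset CO !andbT.
  apply/andP; split; last exact: subset_trans (subsetDl _ _) BO.
  by apply/subsetP => e; rewrite inE => /XOm[].
have cB : #|Bd| = #|NC :&: Bd| + #|Bd :\: NC|.
  by rewrite setIC -(cardsID NC Bd).
lia.
Qed.
End Families.

(** * Cubes of related graphs *)

Section Cubes.
Variable E : finType.
Implicit Types (X Y : {set {set E}}) (G H K x y z : {set E}) (e f : E) (p q : {perm E}).

Lemma cubeP p x K :
  reflect (forall e, (e \in x) && (e \notin K) = (p e \in K) && (p e \notin x))
          (K \in cube p x).
Proof.
have mem e : (p e \in p @: (x :\: K)) = (e \in x) && (e \notin K).
  by rewrite mem_imset ?inE 1?andbC //; apply: perm_inj.
rewrite inE; apply: (iffP eqP) => [h e|h]; first by rewrite -mem h inE andbC.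
by apply/setP => e; rewrite -[e](permKV p) mem h inE andbC.
Qed.

Lemma cubeV p x K : (K \in cube p x) = (x \in cube p^-1 K).
Proof.
apply/cubeP/cubeP => h e; first by rewrite -{1 2}[e](permKV p) -h.
by have := h (p e); rewrite permK => <-.
Qed.

(** The element whose change accompanies a change of [e] along the cube: [e] in [x] leaves exactly
    when [p e] enters, and [e] outside [x] enters exactly when its preimage leaves. If [e] and its
    partner lie on the same side of [x], this exchange is impossible and [e] is constant. *)
Definition partner p x e := if e \in x then p e else (p^-1 e)%g.

Lemma cube_partner p x K e : K \in cube p x -> (partner p x e \in x) = (e \notin x) ->
  (e \in K) (+) (e \in x) = (partner p x e \in K) (+) (partner p x e \in x).
Proof.
move=> /cubeP h; rewrite /partner; case: ifP => ex px.
  by have := h e; rewrite ex px /=; do 2!case: (_ \in K).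
by have := h (p^-1 e)%g; rewrite permKV px ex /=; do 2!case: (_ \in K).
Qed.

Lemma cube_const p x X e : X \subset cube p x -> (partner p x e \in x) = (e \in x) ->
  const_on X e.
Proof.
move=> /subsetP Xc h; apply/const_onP => K K' /Xc/cubeP hK /Xc/cubeP hK'.
move: h; rewrite /partner; case: ifP => ex px.
  have := hK e; have := hK' e; rewrite ex px /= !andbF.
  by move=> /negbFE -> /negbFE ->.
by have := hK (p^-1 e)%g; have := hK' (p^-1 e)%g; rewrite permKV px ex /= !andbT => <- <-.
Qed.

Section Nonconst.
Variables (p : {perm E}) (x : {set E}) (X : {set {set E}}) (e : E).
Hypotheses (Xc : X \subset cube p x) (nc : ~~ const_on X e).

Lemma nonconst_partner : (partner p x e \in x) = (e \notin x).
Proof.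
have : (partner p x e \in x) != (e \in x) by apply: contra nc => /eqP; apply: cube_const Xc.
by do 2!case: (_ \in x).
Qed.

Lemma nonconst_partner_neq : partner p x e != e.
Proof. by apply/eqP => pe; have := nonconst_partner; rewrite pe; case: (e \in x). Qed.

Lemma nonconst_linked : linked X e (partner p x e).
Proof.
apply/linkedP => K K' /(subsetP Xc) hK /(subsetP Xc) hK'.
have := cube_partner hK nonconst_partner; have := cube_partner hK' nonconst_partner.
rewrite nonconst_partner.
by case: (e \in x); do 4!case: (_ \in _).
Qed.

Lemma nonconst_antisym K : K \in X -> (partner p x e \in K) = (e \notin K).
Proof.
move=> /(subsetP Xc) hK; have := cube_partner hK nonconst_partner.
by rewrite nonconst_partner; case: (e \in x); do 2!case: (_ \in K).
Qed.

Lemma nonconst_class_ge2 : 1 < #|link_class X e|.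
Proof.
apply/card_gt1P; exists e, (partner p x e); split.
- exact: mem_link_class.
- by rewrite inE nonconst_linked.
- by rewrite eq_sym nonconst_partner_neq.
Qed.

Lemma nonconst_class_ge3 f : linked X e f -> f != e -> f != partner p x e ->
  2 < #|link_class X e|.
Proof.
move=> ef fe fp; apply/card_gt2P; exists e, (partner p x e), f; split; split.
- exact: mem_link_class.
- by rewrite inE nonconst_linked.
- by rewrite inE.
- by rewrite eq_sym nonconst_partner_neq.
- by rewrite eq_sym.
- by [].
Qed.
End Nonconst.

Lemma cube_refl p x : x \in cube p x.
Proof. by rewrite inE setDv imset0. Qed.

Section Involutive.
Variables (p : {perm E}).
Hypothesis pp : (p * p = 1)%g.

Lemma invo e : p (p e) = e. Proof. by rewrite -permM pp perm1. Qed.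
Lemma invoV : (p^-1 = p)%g. Proof. by apply: (mulgI p); rewrite mulgV pp. Qed.

Lemma cube_sym x y : (y \in cube p x) = (x \in cube p y).
Proof. by rewrite cubeV invoV. Qed.

(** For an involution, membership in the cube means having as many elements as [x] in every orbit of
    [p], which is an equivalence relation; hence cubes of involutions are cliques and partition all
    graphs. *)
Lemma cube_trans x y z : y \in cube p x -> z \in cube p y -> z \in cube p x.
Proof.
move=> /cubeP xy /cubeP yz; apply/cubeP => e.
move: (xy e) (xy (p e)) (yz e) (yz (p e)); rewrite invo.
by do 6!case: (_ \in _).
Qed.

Lemma cube_eq x y : y \in cube p x -> cube p y = cube p x.
Proof.
move=> xy; apply/setP => z; apply/idP/idP; first exact: cube_trans.
by apply: cube_trans; rewrite cube_sym.
Qed.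
End Involutive.

(** Approximate information becomes exact: fixing the set of at most [Er] exceptions costs about
    [Er] log |Om| bits. *)
Lemma fiber_small (Om : {set E}) Y (D : {set E} -> {set E}) Er :
  (forall y, y \in Y -> D y \subset Om) -> (forall y, y \in Y -> #|D y| <= Er) ->
  exists D0, #|Y| <= (#|Om| + 1) ^ Er * #|[set y in Y | D y == D0]|.
Proof.
move=> DO DE; have [->|Y0] := eqVneq Y set0; first by exists set0; rewrite cards0.
have fB y : y \in Y -> D y \in [set D' : {set E} | (D' \subset Om) && (#|D'| <= Er)].
  by move=> yY; rewrite inE DO // DE.
have [D0 _ h] := pigeonhole fB Y0.
exists D0; apply: (leq_trans h); rewrite leq_mul2r; apply/orP; right.
exact: card_small_subsets.
Qed.

Section Ground.
Variable Om : {set E}.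

Lemma cube_sub p x K : (forall e, (p e \in Om) = (e \in Om)) -> x \subset Om ->
  K \in cube p x -> K \subset Om.
Proof.
move=> pO /subsetP xO /cubeP h; apply/subsetP => e eK.
have [/xO //|ex] := boolP (e \in x).
have := h (p^-1 e)%g; rewrite permKV eK ex /= => /andP[/xO].
by rewrite -pO permKV.
Qed.

Lemma card_cube_classes p x X (Cst Bd : {set E}) :
  (forall e, (p e \in Om) = (e \in Om)) -> x \subset Om -> X \subset cube p x ->
  Cst \subset Om -> Bd \subset Om -> [disjoint Cst & Bd] ->
  (forall e, e \in Cst -> const_on X e) ->
  (forall e, e \in Bd -> ~~ const_on X e -> 2 < #|link_class X e|) ->
  exists k, #|X| <= 2 ^ k /\ 6 * k + #|Bd| + 3 * #|Cst| <= 3 * #|Om|.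
Proof.
move=> pO xO Xc CO BO dCB hC hB; apply: card_linked_family => //.
move=> e nc; split; last exact: nonconst_class_ge2 Xc nc.
apply: contraR nc => eO; apply/const_onP => K K' /(subsetP Xc) hK /(subsetP Xc) hK'.
by rewrite !(contraNF (subsetP (cube_sub pO xO _) _) eO).
Qed.

Lemma card_cube_family p x X (Cst Bd : {set E}) :
  (forall e, (p e \in Om) = (e \in Om)) -> x \subset Om -> X \subset cube p x ->
  Cst \subset Om -> Bd \subset Om -> [disjoint Cst & Bd] ->
  (forall e, e \in Cst -> const_on X e) ->
  (forall e, e \in Bd -> ~~ const_on X e ->
     exists f, [/\ linked X e f, f != e & f != partner p x e]) ->
  exists k, #|X| <= 2 ^ k /\ 6 * k + #|Bd| + 3 * #|Cst| <= 3 * #|Om|.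
Proof.
move=> pO xO Xc CO BO dCB hC hB; apply: (card_cube_classes pO xO Xc CO BO dCB hC) => e eB nc.
by have [f []] := hB e eB nc; apply: nonconst_class_ge3 Xc nc f.
Qed.

(** For [p] preserving [Om], [defect] vanishes when [p] exchanges [x] with its complement in [Om],
    and [asym] vanishes when [p] is an automorphism of [x]. *)
Definition defect p x := #|[set e in Om | (e \in x) == (p e \in x)]|.
Definition asym p x := #|[set e in Om | (e \in x) != (p e \in x)]|.
Definition moved p := #|[set e in Om | p e != e]|.

Lemma card_reindex p (P : pred E) : (forall e, (p e \in Om) = (e \in Om)) ->
  #|[set e in Om | P (p e)]| = #|[set e in Om | P e]|.
Proof.
move=> pO; rewrite -(card_imset _ (@perm_inj _ p)); apply: eq_card => e.
rewrite -[e](permKV p) mem_imset; last exact: perm_inj.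
by rewrite !inE pO.
Qed.

Lemma defectV p x : (forall e, (p e \in Om) = (e \in Om)) -> defect p^-1 x = defect p x.
Proof.
move=> pO; rewrite /defect -(card_reindex _ pO); apply: eq_card => e.
by rewrite !inE permK eq_sym.
Qed.

(** Composing two maps that nearly complement [x] gives one that nearly preserves it. *)
Lemma asym_defect p q x : (forall e, (p e \in Om) = (e \in Om)) ->
  asym (p^-1 * q) x <= defect p x + defect q x.
Proof.
move=> pO; rewrite /asym -(card_reindex _ pO).
apply: leq_trans (leq_card_setU _ _); apply/subset_leq_card/subsetP => e.
rewrite !inE permM permK; case: (e \in Om) => //=.
by do 3!case: (_ \in x).
Qed.

(** If [e] and [p e] both lie in [x], then [e] can never leave; if both lie outside, then [p e] can
    never enter. These constant elements are distinct, one for each defect, and each costs half a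
    bit. *)
Lemma card_cube_defect p x X : (forall e, (p e \in Om) = (e \in Om)) -> x \subset Om ->
  X \subset cube p x -> exists k, #|X| <= 2 ^ k /\ 6 * k + 3 * defect p x <= 3 * #|Om|.
Proof.
move=> pO xO Xc.
pose A := [set e in Om | (e \in x) && (p e \in x)].
pose B := [set e in Om | (e \notin x) && (p e \notin x)].
have AB : [disjoint A & p @: B].
  rewrite -setI_eq0; apply/eqP/setP => e; rewrite !inE; apply/negP => /andP[/and3P[_ ex _]].
  by case/imsetP => f; rewrite inE => /and3P[_ _ pf] ef; rewrite ef (negbTE pf) in ex.
have cAB : #|A :|: p @: B| = defect p x.
  have -> : #|A :|: p @: B| = #|A| + #|p @: B| by apply/eqP; rewrite leq_card_setU.
  rewrite (card_imset _ (@perm_inj _ p)).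
  have <- : #|A :|: B| = #|A| + #|B|.
    apply/eqP; rewrite leq_card_setU -setI_eq0; apply/eqP/setP => e; rewrite !inE.
    by case: (e \in x); rewrite ?andbF.
  by apply: eq_card => e; rewrite !inE; case: (e \in Om); do 2!case: (_ \in x).
have [//|||||k [Xk hk]] := @card_cube_family p x X (A :|: p @: B) set0 pO xO Xc.
- rewrite subUset; apply/andP; split; first by apply/subsetP => e; rewrite inE => /andP[].
  by apply/subsetP => _ /imsetP[e eB ->]; rewrite pO; move: eB; rewrite inE => /andP[].
- exact: sub0set.
- by rewrite -setI_eq0 setI0.
- move=> e; rewrite in_setU => /orP[|/imsetP[f]]; rewrite inE => /and3P[_ h h'].
    by apply: (cube_const Xc); rewrite /partner h h'.
  by move=> ->; apply: (cube_const Xc); rewrite /partner (negbTE h') permK (negbTE h).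
- by move=> e; rewrite inE.
by exists k; split => //; rewrite cards0 cAB in hk; lia.
Qed.

(** Once the set where [q] changes membership is fixed, [e] and [q e] are linked. Outside that set
    [q e] agrees with [e], whereas the partner of [e] under [p] disagrees with it, so [q e] is a
    third element of the class whenever [q] moves [e]. *)
Lemma card_nonrigid p q x Er : (forall e, (p e \in Om) = (e \in Om)) ->
  (forall e, (q e \in Om) = (e \in Om)) -> x \subset Om ->
  exists k, #|[set y in cube p x | asym q y <= Er]| <= (#|Om| + 1) ^ Er * 2 ^ k /\
    6 * k + moved q <= 3 * #|Om| + Er.
Proof.
move=> pO qO xO.
set Y := [set y in _ | _].
pose D y := [set e in Om | (e \in y) != (q e \in y)].
have [||D0 hD0] := @fiber_small Om Y D Er.
- by move=> y _; apply/subsetP => e; rewrite inE => /andP[].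
- by move=> y; rewrite inE => /andP[].
pose X := [set y in Y | D y == D0].
have XY : X \subset Y by apply/subsetP => y; rewrite inE => /andP[].
have Xc : X \subset cube p x.
  by apply: (subset_trans XY); apply/subsetP => y; rewrite inE => /andP[].
have memD y e : y \in X -> e \in Om -> (e \in D0) = ((e \in y) != (q e \in y)).
  by rewrite inE => /andP[_ /eqP <-] eO; rewrite inE eO.
have [X0|[y0 y0X]] := set_0Vmem X.
  exists 0; move: hD0; rewrite -/X X0 cards0 muln0 leqn0 => /eqP ->; split => //.
  have : moved q <= #|Om| by apply/subset_leq_card/subsetP => e; rewrite inE => /andP[].
  lia.
have qlink e : e \in Om -> linked X e (q e).
  move=> eO; apply/linkedP => K K' KX K'X.
  by have := memD K e KX eO; rewrite (memD K' e K'X eO); do 4!case: (_ \in _).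
pose Bd := [set e in Om | q e != e] :\: D0.
have [//|||||k [Xk hk]] := @card_cube_family p x X set0 Bd pO xO Xc.
- exact: sub0set.
- by apply/subsetP => e; rewrite !inE => /andP[_ /andP[]].
- by rewrite -setI_eq0 set0I.
- by move=> e; rewrite inE.
- move=> e; rewrite !inE => /andP[eD /andP[eO qe]] nc; exists (q e); split => //.
    exact: qlink.
  apply: contra eD => /eqP qp; rewrite (memD y0) // qp (nonconst_antisym Xc nc y0X).
  by case: (e \in y0).
exists k; split; first by apply: (leq_trans hD0); rewrite leq_mul2l Xk orbT.
have : moved q <= #|Bd| + Er.
  rewrite /moved -(cardsID D0) addnC leq_add2l.
  apply: (@leq_trans #|D0|); first by apply: subset_leq_card; apply: subsetIr.
  have := subsetP XY _ y0X; rewrite inE => /andP[_].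
  by move: y0X; rewrite inE => /andP[_ /eqP <-].
by move: hk; rewrite cards0; lia.
Qed.

Lemma fiber_prescribed Y (S G : {set E}) Er : S \subset Om ->
  (forall y, y \in Y -> #|[set e in S | (e \in y) != (e \in G)]| <= Er) ->
  exists Y' : {set {set E}}, [/\ Y' \subset Y, #|Y| <= (#|Om| + 1) ^ Er * #|Y'| &
    forall e, e \in S -> const_on Y' e].
Proof.
move=> SO h.
have [||D0 hD0] := @fiber_small Om Y (fun y => [set e in S | (e \in y) != (e \in G)]) Er.
- by move=> y _; apply: subset_trans SO; apply/subsetP => e; rewrite inE => /andP[].
- exact: h.
eexists; split; [|exact: hD0|]; first by apply/subsetP => y; rewrite inE => /andP[].
move=> e eS; apply/const_onP => K K'; rewrite !inE => /andP[_ /eqP <-] /andP[_ /eqP/setP/(_ e)].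
by rewrite !inE eS /=; do 3!case: (_ \in _).
Qed.
End Ground.
End Cubes.

(** * Permutations acting on r-sets *)

Lemma card_between (T : finType) (I O : {set T}) r : [disjoint I & O] -> #|I| <= r ->
  'C(#|T| - #|I| - #|O|, r - #|I|) <=
  #|[set e : {set T} | [&& #|e| == r, I \subset e & [disjoint e & O]]]|.
Proof.
move=> dIO Ir.
have cA : #|~: (I :|: O)| = #|T| - #|I| - #|O|.
  have e1 : #|I :|: O| = #|I| + #|O| by apply/eqP; rewrite leq_card_setU.
  by have := cardsC (I :|: O); rewrite e1; lia.
rewrite -cA -cards_draws.
set B := [set A : {set T} | _].
have dB (A : {set T}) : A \in B -> [disjoint A & I :|: O].
  rewrite inE => /andP[/subsetP AS _]; rewrite -setI_eq0; apply/eqP/setP => v.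
  by rewrite [in LHS]inE in_set0; apply/negP => /andP[/AS]; rewrite inE => /negP.
have dBI (A : {set T}) : A \in B -> [disjoint I & A].
  by move=> /dB; rewrite disjoint_sym => /(disjointWl (subsetUl I O)).
rewrite -(@card_in_imset _ _ (fun A => I :|: A) (mem B)).
  apply/subset_leq_card/subsetP => _ /imsetP[A AB ->]; rewrite inE subsetUl /=.
  have -> : #|I :|: A| = #|I| + #|A| by apply/eqP; rewrite leq_card_setU dBI.
  apply/andP; split; first by move: AB; rewrite inE => /andP[_ /eqP ->]; rewrite subnKC.
  rewrite -setI_eq0 setIUl setU_eq0 !setI_eq0 dIO /=.
  by apply: disjointWr (dB A AB); apply: subsetUr.
move=> A A' AB A'B /setP h; apply/setP => v; have := h v; rewrite !inE.
have [vI _|//] := boolP (v \in I).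
by rewrite (disjointFr (dBI _ AB) vI) (disjointFr (dBI _ A'B) vI).
Qed.

Section Action.
Variable n : nat.
Implicit Types (s t phi psi : 'S_n) (e : {set 'I_n}) (v w : 'I_n).

Definition edge_perm s : {perm {set 'I_n}} := perm (imset_inj (@perm_inj _ s)).

Lemma edge_permE s e : edge_perm s e = s @: e. Proof. by rewrite permE. Qed.

Lemma edge_permM s t : (edge_perm (s * t) = edge_perm s * edge_perm t)%g.
Proof.
apply/permP => e; rewrite permM !edge_permE -imset_comp.
by apply: eq_imset => v; rewrite permM.
Qed.

Lemma edge_perm1 : (edge_perm 1 = 1)%g.
Proof.
apply/permP => e; rewrite edge_permE perm1 -[RHS]imset_id.
by apply: eq_imset => v; rewrite perm1.
Qed.

Lemma edge_permV s : (edge_perm s^-1 = (edge_perm s)^-1)%g.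
Proof. by apply: (mulgI (edge_perm s)); rewrite -edge_permM !mulgV edge_perm1. Qed.

Definition redges r := [set e : {set 'I_n} | #|e| == r].

Lemma card_redges r : #|redges r| = 'C(n, r).
Proof.
rewrite /redges -[in RHS](card_ord n) -cardsT -cards_draws.
by apply: eq_card => e; rewrite !inE subsetT.
Qed.

Lemma redges_pres r s e : (edge_perm s e \in redges r) = (e \in redges r).
Proof. by rewrite !inE edge_permE card_imset //; apply: perm_inj. Qed.

Lemma set2_perm s v w : s @: [set v; w] = [set s v; s w].
Proof. by rewrite imsetU1 imset_set1. Qed.

Definition supp s := [set v | s v != v].

Lemma supp_eq0 s : (supp s == set0) = (s == 1%g).
Proof.
apply/eqP/eqP => [/setP h|->]; last by apply/setP => v; rewrite !inE perm1 eqxx.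
by apply/permP => v; have := h v; rewrite !inE perm1 => /negbFE/eqP.
Qed.

Lemma supp_perm s v : (s v \in supp s) = (v \in supp s).
Proof. by rewrite !inE (inj_eq perm_inj). Qed.

Lemma card_supp_gt1 s : s != 1%g -> 1 < #|supp s|.
Proof.
rewrite -supp_eq0 => /set0Pn[v vs]; apply/card_gt1P; exists v, (s v).
by split; rewrite ?supp_perm //; move: vs; rewrite inE eq_sym.
Qed.

(** A permutation is encoded by the graph of its restriction to the support, so that counting
    permutations of small support becomes counting small sets of pairs. *)
Let code s := [set (v, s v) | v in supp s].

Lemma card_code s : #|code s| = #|supp s|.
Proof. by rewrite card_imset // => v w []. Qed.

Lemma code_inj : injective code.
Proof.
move=> s t /setP h; apply/permP => v.
have mem s' u : ((v, u) \in code s') = (u == s' v) && (u != v).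
  apply/imsetP/andP => [[w ws [-> ->]]|[/eqP -> uv]]; last by exists v; rewrite ?inE.
  by rewrite eqxx; move: ws; rewrite inE.
have := h (v, s v); have := h (v, t v); rewrite !mem !eqxx /=.
have [sv|_] := eqVneq (s v) v; last by move=> _ /=; rewrite andbT => /esym/eqP.
have [tv _|_] := eqVneq (t v) v; first by rewrite sv tv.
by rewrite !andbT => /eqP ->.
Qed.

Lemma card_supp_le d : #|[set s | #|supp s| <= d]| <= (n * n + 1) ^ d.
Proof.
rewrite -(card_imset _ code_inj).
have <- : #|[set: 'I_n * 'I_n]| = n * n by rewrite cardsT card_prod card_ord.
apply: leq_trans (card_small_subsets _ _); apply/subset_leq_card/subsetP => _ /imsetP[s + ->].
by rewrite !inE subsetT card_code.
Qed.

Lemma card_supp_eq d : #|[set s | #|supp s| == d]| <= (n * n) ^ d.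
Proof.
rewrite -(card_imset _ code_inj).
have cT : #|[set: 'I_n * 'I_n]| = n * n by rewrite cardsT card_prod card_ord.
rewrite -cT; apply: leq_trans (bin_le_exp _ _); rewrite -cards_draws.
apply/subset_leq_card/subsetP => _ /imsetP[s + ->].
by rewrite !inE subsetT card_code.
Qed.

(** At most n^(2d) <= 2^(2dl) permutations differ from [psi] in exactly d points, so a loss of 3dl
    bits for each leaves M / 2^(dl) for distance d, and the geometric series sums to at most M. *)
Lemma sum_over_perms (P : pred 'S_n) psi (a : 'S_n -> nat) l M : n <= 2 ^ l -> 0 < l ->
  (forall phi, P phi -> phi != psi ->
     a phi * 2 ^ (3 * #|supp (phi * psi^-1)| * l) <= M) ->
  \sum_(phi | P phi && (phi != psi)) a phi <= M.
Proof.
move=> nl l0 h.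
pose d phi := #|supp (phi * psi^-1)|.
have dn phi : d phi < n.+1 by rewrite ltnS -[n in _ <= n]card_ord max_card.
have d0 phi : phi != psi -> 0 < d phi.
  move=> neq; apply: ltnW; apply: card_supp_gt1; apply: contraNneq neq => h1.
  by rewrite -[phi](mulgKV psi) h1 mul1g.
rewrite (partition_big (fun phi => Ordinal (dn phi)) predT) //=.
apply: leq_trans (sum_divn_exp2 M n.+1).
apply: (@leq_trans (\sum_(i < n.+1) (if i == 0 :> nat then 0 else M %/ 2 ^ i))); last first.
  rewrite -(big_mkord xpredT (fun i => if i == 0 then 0 else M %/ 2 ^ i)) big_ltn //= add0n.
  by rewrite !big_nat; apply: leq_sum => i /andP[]; case: i.
apply: leq_sum => -[i lt_i] _ /=; case: eqP => [i0|/eqP i0].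
  rewrite big1 // => phi /andP[/andP[_ /d0]]; rewrite -val_eqE /= i0.
  by case: (d phi).
apply: (@leq_trans (\sum_(phi | d phi == i) M %/ 2 ^ (3 * i * l))).
  rewrite [X in X <= _]big_mkcond [X in _ <= X]big_mkcond; apply: leq_sum => phi _.
  case: ifP => // /andP[/andP[Pp np]]; rewrite -val_eqE /= => di; rewrite di.
  by rewrite leq_divRL ?expn_gt0 // -(eqP di) h.
rewrite sum_nat_const.
have : #|[pred phi | d phi == i]| <= 2 ^ (2 * i * l).
  rewrite -(card_imset _ (mulIg (psi^-1)%g)); apply: (@leq_trans #|[set s | #|supp s| == i]|).
    by apply/subset_leq_card/subsetP => _ /imsetP[phi + ->]; rewrite !inE.
  apply: (leq_trans (card_supp_eq i)).
  have -> : 2 ^ (2 * i * l) = (2 ^ l * 2 ^ l) ^ i by rewrite -expnD -expnM; congr (_ ^ _); lia.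
  by case: i i0 {lt_i} => // i _; rewrite leq_exp2r // leq_mul.
move=> hc; apply: leq_trans (leq_mul hc (leqnn _)) _.
have -> : 2 ^ (3 * i * l) = 2 ^ (i * l) * 2 ^ (2 * i * l) by rewrite -expnD; congr (_ ^ _); lia.
rewrite divnMA mulnC; apply: leq_trans (leq_trunc_div _ _) _.
apply: leq_div2l; rewrite ?expn_gt0 // leq_exp2l // leq_pmulr //.
Qed.
End Action.

Lemma moved2_arith n d x y z b : d <= n -> x <= z + (y + b) -> b <= d ->
  2 * y = (n - d) * (n - d).-1 -> 2 * x = n * n.-1 -> d * (2 * n - d - 3) <= 2 * z.
Proof.
move=> dn h bd; have [k ->] : exists k, n = k + d by exists (n - d); rewrite subnK.
rewrite addnK => y2 x2.
have pred a : a * a.-1 + a = a * a by case: a => // a; rewrite /= mulnS addnC mulnC.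
have e1 := pred k; have e2 := pred (k + d).
have [small|big] := leqP (2 * (k + d) - d) 3.
  have -> : 2 * (k + d) - d - 3 = 0 by lia.
  by rewrite muln0.
have e3 : d * (2 * (k + d) - d - 3) + d * 3 = d * (2 * k + d) by rewrite -mulnDr; congr (_ * _);
  lia.
by move: (_ - 3) e3 => m; lia.
Qed.

Section Moved.
Variable n : nat.
Implicit Types (s t phi psi : 'S_n) (e : {set 'I_n}) (v w : 'I_n).

(** Every edge containing a moved vertex v but not [s v] is moved. *)
Lemma moved_ge r s : s != 1%g -> 0 < r ->
  'C(n - 2, r - 1) <= moved (redges n r) (edge_perm s).
Proof.
rewrite -supp_eq0 => /set0Pn[v]; rewrite inE => sv r0.
have dj : [disjoint [set v] & [set s v]].
  by rewrite -setI_eq0; apply/eqP/setP => w; rewrite !inE; case: eqP => // ->;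
    rewrite eq_sym (negbTE sv).
have := card_between dj; rewrite !cards1 card_ord => /(_ r r0).
rewrite -subnDA => /leq_trans; apply; apply/subset_leq_card/subsetP => e.
rewrite !inE => /and3P[-> ve de] /=; rewrite edge_permE; apply: contraL de => /eqP se.
rewrite -setI_eq0; apply/set0Pn; exists (s v); rewrite !inE eqxx andbT -se imset_f //.
by rewrite -sub1set.
Qed.

(** A pair fixed by [s] either avoids the support or has the form {v, s v}, so at most C(n-d, 2) + d
    pairs are fixed, where d is the size of the support. *)
Lemma moved2_ge s :
  #|supp s| * (2 * n - #|supp s| - 3) <= 2 * moved (redges n 2) (edge_perm s).
Proof.
set d := #|supp s|.
have dn : d <= n by rewrite -[n in _ <= n]card_ord max_card.
pose A := [set e : {set 'I_n} | (e \subset ~: supp s) & #|e| == 2].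
pose B := [set [set v; s v] | v in supp s].
have cA : #|A| = 'C(n - d, 2) by rewrite cards_draws; congr 'C(_, 2); have := cardsC (supp s);
  rewrite card_ord; lia.
have cB : #|B| <= d by apply: leq_imset_card.
have : 'C(n, 2) <= moved (redges n 2) (edge_perm s) + (#|A| + #|B|).
  rewrite -card_redges -(cardsID [set e | edge_perm s e != e]) leq_add //.
    by apply/subset_leq_card/subsetP => e; rewrite !inE.
  apply: leq_trans (leq_card_setU _ _); apply/subset_leq_card/subsetP => e.
  rewrite 3!inE negbK => /andP[/eqP se e2].
  have /cards2P[a [b [ab e_ab]]] := e2.
  move: se; rewrite edge_permE e_ab set2_perm => /setP se.
  have [sa|sa] := eqVneq (s a) a; last first.
    rewrite in_setU; apply/orP; right; apply/imsetP; exists a; rewrite ?inE //.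
    by have := se (s a); rewrite !inE eqxx (negbTE sa) /= => /esym/eqP ->.
  have [sb|sb] := eqVneq (s b) b; last first.
    rewrite in_setU; apply/orP; right; apply/imsetP; exists b; rewrite ?inE //.
    by have := se (s b); rewrite !inE eqxx (negbTE sb) orbT orbF setUC => /esym/eqP ->.
  rewrite in_setU; apply/orP; left; rewrite inE cards2 ab andbT.
  by apply/subsetP => c; rewrite !inE => /orP[]/eqP ->; rewrite ?sa ?sb eqxx.
have two m : 2 * 'C(m, 2) = m * m.-1 by rewrite mul2n bin2 -[RHS]odd_double_half oddM;
  case: m => // m /=; rewrite andNb.
rewrite cA => h; have x2 := two n; have y2 := two (n - d).
exact: moved2_arith dn h cB y2 x2.
Qed.

(** * Edges fixed by an involution *)

Section Involution.
Variable psi : 'S_n.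
Hypothesis psi2 : (psi * psi = 1)%g.

Lemma psiK v : psi (psi v) = v. Proof. by rewrite -permM psi2 perm1. Qed.

(** Take the 2-cycles of [psi] and pair the fixed points arbitrarily; for odd |A| one fixed point
    remains. *)
Lemma invariant_pairs (A : {set 'I_n}) : (forall v, (psi v \in A) = (v \in A)) ->
  exists P : {set {set 'I_n}}, [/\ forall e, e \in P -> [/\ #|e| = 2, psi @: e = e & e \subset A],
     trivIset P, #|P| = #|A|./2 & odd #|A| -> exists u, [/\ psi u = u, u \in A & u \notin cover P]].
Proof.
move: {2}#|A| (leqnn #|A|) => m; elim: m A => [|m IH] A.
  rewrite leqn0 cards_eq0 => /eqP -> _; exists set0; rewrite !cards0.
  split=> //; first by move=> e; rewrite inE.
  by apply/trivIsetP => e f; rewrite inE.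
move=> Am Ainv.
have step a b : a \in A -> b \in A -> a != b -> psi @: [set a; b] = [set a; b] ->
  exists P : {set {set 'I_n}}, [/\ forall e, e \in P -> [/\ #|e| = 2, psi @: e = e & e \subset A],
     trivIset P, #|P| = #|A|./2 & odd #|A| -> exists u, [/\ psi u = u, u \in A & u \notin cover P]].
  move=> aA bA ab inv_ab.
  have sub : [set a; b] \subset A by rewrite subUset !sub1set aA bA.
  have cA : #|A| = #|A :\: [set a; b]|.+2.
    by have := cardsD A [set a; b]; rewrite (setIidPr sub) cards2 ab;
      have := subset_leq_card sub; rewrite cards2 ab; lia.
  have [|v|P [hP tP cP uP]] := IH (A :\: [set a; b]); first by lia.
    rewrite in_setD [in RHS]in_setD Ainv; congr (~~ _ && _).
    by rewrite -[in LHS]inv_ab mem_imset //; apply: perm_inj.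
  have nP : [set a; b] \notin P.
    by apply/negP => /hP[_ _ /subsetP/(_ a)]; rewrite !inE eqxx => /(_ isT).
  exists ([set a; b] |: P); split.
  - move=> e; rewrite in_setU1 => /orP[/eqP ->|/hP[? ? se]]; first by rewrite cards2 ab.
    by split=> //; apply: subset_trans se (subsetDl _ _).
  - have P0 : set0 \notin P by apply/negP => /hP[]; rewrite cards0.
    have dj : {in P, forall B : {set 'I_n}, [disjoint [set a; b] & B]}.
      move=> e /hP[_ _ se]; rewrite disjoint_sym disjoints_subset.
      by apply: subset_trans se _; rewrite setDE subsetIr.
    by have [] := trivIsetU1 dj tP P0.
  - by rewrite cardsU1 nP cP cA.
  - rewrite cA /= negbK => /uP[u [pu uA uc]]; exists u; split=> //.
      by move: uA; rewrite inE => /andP[].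
    rewrite /cover bigcup_setU big_set1 in_setU negb_or; apply/andP; split=> //.
    by move: uA; rewrite inE => /andP[].
case: (boolP [exists v in A, psi v != v]).
  case/exists_inP => v vA pv; apply: (step v (psi v)); rewrite ?Ainv // 1?eq_sym //.
  by rewrite set2_perm psiK setUC.
rewrite negb_exists_in => /forall_inP fixA.
have {}fixA v : v \in A -> psi v = v by move=> /fixA; rewrite negbK => /eqP.
case: (ltnP 1 #|A|) => [/card_gt1P[a [b [aA bA ab]]]|A1].
  by apply: (step a b) => //; rewrite set2_perm !fixA.
exists set0; split.
- by move=> e; rewrite inE.
- by apply/trivIsetP => e f; rewrite inE.
- by rewrite cards0; case: #|A| A1 => [|[]].
- case: (posnP #|A|) => [-> //|/card_gt0P[u uA] _].
  by exists u; rewrite fixA // /cover big_set0 inE.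
Qed.

Definition fixed_edges r := [set e in redges n r | psi @: e == e].

Lemma fixed_edges2_ge : n./2 <= #|fixed_edges 2|.
Proof.
have [|P [hP _ cP _]] := @invariant_pairs setT; first by move=> v; rewrite !inE.
have -> : n./2 = #|P| by rewrite cP cardsT card_ord.
by apply/subset_leq_card/subsetP => e /hP[e2 pe _]; rewrite !inE e2 pe !eqxx.
Qed.

(** With no more than n/2 fixed pairs, the pairing of [invariant_pairs] exhausts them, so they form
    a matching. *)
Lemma fixed_edges2_disjoint e f : #|fixed_edges 2| <= n./2 ->
  e \in fixed_edges 2 -> f \in fixed_edges 2 -> e != f -> [disjoint e & f].
Proof.
move=> le_n; have [|P [hP tP cP _]] := @invariant_pairs setT; first by move=> v; rewrite !inE.
have /eqP <- : P == fixed_edges 2.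
  rewrite eqEcard cP cardsT card_ord le_n andbT.
  by apply/subsetP => e' /hP[e2 pe _]; rewrite !inE e2 pe !eqxx.
by move=> eP fP ef; move/trivIsetP: tP; apply.
Qed.

(** The term subtracted from C(n, r) in f_r(n): every involution fixes at least this many edges, and
    fixed edges carry no bits. *)
Definition min_fixed r := if odd r && ~~ odd n then 0 else 'C(n./2, r./2).

(** A union of r/2 disjoint invariant pairs is fixed; for odd r a fixed vertex outside the pairs is
    added, which exists because n is then odd as well. *)
Lemma fixed_edges_ge r : min_fixed r <= #|fixed_edges r|.
Proof.
rewrite /min_fixed; case: ifP => // odd_rn.
have [|P [hP tP cP uP]] := @invariant_pairs setT; first by move=> v; rewrite !inE.
have [U [cU pU dU]] : exists U : {set 'I_n}, [/\ #|U| = odd r, psi @: U = U & [disjoint U & cover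
  P]].
  case: (boolP (odd r)) odd_rn => [_ /= /negbFE on|_ _].
    have [|u [pu _ uc]] := uP; first by rewrite cardsT card_ord.
    by exists [set u]; rewrite cards1 imset_set1 pu disjoints1.
  by exists set0; rewrite cards0 imset0 -setI_eq0 set0I.
have -> : n./2 = #|P| by rewrite cP cardsT card_ord.
rewrite -cards_draws -(@card_in_imset _ _ (fun Q => U :|: cover Q) (mem [set A : {set {set 'I_n}}
  | A \subset P & #|A| == r./2])).
  apply/subset_leq_card/subsetP => _ /imsetP[Q + ->]; rewrite inE => /andP[QP cQ].
  have dQ : [disjoint U & cover Q].
    apply: disjointWr dU; apply/subsetP => v /bigcupP[e eQ ve].
    by apply/bigcupP; exists e => //; apply: subsetP eQ.
  have cov : #|cover Q| = 2 * r./2.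
    rewrite -(eqP cQ) -(eqP (trivIsetS QP tP)) mulnC -sum_nat_const.
    by apply: eq_bigr => e /(subsetP QP)/hP[].
  rewrite !inE; apply/andP; split.
    have -> : #|U :|: cover Q| = #|U| + #|cover Q| by apply/eqP; rewrite leq_card_setU.
    by rewrite cU cov mul2n odd_double_half.
  rewrite imsetU pU; apply/eqP; congr (_ :|: _); apply/setP => v.
  have cinv w : w \in cover Q -> psi w \in cover Q.
    case/bigcupP => e eQ we; apply/bigcupP; exists e => //.
    by have [_ <- _] := hP e (subsetP QP e eQ); apply: imset_f.
  apply/imsetP/idP => [[w /cinv + ->] //|vQ].
  by exists (psi v); rewrite ?psiK // cinv.
have sub (Q Q' : {set {set 'I_n}}) : Q \subset P -> Q' \subset P -> U :|: cover Q = U :|: cover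
  Q' -> Q \subset Q'.
  move=> QP QP' eqU; apply/subsetP => e eQ.
  have eP := subsetP QP e eQ.
  have [e2 _ _] := hP e eP.
  have /card_gt0P[v ve] : 0 < #|e| by rewrite e2.
  have vc : v \in cover Q by apply/bigcupP; exists e.
  have vP : v \in cover P by apply/bigcupP; exists e.
  have : v \in U :|: cover Q' by rewrite -eqU inE vc orbT.
  rewrite inE (disjointFl dU vP) /= => /bigcupP[f fQ' vf].
  have [->//|ef] := eqVneq e f.
  move/trivIsetP: tP => /(_ e f eP (subsetP QP' f fQ') ef)/disjointFr/(_ ve).
  by rewrite vf.
move=> Q Q'; rewrite !inE => /andP[QP _] /andP[QP' _] eqU.
apply/eqP; rewrite eqEsubset; apply/andP; split; first exact: sub eqU.
by apply: sub QP _ => //.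
Qed.
End Involution.
End Moved.

(** * Rigid members *)

Lemma leq_expl m n e : m <= n -> m ^ e <= n ^ e.
Proof. by case: e => // e; rewrite leq_exp2r. Qed.

Lemma fact_le_exp n : n`! <= n ^ n.
Proof.
suff h m : m <= n -> m`! <= n ^ m by apply: h.
elim: m => // m IH mn; rewrite factS expnS leq_mul // IH //; exact: ltnW.
Qed.

Lemma card_perms_le n l : n <= 2 ^ l -> #|{: 'S_n}| <= 2 ^ (n * l).
Proof.
move=> nl; rewrite card_Sn; apply: leq_trans (fact_le_exp n) _.
by rewrite mulnC expnM leq_expl.
Qed.

Lemma bin_succ_le n r l : n <= 2 ^ l -> 0 < l -> 'C(n, r) + 1 <= 2 ^ (r.+1 * l).
Proof.
move=> nl l0; have h : 'C(n, r) <= 2 ^ (r * l).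
  by apply: leq_trans (bin_le_exp _ _) _; rewrite mulnC expnM leq_expl.
have h2 : 2 <= 2 ^ l by rewrite -{1}[2]expn1 leq_exp2l.
by rewrite mulSn expnD; have := expn_gt0 2 (r * l); nia.
Qed.

Section Rigidity.
Variables (n r l : nat).
Hypotheses (nl : n <= 2 ^ l) (l0 : 0 < l).
Implicit Types (phi psi s : 'S_n) (x y z : {set {set 'I_n}}).
Local Notation Om := (redges n r).
Local Notation N := 'C(n, r).
Local Notation pcube phi x := (cube (edge_perm phi) x).

Definition rigid (d Er : nat) y :=
  [forall s : 'S_n, (d < #|supp s|) ==> (Er < asym Om (edge_perm s) y)].

(** The threshold 2 * [Er] makes every other permutation lose [Er] bits: its cube at [y] has
    dimension at most N/2 - [Er]. *)
Definition near (Er : nat) y phi := defect Om (edge_perm phi) y <= 2 * Er.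

Lemma nearV Er y phi : near Er y (phi^-1)%g = near Er y phi.
Proof. by rewrite /near edge_permV defectV //; apply: redges_pres. Qed.

(** Two near permutations have total defect at most 4 * [Er], so their quotient nearly preserves [y]
    and rigidity applies to it. *)
Lemma near_rigid d Er y phi psi : rigid d (4 * Er) y -> near Er y phi -> near Er y psi ->
  #|supp (phi^-1 * psi)%g| <= d.
Proof.
move=> /forallP/(_ (phi^-1 * psi)%g)/implyP rig nphi npsi; rewrite leqNgt; apply/negP => /rig.
rewrite ltnNge edge_permM edge_permV => /negP; apply.
apply: leq_trans (asym_defect _ _ (@redges_pres n r phi)) _.
by move: nphi npsi; rewrite /near; clear; lia.
Qed.

Lemma card_all_perms_union (T : finType) (P : pred 'S_n) (A : 'S_n -> {set T}) k :
  (forall s, P s -> #|A s| <= 2 ^ k) -> #|\bigcup_(s | P s) A s| <= 2 ^ (n * l + k).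
Proof.
move=> h; apply: leq_trans (leq_card_bigcup _ _) _.
apply: (@leq_trans (\sum_(s : 'S_n) 2 ^ k)).
  by rewrite big_mkcond; apply: leq_sum => s _; case: ifP => // /h.
by rewrite sum_nat_const expnD leq_mul // card_perms_le.
Qed.

Section Family.
Variable F : {set {set {set 'I_n}}}.
Hypothesis FO : forall x, x \in F -> x \subset Om.
Hypothesis Fdiff : forall x y, x \in F -> y \in F -> exists phi, y \in pcube phi x.

(** The union runs over the permutation leading from a fixed member to [y] and over the one
    violating rigidity, 2nl bits in all; recording at most [Er] edges with changed membership takes
    (r+1) l [Er] further bits. *)
Lemma card_nonrigid_family d Er m : m <= N ->
  (forall s : 'S_n, d < #|supp s| -> m <= moved Om (edge_perm s)) ->
  exists k, #|[set y in F | ~~ rigid d Er y]| <= 2 ^ k /\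
    6 * k + m <= 3 * N + 12 * n * l + 6 * r.+1 * l * Er + Er.
Proof.
move=> mN hm; have [->|[x xF]] := set_0Vmem F.
  exists 0; split; last by lia.
  by rewrite (_ : [set y in set0 | _] = set0) ?cards0 //; apply/setP => y; rewrite !inE.
pose k0 := (3 * N + Er - m) %/ 6.
exists (n * l + (n * l + (r.+1 * l * Er + k0))); split; last first.
  have : 6 * k0 <= 3 * N + Er - m by rewrite mulnC leq_trunc_div.
  by move: k0 => k0; lia.
apply: leq_trans (@card_all_perms_union _ predT (fun phi =>
  \bigcup_(s : 'S_n | d < #|supp s|) [set y in pcube phi x | asym Om (edge_perm s) y <= Er]) _ _).
  apply/subset_leq_card/subsetP => y; rewrite inE => /andP[yF].
  rewrite negb_forall => /existsP[s]; rewrite negb_imply -leqNgt => /andP[ds ys].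
  have [phi hphi] := Fdiff xF yF.
  by apply/bigcupP; exists phi => //; apply/bigcupP; exists s => //; rewrite inE hphi.
move=> phi _; apply: card_all_perms_union => s ds.
have [k [hk hk2]] := @card_nonrigid _ Om (edge_perm phi) (edge_perm s) x Er
  (@redges_pres n r phi) (@redges_pres n r s) (FO xF).
rewrite card_redges in hk hk2.
apply: leq_trans hk _; rewrite expnD; apply: leq_mul.
  by rewrite expnM leq_expl // bin_succ_le.
by rewrite leq_exp2l // leq_divRL //; have := hm s ds; lia.
Qed.

Lemma card_far y Er (Z : {set {set {set 'I_n}}}) : 2 * Er <= N -> y \subset Om ->
  exists k, #|[set z in Z | [exists phi, ~~ near Er y phi && (z \in pcube phi y)]]| <= 2 ^ k /\
    6 * k + 6 * Er <= 3 * N + 6 * n * l.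
Proof.
move=> EN yO; pose k0 := (3 * N - 6 * Er) %/ 6.
exists (n * l + k0); split; last first.
  have : 6 * k0 <= 3 * N - 6 * Er by rewrite mulnC leq_trunc_div.
  by move: k0 => k0; lia.
apply: leq_trans (@card_all_perms_union _ (fun phi => ~~ near Er y phi) (fun phi => pcube phi y)
  _ _).
  apply/subset_leq_card/subsetP => z; rewrite inE => /andP[_ /existsP[phi /andP[h zc]]].
  by apply/bigcupP; exists phi.
move=> phi; rewrite /near -ltnNge => h.
have [k [hk hk2]] := card_cube_defect (@redges_pres n r phi) yO (subxx (pcube phi y)).
apply: leq_trans hk _; rewrite leq_exp2l // leq_divRL //.
by rewrite card_redges in hk2; lia.
Qed.
End Family.
End Rigidity.

(** * Intersections of cubes *)

(** Let l be the logarithm and q = l / b. Then l^k <= b^k 2^(qk), which uses only about half of the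
    exponent l >= 2(k+1)q and leaves room for the constant [A] = c b^k. *)
Lemma polylog_le c k : exists n0, forall n, n0 <= n -> c * up_log 2 n ^ k <= n.
Proof.
pose b := 2 * k.+1; pose A := c * b ^ k.
exists (2 ^ (b * A.+2)) => n hn.
have n1 : 1 < n.
  by apply: leq_trans hn; rewrite -{1}[2]expn1 leq_exp2l // /b; lia.
pose l := up_log 2 n.
have lb : b * A.+2 <= l by rewrite -(@leq_exp2l 2) //; apply: leq_trans hn (up_log2_bound n).
have ln : 2 ^ l.-1 < n by apply: up_log_gtn.
apply: leq_trans (ltnW ln); rewrite -/l.
pose q := l %/ b.
have b0 : 0 < b by [].
have qA : A.+2 <= q by rewrite /q leq_divRL // mulnC.
have l_lt : l <= b * 2 ^ q.
  by apply: leq_trans (ltnW (ltn_ceil l b0)) _; rewrite mulnC leq_mul2l ltn_expl ?orbT.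
have l_ge : q * b <= l by rewrite leq_trunc_div.
apply: (@leq_trans (A * 2 ^ (q * k))).
  by rewrite /A -mulnA expnM -expnMn leq_mul2l leq_expl ?orbT.
apply: (@leq_trans (2 ^ A * 2 ^ (q * k))).
  by rewrite leq_mul2r (ltnW (ltn_expl _ _)) ?orbT.
by rewrite -expnD leq_exp2l //; move: l_ge; rewrite /b; nia.
Qed.

Lemma bin_ge_exp m k : (m - k) ^ k <= 'C(m, k) * k`!.
Proof.
rewrite bin_ffact; elim: k m => [|k IH] m //.
case: m => [|m]; first by rewrite sub0n exp0n.
rewrite ffactSS subSS expnS leq_mul //; lia.
Qed.

Lemma bin_lower c k n : 2 * (c + k) <= n -> n ^ k <= 2 ^ k * k`! * 'C(n - c, k).
Proof.
move=> h; rewrite -mulnA [_`! * _]mulnC.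
apply: (@leq_trans (2 ^ k * (n - c - k) ^ k)); last by rewrite leq_mul2l bin_ge_exp orbT.
by rewrite -expnMn leq_expl //; lia.
Qed.

Lemma leq_bin_shift m k j : 'C(m, k) <= 'C(m + j, k + j).
Proof.
elim: j => [|j IH]; first by rewrite !addn0.
by rewrite !addnS binS; apply: leq_trans IH (leq_addl _ _).
Qed.

Lemma leq_bin_drop n r i o : i <= 2 -> o <= 2 -> 3 <= r -> 6 <= n ->
  'C(n - 6, r - 3) <= 'C(n - i.+1 - o.+1, r - i.+1).
Proof.
move=> i2 o2 r3 n6; have -> : r - i.+1 = r - 3 + (2 - i) by lia.
by apply: leq_trans (leq_bin_shift _ _ (2 - i)) _; apply: leq_bin2l; lia.
Qed.

Section CrossCubes.
Variables (n r : nat).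
Implicit Types (phi psi s : 'S_n) (x y z e : {set 'I_n}).
Local Notation Om := (redges n r).
Local Notation pcube phi x := (cube (edge_perm phi) x).

Lemma edge_perm_invo psi : (psi * psi = 1)%g -> (edge_perm psi * edge_perm psi = 1)%g.
Proof. by rewrite -edge_permM => ->; rewrite edge_perm1. Qed.

Lemma partner_invo psi (x : {set {set 'I_n}}) e : (psi * psi = 1)%g ->
  partner (edge_perm psi) x e = psi @: e.
Proof.
by move=> h; rewrite /partner (invoV (edge_perm_invo h)) edge_permE; case: ifP.
Qed.

Lemma fixed_const psi (x : {set {set 'I_n}}) (Z : {set {set {set 'I_n}}}) e : (psi * psi = 1)%g ->
  Z \subset pcube psi x -> psi @: e = e -> const_on Z e.
Proof.
by move=> psi2 Zx pe; apply: (cube_const Zx); rewrite (partner_invo x e psi2) pe.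
Qed.

(** An edge in both cubes is linked to its partner under [psi] and to its partner under [phi]; where
    these differ, its class has at least three elements. *)
Lemma card_cross_cube phi psi (x y : {set {set 'I_n}}) (Z : {set {set {set 'I_n}}})
    (Cst Bd : {set {set 'I_n}}) : (psi * psi = 1)%g ->
  x \subset Om -> Z \subset pcube psi x -> Z \subset pcube phi y ->
  Cst \subset Om -> Bd \subset Om -> [disjoint Cst & Bd] ->
  (forall e, e \in Cst -> const_on Z e) ->
  (forall e, e \in Bd -> ~~ const_on Z e -> partner (edge_perm phi) y e != psi @: e) ->
  exists k, #|Z| <= 2 ^ k /\ 6 * k + #|Bd| + 3 * #|Cst| <= 3 * 'C(n, r).
Proof.
move=> psi2 xO Zx Zy CO BO dCB hC hB.
rewrite -card_redges; apply: (card_cube_family (@redges_pres n r psi) xO Zx) => // e eB nc.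
exists (partner (edge_perm phi) y e); split; first exact: nonconst_linked Zy nc.
  exact: nonconst_partner_neq Zy nc.
by rewrite (partner_invo x e psi2) hB.
Qed.

(** Neither the image nor the preimage of e under [phi] is psi e, so the two partners of e differ
    whichever side of a graph [y] contains e. *)
Definition bad_edges phi psi :=
  [set e in Om | [&& psi @: e != e, phi @: e != psi @: e & phi @: (psi @: e) != e]].

Lemma perm_imset_mem s (A : {set 'I_n}) v : (s v \in s @: A) = (v \in A).
Proof. by rewrite mem_imset //; apply: perm_inj. Qed.

Lemma bad_edge phi psi v a e : (psi * psi = 1)%g -> e \in Om ->
  v \in e -> psi (phi v) \notin e -> (psi v \in e) != (phi v \in e) ->
  a \in e -> psi a \notin e -> e \in bad_edges phi psi.
Proof.
move=> psi2 eO ve nve split_e ae nae; rewrite inE eO /=.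
have psi_mem u : (u \in psi @: e) = (psi u \in e).
  by rewrite -{1}(psiK psi2 u) perm_imset_mem.
apply/and3P; split.
- by apply: contra nae => /eqP <-; rewrite perm_imset_mem.
- by apply: contra nve => /eqP h; rewrite -psi_mem -h perm_imset_mem.
- apply: contra split_e => /eqP h; apply/eqP.
  by rewrite -{2}h perm_imset_mem psi_mem.
Qed.

(* The four points v, psi v, phi v, psi (phi v) can be split so that every edge
   respecting the splitting and not invariant under psi is bad. *)
Lemma bad_split phi psi v : (psi * psi = 1)%g -> phi v != psi v ->
  exists I O : {set 'I_n}, [/\ #|I| <= 2, #|O| <= 2, [disjoint I & O],
    I :|: O \subset [set v; psi v; phi v; psi (phi v)] &
    forall e a, e \in Om -> I \subset e -> [disjoint e & O] -> a \in e -> psi a \notin e ->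
      v \in e /\ e \in bad_edges phi psi].
Proof.
move=> psi2 neq; have inj := inj_eq (@perm_inj _ psi).
have pfv : psi (phi v) != v by rewrite -[X in _ != X](psiK psi2) inj.
have c2 (a b : 'I_n) : #|[set a; b]| <= 2 by rewrite cards2; case: eqP.
have c1 (a : 'I_n) : #|[set a]| <= 2 by rewrite cards1.
have out (e O : {set 'I_n}) w : [disjoint e & O] -> w \in O -> w \notin e.
  by move=> d wO; rewrite (disjointFl d wO).
have dsj (I O : {set 'I_n}) : (forall w, w \in I -> w \notin O) -> [disjoint I & O].
  move=> h; rewrite -setI_eq0; apply/eqP/setP => w; rewrite !inE; apply/negP => /andP[/h/negP].
  by [].
have [pv|pv] := eqVneq (psi v) v.
  exists [set v], [set phi v; psi (phi v)]; split=> //.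
  - apply: dsj => w; rewrite !inE => /eqP ->; rewrite negb_or ![v == _]eq_sym pfv andbT.
    by rewrite -{2}pv.
  - by apply/subsetP => w; rewrite !inE => /or3P[] ->; rewrite ?orbT.
  move=> e a eO; rewrite sub1set => ve dO ae pa; split=> //.
  apply: (@bad_edge phi psi v a) => //; first by apply: out dO _; rewrite !inE eqxx orbT.
  by rewrite pv ve (negbTE (out _ _ (phi v) dO _)) // !inE eqxx.
have [pf|pf] := eqVneq (psi (phi v)) (phi v).
  exists [set v; psi v], [set phi v]; split=> //.
  - apply: dsj => w; rewrite !inE => /orP[]/eqP ->; last by rewrite eq_sym.
    by rewrite -pf eq_sym.
  - by apply/subsetP => w; rewrite !inE => /orP[/orP[]|] /eqP ->; rewrite eqxx ?orbT.
  move=> e a eO; rewrite subUset !sub1set => /andP[ve pve] dO ae pa; split=> //.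
  have fe : phi v \notin e by apply: out dO _; rewrite inE.
  by apply: (@bad_edge phi psi v a) => //; rewrite ?pf // pve (negbTE fe).
exists [set v; phi v], [set psi v; psi (phi v)]; split=> //.
- apply: dsj => w; rewrite !inE negb_or => /orP[]/eqP ->; apply/andP; split=> //; rewrite eq_sym //.
- by apply/subsetP => w; rewrite !inE => /orP[/orP[]|/orP[]] /eqP ->; rewrite eqxx ?orbT.
move=> e a eO; rewrite subUset !sub1set => /andP[ve fe] dO ae pa; split=> //.
have h1 : psi v \notin e by apply: out dO _; rewrite !inE eqxx.
have h2 : psi (phi v) \notin e by apply: out dO _; rewrite !inE eqxx orbT.
by apply: (@bad_edge phi psi v a) => //; rewrite fe (negbTE h1).
Qed.

(** Double count triples (v, a, e) with e bad and containing v and a, where [phi] and [psi] differ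
    at v and [psi] moves a. [bad_split] at v together with a in e and psi a outside e prescribes at
    most three vertices on either side; each bad edge is counted at most r * r times. *)
Lemma card_bad_edges phi psi : (psi * psi = 1)%g -> 3 <= r -> 6 <= n ->
  #|supp (phi * psi^-1)| * ((#|supp psi| - 4) * 'C(n - 6, r - 3)) <=
    r * (r * #|bad_edges phi psi|).
Proof.
move=> psi2 r3 n6; set D := supp _; set Bd := bad_edges _ _.
have Bdr e : e \in Bd -> #|e| = r by rewrite !inE => /andP[/eqP].
apply: (@leq_trans (\sum_(v in D) r * #|[set e in Bd | v \in e]|)); last first.
  rewrite -big_distrr leq_mul2l; apply/orP; right.
  by apply: sum_card_incident => e /Bdr ->.
rewrite -sum_nat_const; apply: leq_sum => v; rewrite inE permM => vD.
have neq : phi v != psi v.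
  by apply: contra vD => /eqP ->; rewrite permK.
have [I [O [cI cO dIO sIO hIO]]] := bad_split psi2 neq.
set B := [set v; psi v; phi v; psi (phi v)] in sIO.
have cB : #|B| <= 4 by rewrite /B -!setUA !cardsU1 cards1; do !case: (_ \notin _).
apply: (@leq_trans (\sum_(a in supp psi :\: B) #|[set e in [set e in Bd | v \in e] | a \in e]|));
  last first.
  by apply: sum_card_incident => e; rewrite inE => /andP[/Bdr -> _].
apply: (@leq_trans (\sum_(a in supp psi :\: B) 'C(n - 6, r - 3))).
  rewrite sum_nat_const leq_mul2r; apply/orP; right.
  by have := cardsID B (supp psi); have := subset_leq_card (subsetIr (supp psi) B); lia.
apply: leq_sum => a; rewrite !inE => /andP[aB pa].
(* The four points are closed under [psi], so [psi a] avoids them along with a and can be prescribed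
   independently. *)
have Binv w : (psi w \in B) = (w \in B).
  have Bi u : u \in B -> psi u \in B.
    by rewrite !inE => /orP[/orP[/orP[]|]|] /eqP ->; rewrite ?(psiK psi2) eqxx ?orbT.
  by apply/idP/idP => [/Bi|/Bi] //; rewrite psiK.
have aB' : a \notin B by rewrite !inE.
have [aI aO] : a \notin I /\ a \notin O.
  by split; apply: contra aB' => h; apply: (subsetP sIO); rewrite inE h ?orbT.
have [paI paO] : psi a \notin I /\ psi a \notin O.
  by split; rewrite -Binv in aB'; apply: contra aB' => h; apply: (subsetP sIO); rewrite inE h ?orbT.
have dj : [disjoint a |: I & psi a |: O].
  rewrite -setI_eq0 setIUl setU_eq0 !setI_eq0 disjoints1 !inE negb_or aO eq_sym pa /=.
  by rewrite disjoint_sym -setI_eq0 setIUl setU_eq0 !setI_eq0 disjoints1 paI disjoint_sym.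
have cI' : #|a |: I| = #|I|.+1 by rewrite cardsU1 aI.
have cO' : #|psi a |: O| = #|O|.+1 by rewrite cardsU1 paO.
have := @card_between _ _ _ r dj; rewrite card_ord cI' cO' => /(_ _) cb.
apply: (@leq_trans 'C(n - #|I|.+1 - #|O|.+1, r - #|I|.+1)).
  exact: leq_bin_drop.
apply: leq_trans (cb _) _; first exact: leq_ltn_trans cI r3.
apply/subset_leq_card/subsetP => e.
rewrite inE => /and3P[er + +].
rewrite subUset sub1set => /andP[ae Ie].
rewrite disjoint_sym => de.
have pae : psi a \notin e by rewrite (disjointFr de) // !inE eqxx.
have dO : [disjoint e & O] by rewrite disjoint_sym; apply: disjointWl de; apply: subsetUr.
have eO : e \in Om by rewrite inE.
have [ve eBd] := hIO e a eO Ie dO ae pae.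
by rewrite in_set ae andbT in_set ve andbT.
Qed.
End CrossCubes.

(** * Uniformity at least three *)

(** Sixth powers keep all exponents integral; the summand 6 pays for the factor 2 from adding two
    powers. *)
Lemma sixth_power_le c g P k k' : c <= 2 ^ k + 2 ^ k' -> 6 * k + g + 6 <= P ->
  6 * k' + g + 6 <= P -> c ^ 6 * 2 ^ g <= 2 ^ P.
Proof.
wlog kk : k k' / k <= k'.
  by move=> h; case/orP: (leq_total k k') => hk cc h1 h2; [apply: (h k k') | apply: (h k' k);
    rewrite // addnC].
move=> hc h1 h2; have hc2 : c <= 2 ^ k'.+1.
  by apply: leq_trans hc _; rewrite expnS mul2n -addnn leq_add2r leq_exp2l.
apply: (@leq_trans ((2 ^ k'.+1) ^ 6 * 2 ^ g)); first by rewrite leq_mul2r leq_expl ?orbT.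
by rewrite -expnM -expnD leq_exp2l //; lia.
Qed.

Lemma min_fixed_le n r : 3 <= r -> 0 < n -> min_fixed n r <= n ^ (r - 2).
Proof.
move=> r3 n0; rewrite /min_fixed; case: ifP => // _.
apply: leq_trans (bin_le_exp _ _) _.
apply: (@leq_trans (n ^ r./2)); first by apply: leq_expl; lia.
by apply: leq_pexp2l => //; lia.
Qed.

(** Edges consisting of fixed points are fixed. If half of the vertices were fixed, order n^r edges
    would be, far more than n^(r-2) l. *)
Lemma fixed_points_few n r (psi : 'S_n) l : 2 * r <= n./2 -> 0 < r -> 2 <= n ->
  3 ^ r * (2 ^ r * r`!) * 8 * l < n ->
  #|fixed_edges psi r| <= 8 * n ^ (r - 2) * l -> 2 <= r -> n./2 < #|supp psi|.
Proof.
move=> rn r0 n2 hK hfix r2; rewrite ltnNge; apply/negP => small.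
pose J := ~: supp psi.
have cJ : n./2 <= #|J| by have := cardsC (supp psi); rewrite card_ord -/J; lia.
have h1 : 'C(n./2, r) <= #|fixed_edges psi r|.
  apply: leq_trans (leq_bin2l r cJ) _; rewrite -cards_draws.
  apply/subset_leq_card/subsetP => e; rewrite !inE => /andP[/subsetP eJ ->] /=.
  rewrite (eq_in_imset (g := id)) ?imset_id // => v /eJ.
  by rewrite !inE => /negbNE/eqP.
have h2 : n ^ r <= 3 ^ r * (2 ^ r * r`! * 'C(n./2, r)).
  apply: (@leq_trans (3 ^ r * (n./2) ^ r)); first by rewrite -expnMn leq_expl //; lia.
  by rewrite leq_mul2l -{2}[n./2]subn0 bin_lower ?orbT.
have h3 : n ^ r = n * n * n ^ (r - 2) by rewrite -{1}(subnKC r2) expnD expnS expn1.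
have a0 : 0 < n ^ (r - 2) by rewrite expn_gt0; lia.
move: (n ^ (r - 2)) (3 ^ r) (2 ^ r * r`!) 'C(n./2, r) h1 h2 h3 hfix hK a0 => a u w c h1 h2 h3
  hfix hK a0.
have : n * n * a <= u * (w * (8 * a * l)) by rewrite -h3; apply: leq_trans h2 _;
  rewrite !leq_mul2l; apply/orP; right; apply/orP; right; lia.
have -> : u * (w * (8 * a * l)) = u * w * 8 * l * a by lia.
by rewrite leq_pmul2r // leqNgt; nia.
Qed.

Lemma nonrigid_arith k m N n l r a g P :
  6 * k + m <= 3 * N + 12 * n * l + 6 * r.+1 * l * (4 * (4 * a * l)) + 4 * (4 * a * l) ->
  400 * (a * l * l) + 200 * r * (a * l * l) <= m -> a <= a * l -> n * l <= a * l ->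
  a * l <= a * l * l -> 0 < a -> g <= a -> 3 * N <= P + 3 * a -> 6 * k + g + 6 <= P.
Proof.
have -> : 6 * r.+1 * l * (4 * (4 * a * l)) = 96 * (a * l * l) + 96 * (r * (a * l * l)) by lia.
by clear; lia.
Qed.

Section LargeUniformity.
Variables (r : nat) (r3 : 3 <= r).

(** [K2] and [K3] compare n^(r-1) with C(n-2, r-1) and n^r with C(n/2, r). [K0] is such that d
    points of disagreement with an involution moving over half of the vertices give at least d
    n^(r-2) / [K0] bad edges. [c1] collects all requirements on n. *)
Let K2 := 2 ^ (r - 1) * (r - 1)`!.
Let K3 := 3 ^ r * (2 ^ r * r`!).
Let K0 := 4 * (r * r) * (2 ^ (r - 3) * (r - 3)`!).
Let c1 := K2 * (200 * r.+1 + 200) + 8 * K3 + 200 * K0 + 8 * r + 100.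

Lemma K0_gt0 : 0 < K0.
Proof. by rewrite /K0 !muln_gt0 expn_gt0 fact_gt0 /=; lia. Qed.

Lemma K2_gt0 : 0 < K2.
Proof. by rewrite /K2 !muln_gt0 expn_gt0 fact_gt0. Qed.

Section N.
Variables (n l : nat).
Hypotheses (nl : n <= 2 ^ l) (l0 : 0 < l) (big : c1 * l ^ 2 <= n).
Let a := n ^ (r - 2).
Let N := 'C(n, r).
Let m := 'C(n - 2, r - 1).

Lemma const_ll_le c : c <= c1 -> c * (l * l) <= n.
Proof. by move=> h; apply: leq_trans big; rewrite -mulnn leq_mul2r h orbT. Qed.

Lemma const_l_le c : c <= c1 -> c * l <= n.
Proof. by move=> /const_ll_le; apply: leq_trans; rewrite mulnA leq_pmulr. Qed.

Lemma const_le c : c <= c1 -> c <= n.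
Proof. by move=> /const_l_le; apply: leq_trans; rewrite leq_pmulr. Qed.

Lemma n_ge : 8 * r + 100 <= n.
Proof. by apply: const_le; rewrite /c1; lia. Qed.

Lemma a_gt0 : 0 < a. Proof. by rewrite /a expn_gt0; have := n_ge; lia. Qed.

Lemma n_le_a : n <= a.
Proof. by rewrite /a -{1}[n]expn1 leq_pexp2l //; have := n_ge; lia. Qed.

Lemma m_lower : (200 * r.+1 + 200) * (l * l) * a <= m.
Proof.
rewrite -(@leq_pmul2l K2) ?K2_gt0 //; apply: (@leq_trans (n * a)); last first.
  rewrite /a -expnS /K2 /m; have -> : (r - 2).+1 = r - 1 by lia.
  by apply: bin_lower; have := n_ge; lia.
rewrite !mulnA -(mulnA _ l l) leq_mul2r; apply/orP; right; apply: const_ll_le.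
by rewrite /c1; lia.
Qed.

Lemma m_le_N : m <= N.
Proof.
rewrite /m /N; apply: (@leq_trans 'C(n - 2 + 1, r - 1 + 1)); first exact: leq_bin_shift.
have -> : r - 1 + 1 = r by lia.
by apply: leq_bin2l; have := n_ge; lia.
Qed.

Lemma bad_edges_lower (phi psi : 'S_n) : (psi * psi = 1)%g -> n./2 < #|supp psi| ->
  #|supp (phi * psi^-1)%g| * a <= K0 * #|bad_edges r phi psi|.
Proof.
move=> psi2 mv; have n6 : 6 <= n by have := n_ge; lia.
have := card_bad_edges phi psi2 r3 n6.
have h1 : n ^ (r - 3) <= 2 ^ (r - 3) * (r - 3)`! * 'C(n - 6, r - 3).
  by apply: bin_lower; have := n_ge; lia.
have h2 : n <= 4 * (#|supp psi| - 4) by have := n_ge; lia.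
have -> : a = n * n ^ (r - 3) by rewrite /a -expnS; congr (_ ^ _); lia.
set d := #|supp _|; set p := #|supp psi| - 4 in h2 *.
set c := 'C(_, _) in h1 *; set B := #|_| => h.
rewrite /K0; set w := 2 ^ _ * _ in h1 *.
apply: (@leq_trans (d * (4 * p * (w * c)))); first by rewrite leq_mul2l leq_mul ?orbT.
have -> : d * (4 * p * (w * c)) = 4 * w * (d * (p * c)) by lia.
have -> : 4 * (r * r) * w * B = 4 * w * (r * (r * B)) by lia.
by rewrite leq_mul2l h orbT.
Qed.

Section F.
Variable F : {set {set {set 'I_n}}}.
Local Notation Om := (redges n r).
Local Notation pcube phi x := (cube (edge_perm phi) x).
Hypothesis FO : forall x, x \in F -> x \subset Om.
Hypothesis Fdiff : forall x y, x \in F -> y \in F -> exists phi, y \in pcube phi x.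
Hypothesis Fncl : forall psi x, (psi * psi = 1)%g -> x \in F -> ~~ (F \subset pcube psi x).

(** On the scale multiplied by 6, [P] is 6 f_r(n) and [g] is the saving. It is a small enough share
    of the bad edges that the rest covers the 18dl needed for summing over all [phi]. *)
Let g := a %/ (2 * K0).
Let P := 3 * (N - min_fixed n r).

Lemma g_le : g * (2 * K0) <= a. Proof. exact: leq_trunc_div. Qed.

Lemma P_ge : 3 * N <= P + 3 * a.
Proof.
have : min_fixed n r <= a by apply: min_fixed_le => //; have := n_ge; lia.
by rewrite /P; move: (min_fixed n r) => mf; lia.
Qed.

Lemma g_le_a : g <= a.
Proof. by rewrite /g; apply: leq_div. Qed.

(** No member of the cube of [psi] at [x] is related to [y] through [psi] itself, since [y] would
    then be in that cube. So the cubes at [y] of the other permutations cover the clique, and each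
    meets it in a set made small by the fixed edges and the bad edges. *)
Lemma card_other_clique (psi : 'S_n) x y : (psi * psi = 1)%g -> n./2 < #|supp psi| ->
  x \in F -> y \in F -> y \notin pcube psi x ->
  exists k, #|F :&: pcube psi x| <= 2 ^ k /\ 6 * k + g + 6 <= P.
Proof.
move=> psi2 mv xF yF ync.
have K0_0 := K0_gt0; have a0 := a_gt0.
have big200 : 200 * K0 * l <= a.
  by apply: leq_trans n_le_a; apply: const_l_le; rewrite /c1; lia.
have gB phi : phi != psi ->
    18 * #|supp (phi * psi^-1)%g| * l + g + 12 <= #|bad_edges r phi psi|.
  move=> neq; have d2 : 1 < #|supp (phi * psi^-1)%g|.
    by apply: card_supp_gt1; apply: contraNneq neq => h1; rewrite -[phi](mulgKV psi) h1 mul1g.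
  rewrite -(@leq_pmul2l K0) //; apply: leq_trans (bad_edges_lower phi psi2 mv).
  move: #|supp _| d2 => d d2; have gl := g_le.
  have h1 : 4 * (K0 * (18 * d * l)) <= 2 * (d * a).
    have -> : 4 * (K0 * (18 * d * l)) = d * (72 * K0 * l) by lia.
    have -> : 2 * (d * a) = d * (2 * a) by lia.
    by rewrite leq_mul2l; apply/orP; right; lia.
  have h2 : 2 * a <= d * a by rewrite leq_mul2r d2 orbT.
  have h3 : 200 * K0 <= a by apply: leq_trans big200; rewrite leq_pmulr.
  by move: (d * a) h1 h2 => da h1 h2; lia.
have FixO : fixed_edges psi r \subset Om by apply/subsetP => e; rewrite !inE => /andP[].
have mf := fixed_edges_ge psi2 r.
have each phi : phi != psi -> exists k, #|pcube psi x :&: pcube phi y| <= 2 ^ k /\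
    6 * k + #|bad_edges r phi psi| <= P.
  move=> neq.
  have [||||k [hk hk2]] := @card_cross_cube n r phi psi x y (pcube psi x :&: pcube phi y)
    (fixed_edges psi r) (bad_edges r phi psi) psi2 (FO xF) (subsetIl _ _) (subsetIr _ _) FixO.
  - by apply/subsetP => e; rewrite !inE => /andP[].
  - rewrite -setI_eq0; apply/eqP/setP => e; rewrite !inE.
    by case: (_ @: e == e); rewrite ?andbF.
  - by move=> e; rewrite inE => /andP[_ /eqP]; apply: fixed_const psi2 (subsetIl _ _).
  - move=> e; rewrite inE => /and4P[_ _ h1 h2] _; rewrite /partner; case: ifP => _.
      by rewrite edge_permE.
    by apply: contra h2 => /eqP <-; rewrite -edge_permE permKV.
  exists k; split => //; rewrite /P.
  move: #|fixed_edges psi r| mf hk2 => fx; move: (min_fixed n r) #|bad_edges _ _ _| => f0 B.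
  by rewrite -/N; clear; lia.
pose k3 := (P - (g + 6)) %/ 6.
have [phi0 hphi0] := Fdiff yF xF.
have P_big : g + 12 <= P.
  have neq0 : phi0 != psi.
    by apply: contraNneq ync => e; rewrite (cube_sym (edge_perm_invo psi2)) -e.
  have [k [_ hk]] := each _ neq0; have := gB _ neq0.
  by move: #|bad_edges _ _ _| (18 * _ * l) hk; clear; lia.
exists k3; split; last first.
  have : 6 * k3 <= P - (g + 6) by rewrite mulnC leq_trunc_div.
  by move: k3 P_big; clear; lia.
apply: (@leq_trans (\sum_(phi : 'S_n | predT phi && (phi != psi)) #|pcube psi x :&: pcube phi y|)).
  apply: leq_trans _ (leq_card_bigcup _ _); apply/subset_leq_card/subsetP => z.
  rewrite in_setI => /andP[zF zx]; have [phi zy] := Fdiff yF zF.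
  apply/bigcupP; exists phi; last by rewrite in_setI zx.
  apply: contraNneq ync => e; rewrite e in zy.
  by rewrite -(cube_eq (edge_perm_invo psi2) zx) (cube_sym (edge_perm_invo psi2)).
apply: (sum_over_perms nl l0) => phi _ neq.
have [k [hk hk2]] := each phi neq.
apply: leq_trans (leq_mul hk (leqnn _)) _; rewrite -expnD leq_exp2l // leq_divRL //.
by have := gB phi neq; move: #|supp _| #|bad_edges _ _ _| hk2; clear; lia.
Qed.

Lemma family_bound : exists k k',
  [/\ #|F| <= 2 ^ k + 2 ^ k', 6 * k + g + 6 <= P & 6 * k' + g + 6 <= P].
Proof.
(* The [E0] bits lost by a permutation that is not near must cover the n l bits of all permutations,
   where n <= a since r >= 3, and the at most a fixed edges subtracted in [P]. *)
pose E0 := 4 * a * l.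
have a0 := a_gt0; have na := n_le_a; have mN := m_le_N; have ga := g_le_a; have hP := P_ge.
have ml := m_lower; have n100 := n_ge.
have al : a <= a * l by rewrite leq_pmulr.
have nlal : n * l <= a * l by rewrite leq_mul2r na orbT.
have all : a * l <= a * l * l by rewrite leq_pmulr.
have mge : 400 * (a * l * l) + 200 * r * (a * l * l) <= m.
  apply: leq_trans ml; have -> : (200 * r.+1 + 200) * (l * l) * a = (200 * r.+1 + 200) * (a * l *
    l) by lia.
  by rewrite -mulnDl leq_mul2r; apply/orP; right; lia.
have [|k1 [hk1 hk1']] := @card_nonrigid_family n r l nl l0 F FO Fdiff 0 (4 * E0) m mN.
  by move=> s; rewrite card_gt0 supp_eq0 => s1; apply: moved_ge => //; lia.
have k1P : 6 * k1 + g + 6 <= P by apply: nonrigid_arith hk1' mge al nlal all a0 ga hP.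
have [noH|[H]] := set_0Vmem [set y in F | rigid r 0 (4 * E0) y].
  exists k1, k1; split=> //; apply: (@leq_trans (2 ^ k1)); last exact: leq_addr.
  apply: leq_trans hk1; apply/subset_leq_card/subsetP => y yF; rewrite inE yF /=.
  by apply/negP => yr; have := in_set0 y; rewrite -noH inE yF yr.
rewrite inE => /andP[HF Hr].
have E0N : 2 * E0 <= N.
  apply: leq_trans mN; apply: leq_trans mge; apply: leq_trans (leq_addr _ _).
  by rewrite /E0; move: (a * l * l) all => x; rewrite -(mulnA 4 a l); move: (a * l); clear; lia.
have [k2 [hk2 hk2']] := @card_far n r l nl l0 H E0 F E0N (FO HF).
have k2P : 6 * k2 + g + 6 <= P.
  move: hk2' hP ga al nlal a0; rewrite -/N /E0 -(mulnA 4 a l) -(mulnA 6 n l).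
  by move: (a * l) (n * l) => al' nl'; move: a g P N => a' g' P' N'; clear; lia.
(* Rigidity with d = 0 makes all near permutations coincide; the inverse of a near one is near, so
   the common one is an involution. *)
have near_psi phi psi : near r E0 H phi -> near r E0 H psi -> phi = psi.
  move=> h1 h2; have := near_rigid Hr h1 h2; rewrite leqn0 cards_eq0 supp_eq0 => /eqP h3.
  by rewrite -[psi](mulKVg phi) h3 mulg1.
have covered z : z \in F -> (z \in [set z in F | [exists phi, ~~ near r E0 H phi && (z \in pcube
  phi H)]])
    \/ exists2 phi, near r E0 H phi & z \in pcube phi H.
  move=> zF; have [phi zH] := Fdiff HF zF.
  have [np|np] := boolP (near r E0 H phi); first by right; exists phi.
  by left; rewrite inE zF; apply/existsP; exists phi; rewrite np zH.
have [/existsP[psi npsi]|] := boolP [exists psi, near r E0 H psi]; last first.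
  rewrite negb_exists => /forallP nonear; exists k2, k2; split=> //.
  apply: (@leq_trans (2 ^ k2)); last exact: leq_addr.
  apply: leq_trans hk2; apply/subset_leq_card/subsetP => z zF.
  by have [//|[phi np]] := covered z zF; case/negP: (nonear phi).
have psi2 : (psi * psi = 1)%g.
  by rewrite -{1}(near_psi (psi^-1)%g psi) ?nearV // mulVg.
have mv : n./2 < #|supp psi|.
  apply: (@fixed_points_few n r psi l) => //.
  - by move: n100; clear; lia.
  - by move: r3; clear; lia.
  - by move: n100; clear; lia.
  - have : (8 * K3 + 1) * l <= n by apply: const_l_le; rewrite /c1; clear; lia.
    have K3_0 : 0 < l by []. 
    rewrite /K3; move: (3 ^ r) (2 ^ r * r`!) => u w; rewrite mulnDl mul1n.
    have -> : 8 * (u * w) * l = u * w * 8 * l by lia.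
    by move: (u * w * 8 * l) K3_0; clear; lia.
  - apply: leq_trans (_ : defect Om (edge_perm psi) H <= _).
      apply/subset_leq_card/subsetP => e /setIdP[eO /eqP pe].
      by apply/setIdP; rewrite eO edge_permE pe eqxx.
    by apply: leq_trans npsi _; rewrite /E0 mulnA mulnA.
  - by move: r3; clear; lia.
have [y yF ync] : exists2 y, y \in F & y \notin pcube psi H.
  by have /subsetPn[y] := Fncl psi2 HF; exists y.
have [k3 [hk3 k3P]] := card_other_clique psi2 mv HF yF ync.
exists k2, k3; split=> //; rewrite -(cardsID (pcube psi H)) addnC; apply: leq_add => //.
apply: leq_trans hk2; apply/subset_leq_card/subsetP => z.
rewrite in_setD => /andP[znc zF]; have [//|[phi np zH]] := covered z zF.
by move: znc; rewrite (near_psi psi phi) ?zH.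
Qed.

End F.
End N.

Lemma large_uniformity : exists n0 K, 0 < K /\
  forall n (F : {set {set {set 'I_n}}}), n0 <= n ->
  (forall x, x \in F -> x \subset redges n r) ->
  (forall x y, x \in F -> y \in F -> exists phi : 'S_n, y \in cube (edge_perm phi) x) ->
  (forall (psi : 'S_n) x, (psi * psi = 1)%g -> x \in F -> ~~ (F \subset cube (edge_perm psi) x)) ->
  exists g, #|F| ^ 6 * 2 ^ g <= 2 ^ (3 * ('C(n, r) - min_fixed n r)) /\ n ^ (r - 2) <= K * g.
Proof.
have [n0 hn0] := polylog_le c1 2.
exists (n0 + 2), (4 * K0); split; first by rewrite muln_gt0 K0_gt0.
move=> n F hn FO Fdiff Fncl.
have nl := up_log2_bound n.
have l0 : 0 < up_log 2 n by rewrite up_log_gt0; lia.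
have big : c1 * up_log 2 n ^ 2 <= n by apply: hn0; lia.
exists (n ^ (r - 2) %/ (2 * K0)); split.
  have [k [k' [hF h1 h2]]] := family_bound nl l0 big FO Fdiff Fncl.
  exact: sixth_power_le hF h1 h2.
have K0_0 := K0_gt0.
have aK : 2 * K0 <= n ^ (r - 2).
  apply: leq_trans (n_le_a nl l0 big); apply: (const_le l0 big).
  by rewrite /c1; clear; lia.
have : n ^ (r - 2) < ((n ^ (r - 2) %/ (2 * K0)).+1 * (2 * K0)) by apply: ltn_ceil; rewrite muln_gt0.
have : 0 < n ^ (r - 2) %/ (2 * K0) by rewrite divn_gt0 // muln_gt0.
move: (_ %/ _) => q q0 /ltnW h; apply: leq_trans h _.
have -> : 4 * K0 * q = (2 * q) * (2 * K0) by lia.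
by rewrite leq_mul2r; apply/orP; right; lia.
Qed.
End LargeUniformity.

(** * Graphs: members outside a maximal clique *)

Lemma exchange_card (T : finType) (A : {set T}) (P : rel T) :
  \sum_(v in A) #|[set w in A | P v w]| = \sum_(w in A) #|[set v in A | P v w]|.
Proof.
under eq_bigr do rewrite -sum1_card.
under [RHS]eq_bigr do rewrite -sum1_card.
rewrite (exchange_big_dep (mem A)) /=; last by move=> v e _; rewrite inE => /andP[].
by apply: eq_bigr => e eB; apply: eq_bigl => v; rewrite !inE eB.
Qed.

Section Unrelated.
Variables (n l t : nat) (psi : 'S_n).
Hypotheses (nl : n <= 2 ^ l) (l0 : 0 < l) (psi2 : (psi * psi = 1)%g).
Hypothesis fixed_disjoint : forall e f, e \in fixed_edges psi 2 -> f \in fixed_edges psi 2 ->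
  e != f -> [disjoint e & f].
Local Notation graph := {set {set 'I_n}}.
Local Notation Om := (redges n 2).
Local Notation pcube phi x := (cube (edge_perm phi) x).
Implicit Types (phi : 'S_n) (x y K : graph) (e : {set 'I_n}) (v w z : 'I_n).

(** For such x every non-fixed pair e, psi e can be exchanged freely, so the cube of [psi] at x has
    the largest dimension its fixed edges allow. *)
Definition full x := forall e, e \in Om -> psi @: e != e -> (psi @: e \in x) = (e \notin x).

Definition degree y v := #|[set w | [set v; w] \in y]|.
Definition codegree y v := #|[set w | (w != v) && ([set v; w] \notin y)]|.

(** By [bad_at], disagreeing with [psi] at v wastes almost as many edges as the degree of v and as
    the codegree of psi v; only at these vertices can a disagreement be cheap. *)
Definition twins y := [set v | (degree y v <= t) && (codegree y (psi v) <= t)].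

Let psi_inj : injective psi := @perm_inj _ psi.

Lemma psi_setK e : psi @: (psi @: e) = e.
Proof. by rewrite -!edge_permE -permM edge_perm_invo // perm1. Qed.

Lemma set2_redges v w : ([set v; w] \in Om) = (v != w).
Proof. by rewrite inE cards2; case: (v != w). Qed.

Lemma redges_psi e : (psi @: e \in Om) = (e \in Om).
Proof. by rewrite -edge_permE redges_pres. Qed.

Lemma set2_injr v : injective (fun w => [set v; w]).
Proof.
move=> w w' /setP h; have := h w; have := h w'; rewrite !inE !eqxx !orbT.
have [->|wv _ /esym/eqP //] := eqVneq w v.
by rewrite orbb => /eqP ->.
Qed.

Lemma degree_codegree y v : y \subset Om -> degree y v + codegree y v = n.-1.
Proof.
move=> /subsetP yO; rewrite /degree /codegree.
have -> : n.-1 = #|[set~ v]| by rewrite cardsC1 card_ord.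
rewrite -(cardsID [set w | [set v; w] \in y] [set~ v]); congr (_ + _).
  apply: eq_card => w; rewrite !inE; case h : (_ \in y); rewrite ?andbF // andbT.
  by have := yO _ h; rewrite set2_redges eq_sym.
by apply: eq_card => w; rewrite !inE andbC.
Qed.

Lemma twins_disjoint y v : y \subset Om -> 2 * t < n.-1 -> v \in twins y -> psi v \notin twins y.
Proof.
move=> yO tn; rewrite !inE => /andP[_ h]; apply/negP => /andP[h' _].
by have := degree_codegree (psi v) yO; move: h h' tn; clear; lia.
Qed.

(** For twins v and w the pair {v, psi w} either is an edge, counted in the degree of v, or is not,
    counted in the codegree of psi w; hence |Z|^2 <= 2t |Z|. *)
Lemma card_twins y : y \subset Om -> 2 * t < n.-1 -> #|twins y| <= 2 * t.
Proof.
move=> yO tn; set Z := twins y.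
have [->|[z0 z0Z]] := set_0Vmem Z; first by rewrite cards0.
have Z0 : 0 < #|Z| by rewrite card_gt0; apply/set0Pn; exists z0.
rewrite -(leq_pmul2l Z0).
apply: (@leq_trans (\sum_(v in Z) (#|[set w in Z | [set v; psi w] \in y]|
                                 + #|[set w in Z | [set psi w; v] \notin y]|))).
  rewrite -sum_nat_const; apply: leq_sum => v vZ.
  rewrite -(cardsID [set w | [set v; psi w] \in y] Z) leq_add //.
    by apply/subset_leq_card/subsetP => w; rewrite !inE.
  by apply/subset_leq_card/subsetP => w; rewrite !inE setUC andbC.
rewrite big_split /= mul2n -addnn mulnDr leq_add //.
  rewrite -sum_nat_const; apply: leq_sum => v; rewrite inE => /andP[dv _].
  apply: leq_trans dv; rewrite -(card_imset _ psi_inj).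
  by apply/subset_leq_card/subsetP => _ /imsetP[w + ->]; rewrite !inE => /andP[].
rewrite (exchange_card Z (fun v w => [set psi w; v] \notin y)).
rewrite -sum_nat_const; apply: leq_sum => w wZ; have := wZ; rewrite inE => /andP[_ dw].
apply: leq_trans dw; apply/subset_leq_card/subsetP => v; rewrite !inE => /andP[vZ ->].
rewrite andbT; apply: contraTneq vZ => ->; have := twins_disjoint yO tn wZ.
by rewrite inE.
Qed.

(** * Graphs of the clique that agree with a prescribed pattern on R *)

Section Pattern.
Variables (x y x' R : graph).
Hypotheses (xO : x \subset Om) (yO : y \subset Om) (fullx : full x) (x'x : x' \in pcube psi x).
Hypotheses (RO : R \subset Om) (Rpsi : forall e, e \in R -> psi @: e \in R).

Let PK := [set K in pcube psi x | [forall e in R, (e \in K) == (e \in x')]].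
Let W := [set e in x' | (psi @: e != e) && (e \notin R)].
Let Cst := fixed_edges psi 2 :|: R.

Let pinv := edge_perm_invo psi2.

Lemma x'O : x' \subset Om.
Proof. exact: cube_sub (@redges_pres n 2 psi) xO x'x. Qed.

Lemma full_x' : full x'.
Proof.
move=> e eO pe; have := cubeP _ _ _ x'x e; have := cubeP _ _ _ x'x (psi @: e).
by rewrite !edge_permE psi_setK (fullx eO pe); case: (e \in x); do 2!case: (_ \in x').
Qed.

(** Replacing any subset of [W] in [x'] by its image under [psi] stays in the clique and does not
    touch [R]. *)
Lemma card_pattern_ge : 2 ^ #|W| <= #|PK|.
Proof.
pose KU (U : graph) := (x' :\: U) :|: edge_perm psi @: U.
have memKU (U : graph) e : (e \in KU U) = (e \in x') && (e \notin U) || (psi @: e \in U).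
  rewrite !inE andbC; congr (_ || _); apply/imsetP/idP => [[f fU ->]|pe].
    by rewrite edge_permE psi_setK.
  by exists (psi @: e); rewrite // edge_permE psi_setK.
have UW (U : graph) e : U \subset W -> e \in U -> [/\ e \in x', psi @: e \notin x' & e \notin R].
  move=> /subsetP UW /UW; rewrite inE => /and3P[ex pe eR]; split=> //.
  by rewrite full_x' ?negbK // (subsetP x'O).
rewrite -card_powerset -(@card_in_imset _ _ KU (mem (powerset W))).
  apply/subset_leq_card/subsetP => _ /imsetP[U + ->]; rewrite inE => UsW; rewrite inE.
  apply/andP; split.
    apply: (cube_trans pinv x'x); apply/cubeP => e; rewrite edge_permE !memKU psi_setK.
    have [eU|eU] := boolP (e \in U).
      have [ex px _] := UW U e UsW eU; rewrite ex (negbTE px) /=.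
      by apply/negP => peU; have [h _ _] := UW U _ UsW peU; rewrite h in px.
    have [peU|peU] := boolP (psi @: e \in U).
      have [ex px _] := UW U _ UsW peU; rewrite psi_setK in px.
      by rewrite (negbTE px) ex.
    by rewrite !orbF !andbT; case: (e \in x'); case: (_ \in x').
  apply/forall_inP => e eR; rewrite memKU.
  have eU : e \notin U by apply: contraL eR => /(UW U _ UsW)[].
  have peU : psi @: e \notin U by apply: contraL (Rpsi eR) => /(UW U _ UsW)[].
  by rewrite eU (negbTE peU) andbT orbF.
move=> U U'; rewrite !inE => UsW U'sW /setP eqK; apply/setP => e.
have key (V : graph) : V \subset W -> e \in W -> (e \in KU V) = (e \notin V).
  move=> VW; rewrite inE => /and3P[ex pe eR]; rewrite memKU ex /= orbC.
  case peV : (psi @: e \in V) => //; have [h _ _] := UW V _ VW peV.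
  by move: h; rewrite full_x' ?(subsetP x'O) // ex.
have [eW|eW] := boolP (e \in W).
  have h := key U UsW eW; rewrite eqK (key U' U'sW eW) in h.
  by apply: negb_inj; rewrite h.
by rewrite (contraNF (subsetP UsW e) eW) (contraNF (subsetP U'sW e) eW).
Qed.

Lemma card_ground_pattern : 'C(n, 2) <= #|Cst| + 2 * #|W|.
Proof.
rewrite -card_redges; apply: (@leq_trans #|Cst :|: (W :|: edge_perm psi @: W)|); last first.
  apply: leq_trans (leq_card_setU _ _) _; rewrite leq_add2l mul2n -addnn.
  by apply: leq_trans (leq_card_setU _ _) _; rewrite card_imset //; apply: perm_inj.
apply/subset_leq_card/subsetP => e eO; rewrite !in_setU.
have [pe|pe] := eqVneq (psi @: e) e; first by rewrite inE eO pe eqxx.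
have [eR|eR] := boolP (e \in R); first by rewrite orbT.
have [ex|ex] := boolP (e \in x'); first by rewrite [e \in W]inE ex pe eR !orbT.
apply/orP; right; apply/orP; right; apply/imsetP; exists (psi @: e);
  last by rewrite edge_permE psi_setK.
rewrite inE full_x' // ex psi_setK eq_sym pe /=.
by apply: contra eR => /Rpsi; rewrite psi_setK.
Qed.

(** For e outside [y] the partner under [phi] is the preimage. Should it equal psi e while psi e
    also avoids [y], then e is constant; so e may be counted as soon as psi e is outside [y], which
    makes more edges bad than in [bad_edges]. *)
Definition bad_outside phi := [set e in Om :\: R | [&& psi @: e != e, phi @: e != psi @: e &
  [|| e \in y, psi @: e \notin y | phi @: (psi @: e) != e]]].

Lemma card_pattern_related phi : exists k, #|PK :&: pcube phi y| <= 2 ^ k /\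
  6 * k + #|bad_outside phi| <= 6 * #|W|.
Proof.
have PKx : PK :&: pcube phi y \subset pcube psi x.
  by apply/subsetP => K; rewrite in_setI => /andP[/setIdP[]].
have [|||||k [hk hk2]] := @card_cross_cube n 2 phi psi x y _ Cst (bad_outside phi) psi2 xO PKx
  (subsetIr _ _).
- by rewrite subUset RO andbT; apply/subsetP => e /setIdP[].
- by apply/subsetP => e /setIdP[/setDP[]].
- rewrite -setI_eq0; apply/eqP/setP => e; rewrite in_set0;
  apply/negP => /setIP[+ /setIdP[/setDP[_ eR] /and3P[pe _ _]]].
  by rewrite in_setU (negbTE eR) orbF inE (negbTE pe) andbF.
- move=> e; rewrite in_setU => /orP[/setIdP[_ /eqP pe]|eR].
    exact: fixed_const psi2 PKx pe.
  by apply/const_onP => K K' /setIP[/setIdP[_ /forall_inP h] _] /setIP[/setIdP[_ /forall_inP h'] _];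
    rewrite (eqP (h e eR)) (eqP (h' e eR)).
- move=> e /setIdP[_ /and3P[_ h1 h2]] nc; have := nonconst_partner (subsetIr PK _) nc.
  rewrite /partner; case: ifP => ey; first by rewrite edge_permE.
  move=> py; apply/eqP => pp; rewrite pp in py; move: h2; rewrite ey py /=.
  by rewrite -pp -edge_permE permKV eqxx.
exists k; split=> //; have := card_ground_pattern.
by move: hk2; move: #|Cst| #|W| #|bad_outside phi| 'C(n, 2); clear; lia.
Qed.

Definition rdegree v := #|[set w | [set v; w] \in R]|.

Lemma rdegree_le v : rdegree v <= #|R|.
Proof.
rewrite /rdegree -(card_imset _ (@set2_injr v)).
by apply/subset_leq_card/subsetP => _ /imsetP[w + ->]; rewrite inE.
Qed.

Lemma card_fixed_at v : #|[set w | [set v; w] \in fixed_edges psi 2]| <= 1.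
Proof.
apply/card_le1_eqP => w w' hw hw'; rewrite in_set in hw; rewrite in_set in hw'.
apply/eqP; apply: contraT => ww'.
have neq : [set v; w] != [set v; w'].
  by apply: contra ww' => /eqP/set2_injr ->.
have /disjointFr/(_ (set21 v w)) := fixed_disjoint hw hw' neq.
by rewrite set21.
Qed.

(** The exceptional w are v itself, the only candidates psi (phi v) and psi (phi^-1 v) for the two
    images to coincide, at most one fixed pair at v, and the pairs of [R]. *)
Lemma bad_degree phi v (A : {set 'I_n}) : phi v != psi v ->
  (forall w, w \in A -> [|| [set v; w] \in y, psi @: [set v; w] \notin y | phi (psi w) != w]) ->
  #|A| <= #|[set e in bad_outside phi | v \in e]| + (4 + rdegree v).
Proof.
move=> vD hA.
pose X := [set v; psi (phi v); psi ((phi^-1)%g v)] :|: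
  ([set w | [set v; w] \in fixed_edges psi 2] :|: [set w | [set v; w] \in R]).
have cX : #|X| <= 4 + rdegree v.
  apply: leq_trans (leq_card_setU _ _) _; rewrite -(addnA 3 1); apply: leq_add.
    by rewrite -setUA !cardsU1 cards1; do !case: (_ \notin _).
  by apply: leq_trans (leq_card_setU _ _) _; rewrite leq_add2r card_fixed_at.
rewrite -(cardsID X A) addnC; apply: leq_add; last first.
  by apply: leq_trans cX; apply/subset_leq_card/subsetIr.
rewrite -(card_imset _ (@set2_injr v)); apply/subset_leq_card/subsetP => _ /imsetP[w + ->].
rewrite in_setD !in_setU !negb_or => /andP[/andP[w0 /andP[w1 w2]] wA].
rewrite !in_set1 in w0; have /andP[/andP[wv wp] wpV] := w0.
rewrite in_set in w1; rewrite in_set in w2.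
have eO : [set v; w] \in Om by rewrite set2_redges eq_sym.
rewrite in_set set21 andbT; apply/setIdP; split; first by rewrite in_setD w2.
have pe : psi @: [set v; w] != [set v; w] by apply: contra w1 => pe; apply/setIdP.
have phie : phi @: [set v; w] != psi @: [set v; w].
  apply: contra wp => /eqP/setP/(_ (phi v)); rewrite !set2_perm set21 !inE (negbTE vD) /=.
  by move=> /esym/eqP ->; rewrite psiK.
rewrite pe phie /=; have /or3P[-> //|->|pw] := hA w wA; first by rewrite orbT.
rewrite (_ : phi @: _ != _) ?orbT //.
apply: contra wpV => /eqP/setP/(_ (phi (psi w))); rewrite !set2_perm set22 !inE (negbTE pw) orbF.
by move=> /esym/eqP <-; rewrite permK psiK.
Qed.

(** If u is a point of disagreement and w = psi u, then phi (psi w) differs from w; so every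
    disagreement vertex v off the centres is bad together with almost all such w. *)
Lemma bad_many phi c : (forall v, v != c -> v != psi c -> rdegree v <= 2) ->
  (#|supp (phi * psi^-1)%g| - 2) * (#|supp (phi * psi^-1)%g| - 6) <= 2 * #|bad_outside phi|.
Proof.
move=> hR; set D := supp _.
have memD v : (v \in D) = (phi v != psi v).
  by rewrite inE permM -(inj_eq psi_inj) permKV.
have B2 e : e \in bad_outside phi -> #|e| <= 2.
  by move=> /setIdP[/setDP[+ _] _]; rewrite inE => /eqP ->.
apply: leq_trans (sum_card_incident (D :\: [set c; psi c]) B2).
apply: (@leq_trans (\sum_(v in D :\: [set c; psi c]) (#|D| - 6))).
  rewrite sum_nat_const leq_mul2r; apply/orP; right.
  have := cardsID [set c; psi c] D.
  have := subset_leq_card (subsetIr D [set c; psi c]).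
  have : #|[set c; psi c]| <= 2 by rewrite cards2; case: eqP.
  by move: #|_ :&: _| #|_ :\: _| #|[set c; psi c]| #|D|; clear; lia.
apply: leq_sum => v; rewrite in_setD in_set2 negb_or => /andP[/andP[vc vpc] vD].
rewrite leq_subLR; have <- : #|[set psi u | u in D]| = #|D| by rewrite card_imset.
rewrite memD in vD.
have := bad_degree vD (A := [set psi u | u in D]) _; have := hR v vc vpc.
move: (rdegree v) #|[set e in _ | _]| => rv B rv2 h; apply: leq_trans (h _) _.
  by move=> _ /imsetP[u uD ->]; rewrite (psiK psi2) -memD uD !orbT.
by move: rv2; clear; lia.
Qed.

Lemma bad_at phi v : phi v != psi v ->
  degree y v <= #|bad_outside phi| + (4 + rdegree v) /\
  codegree y (psi v) <= #|bad_outside phi| + (4 + rdegree v).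
Proof.
move=> vD; have sub : #|[set e in bad_outside phi | v \in e]| <= #|bad_outside phi|.
  by apply/subset_leq_card/subsetP => e /setIdP[].
split.
  apply: leq_trans (bad_degree vD (A := [set w | [set v; w] \in y]) _) _.
    by move=> w; rewrite inE => ->.
  by rewrite leq_add2r.
have -> : codegree y (psi v) = #|[set w | (psi w != psi v) && ([set psi v; psi w] \notin y)]|.
  rewrite /codegree -(card_imset [set w | _ && _] psi_inj); apply: eq_card => w.
  rewrite -[w](psiK psi2) mem_imset // !inE.
  by rewrite (psiK psi2).
apply: leq_trans (bad_degree vD (A := [set w | (psi w != psi v) && ([set psi v;
  psi w] \notin y)]) _) _.
  by move=> w; rewrite inE set2_perm => /andP[_ ->]; rewrite orbT.
by rewrite leq_add2r.
Qed.

Hypotheses (tl : 1800 * l ^ 2 + 20 <= t) (tn : 6 * t + 10 <= n).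
Hypothesis R_small : #|R| <= 4 * t + 2.
Hypothesis R_star : exists c, forall v, v != c -> v != psi c -> rdegree v <= 2.
Hypothesis R_twins : forall v, v \notin twins y -> psi v \notin twins y -> rdegree v <= 2.
Hypothesis kill : forall phi K, (forall v, phi v != psi v -> v \in twins y) ->
  K \in PK -> K \notin pcube phi y.

(** For at least 100 l disagreements the quadratic bound suffices. For fewer, 18dl < 1800 l^2, and
    the single vertex v outside the twins already gives about t bad edges; this fixes the size of
    t. *)
Lemma bad_outside_lower phi v : phi v != psi v -> v \notin twins y ->
  18 * #|supp (phi * psi^-1)%g| * l + 6 <= #|bad_outside phi|.
Proof.
move=> vD vZ; have [c hc] := R_star.
have := bad_many phi hc; move: #|supp _| => d hd.
have [big|small] := leqP (100 * l) d.
  by move: hd big l0; move: #|_| => B; clear; nia.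
have h1800 : 18 * d * l + 6 <= 1800 * l ^ 2 + 6 by rewrite -mulnn; move: small; clear; nia.
apply: (leq_trans h1800); apply: (@leq_trans (t - 10)); first by move: tl; clear; lia.
have [hdeg hcodeg] := bad_at vD.
have [pvZ|pvZ] := boolP (psi v \in twins y).
  move: pvZ; rewrite inE (psiK psi2) => /andP[_ hc'].
  have := degree_codegree v yO; have := rdegree_le v.
  by move: hdeg hc' R_small tn; clear; lia.
have := R_twins vZ pvZ; move: vZ; rewrite inE negb_and -!ltnNge => /orP[] h.
  by move: h hdeg; clear; lia.
by move: h hcodeg; clear; lia.
Qed.

(** By [kill], permutations that differ from [psi] only at twins relate [y] to no graph of the
    pattern; all others together relate it to at most half of them. *)
Lemma card_unrelated_pattern :
  2 ^ #|W| <= 2 * #|[set K in pcube psi x | [forall phi, K \notin pcube phi y]]|.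
Proof.
set U := [set K in _ | _].
pose P := [pred phi : 'S_n | [exists v, (phi v != psi v) && (v \notin twins y)]].
have hsum : \sum_(phi | P phi && (phi != psi)) #|PK :&: pcube phi y| <= 2 ^ #|W| %/ 2.
  apply: (sum_over_perms nl l0) => phi /existsP[v /andP[vD vZ]] _.
  have [k [hk hk2]] := card_pattern_related phi; have := bad_outside_lower vD vZ.
  move: #|supp _| #|bad_outside phi| hk2 => d B hk2 hB.
  rewrite leq_divRL // -mulnA -expnSr; apply: leq_trans (leq_mul hk (leqnn _)) _.
  by rewrite -expnD leq_exp2l //; move: hk2 hB; move: #|W|; clear; lia.
have cov : PK \subset U :|: \bigcup_(phi | P phi && (phi != psi)) (PK :&: pcube phi y).
  apply/subsetP => K KP; rewrite in_setU; have [//|KU /=] := boolP (K \in U).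
  have : ~~ [forall phi, K \notin pcube phi y].
    by apply: contra KU => h; apply/setIdP; split=> //; move: KP => /setIdP[].
  rewrite negb_forall => /existsP[phi]; rewrite negbK => Kphi.
  apply/bigcupP; exists phi; last by rewrite in_setI KP.
  have hv : P phi.
    rewrite /P /=; apply: contraLR Kphi => nP; apply: kill KP => v vD.
    by apply: contraNT nP => vZ; apply/existsP; exists v; rewrite vD.
  apply/andP; split; first exact: hv.
  apply: contraTneq hv => ->; rewrite /P /= negb_exists.
  by apply/forallP => v; rewrite eqxx.
have h := leq_trans card_pattern_ge (leq_trans (subset_leq_card cov) (leq_card_setU _ _)).
have h2 := leq_trans (leq_card_bigcup _ _) hsum.
move: h h2; move: #|U| #|\bigcup_(_ | _) _| (2 ^ #|W|); clear; lia.
Qed.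

End Pattern.
Definition unrelated x y := [set K in pcube psi x | [forall phi, K \notin pcube phi y]].

Definition many_unrelated x y := exists k,
  'C(n, 2) <= #|fixed_edges psi 2| + (4 * t + 2) + 2 * k /\ 2 ^ k <= 2 * #|unrelated x y|.

Hypotheses (tl : 1800 * l ^ 2 + 20 <= t) (tn : 6 * t + 10 <= n).

Lemma many_of_pattern x y x' (R : graph) : x \subset Om -> y \subset Om -> full x ->
  x' \in pcube psi x -> R \subset Om -> (forall e, e \in R -> psi @: e \in R) ->
  #|R| <= 4 * t + 2 -> (exists c, forall v, v != c -> v != psi c -> rdegree R v <= 2) ->
  (forall v, v \notin twins y -> psi v \notin twins y -> rdegree R v <= 2) ->
  (forall phi K, (forall v, phi v != psi v -> v \in twins y) -> K \in pcube psi x ->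
    (forall e, e \in R -> (e \in K) = (e \in x')) -> K \notin pcube phi y) ->
  many_unrelated x y.
Proof.
move=> xO yO fx x'x RO Rp Rs Rstar Rt kill.
exists #|[set e in x' | (psi @: e != e) && (e \notin R)]|; split.
  apply: leq_trans (card_ground_pattern fx x'x Rp) _; rewrite leq_add2r.
  by apply: leq_trans (leq_card_setU _ _) _; rewrite leq_add2l.
apply: card_unrelated_pattern => // phi K hphi /setIdP[Kx /forall_inP KR].
by apply: kill => // e eR; apply/eqP/KR.
Qed.

Lemma full_cube x x' : x \subset Om -> x' \subset Om -> full x -> full x' ->
  (forall e, e \in Om -> psi @: e = e -> (e \in x') = (e \in x)) -> x' \in pcube psi x.
Proof.
move=> xO x'O fx fx' h; apply/cubeP => e; rewrite edge_permE.
have [eO|eO] := boolP (e \in Om); last first.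
  rewrite (contraNF (subsetP xO e) eO) (contraNF (subsetP x'O (psi @: e))) //.
  by rewrite redges_psi.
have [pe|pe] := eqVneq (psi @: e) e; first by rewrite pe h //; case: (e \in x).
by rewrite fx // fx' //; case: (e \in x); case: (e \in x').
Qed.

Lemma cube_fixed x K e : K \in pcube psi x -> e \in Om -> psi @: e = e -> (e \in K) = (e \in x).
Proof.
by move=> /cubeP/(_ e); rewrite edge_permE => + eO pe; rewrite pe; do 2!case: (e \in _).
Qed.

(** Force e0 into K. As psi e0 avoids the twins, any [phi] left to rule out maps psi e0 to e0. Then
    e0 would be an edge of K outside [y] whose preimage is not in [y], which no cube at [y]
    allows. *)
Lemma many_disjoint x y e0 : x \subset Om -> y \subset Om -> full x -> e0 \in Om ->
  e0 \notin y -> psi @: e0 \notin y -> (psi @: e0 = e0 -> e0 \in x) ->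
  [disjoint e0 & psi @: twins y] -> many_unrelated x y.
Proof.
move=> xO yO fx e0O e0y pe0y e0x dj.
pose R := [set e0; psi @: e0].
have RO : R \subset Om by apply/subsetP => e /set2P[] ->; rewrite ?redges_psi.
have cR : #|R| <= 2 by rewrite cards2; case: (_ != _).
have Rcl (e : {set 'I_n}) : e \in R -> psi @: e \in R.
  by move=> /set2P[] ->; rewrite ?psi_setK ?set21 ?set22.
have [x' x'x e0x'] : exists2 x', x' \in pcube psi x & e0 \in x'.
  have [e0ix|e0nx] := boolP (e0 \in x); first by exists x; rewrite ?cube_refl.
  have pe0 : psi @: e0 != e0 by apply: contra e0nx => /eqP.
  exists [set e in Om | if e \in R then e == e0 else e \in x]; last by rewrite !inE !eqxx;
    move: e0O; rewrite inE => ->.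
  apply: full_cube => //.
  - by apply/subsetP => e; rewrite in_set => /andP[].
  - have memx' f : (f \in [set e in Om | if e \in R then e == e0 else e \in x]) =
        (f \in Om) && (if f \in R then f == e0 else f \in x) by rewrite in_set.
    have Rp (f : {set 'I_n}) : (psi @: f \in R) = (f \in R).
      by apply/idP/idP => [/Rcl|/Rcl] //; rewrite psi_setK.
    move=> e eO pe; rewrite !memx' redges_psi eO /= Rp; case: ifP => [/set2P[] ->|_];
      last exact: fx.
      by rewrite eqxx (negbTE pe0).
    by rewrite psi_setK eqxx (negbTE pe0).
  - move=> e eO pe; rewrite in_set eO /=; case: ifP => // /set2P[] ee.
      by move: pe0; rewrite -ee pe eqxx.
    by move: pe0; rewrite -{1}ee -pe ee !psi_setK => /negP; case.
apply: (@many_of_pattern x y x' R) => //.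
- by apply: leq_trans cR _; move: tl; clear; lia.
- have /card_gt0P[c _] : 0 < #|e0| by move: e0O; rewrite inE => /eqP ->.
  by exists c => v _ _; apply: leq_trans (rdegree_le R v) cR.
- by move=> v _ _; apply: leq_trans (rdegree_le R v) cR.
move=> phi K hphi Kx KR; apply/negP => /cubeP/(_ (psi @: e0)).
have -> : edge_perm phi (psi @: e0) = e0.
  rewrite edge_permE -imset_comp -[RHS]imset_id; apply: eq_in_imset => v ve /=.
  have [//|/hphi pv] := eqVneq (phi (psi v)) (psi (psi v)).
    by rewrite (psiK psi2).
  have := disjointFr dj ve; rewrite -{1}(psiK psi2 v) mem_imset ?pv //.
by rewrite (negbTE pe0y) (negbTE e0y) (KR e0 (set21 _ _)) e0x'.
Qed.

(** Here [phi] may permute the twins, so the preimage of e0 = {z, psi z'} is unknown; but it is {psi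
    z, u} for some twin u. Making K agree with [y] on the whole star at psi z forbids this edge from
    leaving, whichever u occurs, while e0 is in K and not in [y]. A star costs few edges and adds at
    most two at each vertex other than z and psi z. *)
Lemma many_star x y z z' : x \subset Om -> y \subset Om -> full x ->
  z \in twins y -> z' \in twins y -> [set z; psi z'] \notin y ->
  (z = z' -> [set z; psi z'] \in x) ->
  (z <> z' -> [set psi z; z'] \notin y /\
     forall e, e \in Om -> psi @: e = e -> (e \in x) = (e \in y)) ->
  many_unrelated x y.
Proof.
move=> xO yO fx zZ z'Z e0y e0x hA; set Z := twins y in zZ z'Z *.
have tn1 : 2 * t < n.-1 by move: tn; clear; lia.
have pZ v : v \in Z -> psi v \notin Z by apply: twins_disjoint.
have zpz v w : v \in Z -> w \in Z -> v != psi w by move=> vZ /pZ; apply: contraNneq => <-.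
pose S : graph := [set [set psi z; u] | u in Z].
pose R : graph := S :|: [set psi @: e | e : {set 'I_n} in S].
have cR : #|R| <= 4 * t.
  apply: leq_trans (leq_card_setU _ _) _.
  have cS : #|S| <= 2 * t by apply: leq_trans (leq_imset_card _ _) _; apply: card_twins.
  have -> : 4 * t = 2 * t + 2 * t by clear; lia.
  by rewrite leq_add // (leq_trans (leq_imset_card _ _)).
have SO e : e \in S -> e \in Om.
  by move=> /imsetP[u uZ ->]; rewrite set2_redges eq_sym zpz.
have RS (e : {set 'I_n}) : (e \in R) = (e \in S) || (psi @: e \in S).
  rewrite in_setU; congr (_ || _); apply/imsetP/idP => [[f fS ->]|h]; first by rewrite psi_setK.
  by exists (psi @: e); rewrite ?psi_setK.
have Rcl (e : {set 'I_n}) : e \in R -> psi @: e \in R by rewrite !RS psi_setK orbC.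
have RO : R \subset Om by apply/subsetP => e; rewrite RS => /orP[/SO //|/SO]; rewrite redges_psi.
(* A non-fixed pair meets the star at most once. *)
have S_once (e : {set 'I_n}) : e \in S -> psi @: e \in S -> psi @: e = e.
  move=> /imsetP[u uZ ->]; rewrite set2_perm (psiK psi2) => /imsetP[u' u'Z /setP eq].
  have zu' : z = u'.
    by have := eq z; rewrite !inE eqxx /= (negbTE (zpz _ _ zZ zZ)) /= => /esym/eqP.
  have := eq (psi z); rewrite !inE eqxx /= eq_sym (negbTE (zpz _ _ zZ zZ)) /= => /eqP/psi_inj ->.
  by rewrite setUC.
pose x' := [set e in Om | if psi @: e == e then e \in x else
  if e \in S then e \in y else if psi @: e \in S then psi @: e \notin y else e \in x].
have memx' e : e \in Om -> (e \in x') = if psi @: e == e then e \in x else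
    if e \in S then e \in y else if psi @: e \in S then psi @: e \notin y else e \in x.
  by move=> eO; rewrite in_set eO.
have x'O' : x' \subset Om by apply/subsetP => e; rewrite in_set => /andP[].
have fx' : full x'.
  move=> e eO pe; rewrite !memx' ?redges_psi // psi_setK eq_sym (negbTE pe).
  have [eS|eS] := boolP (e \in S).
    have [peS|//] := boolP (psi @: e \in S); by rewrite (S_once e eS peS) eqxx in pe.
  have [peS|peS] := boolP (psi @: e \in S); first by rewrite negbK.
  exact: fx.
have x'x : x' \in pcube psi x.
  by apply: full_cube => // e eO pe; rewrite memx' // pe eqxx.
have degR v : v != z -> v != psi z -> rdegree R v <= 2.
  move=> vz vpz; apply: (@leq_trans #|[set z; psi z]|); last by rewrite cards2; case: (_ != _).
  apply/subset_leq_card/subsetP => w; rewrite in_set RS set2_perm => /orP[]/imsetP[u uZ /setP eq].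
    have := eq (psi z); rewrite !inE eqxx /= eq_sym (negbTE vpz) /= => /eqP ->.
    by rewrite eqxx orbT.
  have := eq (psi z); rewrite !inE eqxx /= !(inj_eq psi_inj) eq_sym (negbTE vz) /= => /eqP ->.
  by rewrite eqxx.
apply: (@many_of_pattern x y x' R) => //.
- by apply: leq_trans cR _; rewrite leq_addr.
- by exists z.
- by move=> v vZ pvZ; apply: degR; apply: contraNneq vZ => h; rewrite ?h //; move: pvZ;
  rewrite h (psiK psi2) zZ.
move=> phi K hphi Kx KR; apply/negP => /cubeP hK.
have fixZ v : v \notin Z -> phi v = psi v by move=> vZ; apply/eqP; apply: contraR vZ => /hphi.
have fK := full_x' fx Kx.
pose e0 := [set z; psi z'].
have e0O : e0 \in Om by rewrite set2_redges zpz.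
have e0K : e0 \in K.
  have [zz'|zz'] := eqVneq z z'.
    by rewrite (cube_fixed Kx) ?e0x // /e0 zz' set2_perm (psiK psi2) setUC.
  have [pe0y _] := hA (elimN eqP zz').
  have pe0 : psi @: e0 = [set psi z; z'] by rewrite set2_perm (psiK psi2).
  have pe0S : psi @: e0 \in S by rewrite pe0; apply: imset_f.
  have npe0 : psi @: e0 != e0.
    apply: contra zz' => /eqP/setP/(_ z); rewrite pe0 /e0 !inE eqxx /=.
    by rewrite (negbTE (zpz _ _ zZ zZ)).
  have : psi @: e0 \notin K.
    rewrite KR ?RS ?pe0S // memx' ?redges_psi // psi_setK eq_sym (negbTE npe0) pe0S pe0.
    by [].
  by rewrite fK // negbK.
have [u uZ phiu] : exists2 u, u \in Z & phi u = psi z'.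
  exists ((phi^-1)%g (psi z')); last by rewrite permKV.
  apply: contraT => h; have := fixZ _ h; rewrite permKV => /psi_inj h'.
  by move: h; rewrite -h' z'Z.
pose f := [set psi z; u].
have phif : edge_perm phi f = e0.
  by rewrite edge_permE set2_perm phiu fixZ ?(psiK psi2) // pZ.
have fS : f \in S by apply: imset_f.
have := hK f; rewrite phif e0K e0y /= => /andP[fy fK'].
have [pf|pf] := eqVneq (psi @: f) f; last first.
  by move: fK'; rewrite KR ?RS ?fS // memx' ?SO // (negbTE pf) fS fy.
have uz : u = z.
  move: pf; rewrite set2_perm (psiK psi2) => /setP/(_ z); rewrite !inE eqxx /=.
  by rewrite (negbTE (zpz _ _ zZ zZ)) => /esym/eqP.
have [zz'|zz'] := eqVneq z z'.
  have fe : f = [set z; psi z'] by rewrite /f uz -zz' setUC.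
  by rewrite -fe fy in e0y.
have [_ xy] := hA (elimN eqP zz').
by move: fK'; rewrite (cube_fixed Kx) ?SO // xy ?SO // fy.
Qed.

(** If neither e0 nor psi e0 avoids the images of the twins, then e0 contains both a twin and the
    image of a twin, which is the shape handled by the star. *)
Lemma many_witness x y e0 : x \subset Om -> y \subset Om -> full x -> e0 \in Om ->
  e0 \notin y -> (psi @: e0 = e0 -> e0 \in x) ->
  (psi @: e0 <> e0 -> psi @: e0 \notin y /\
     forall e, e \in Om -> psi @: e = e -> (e \in x) = (e \in y)) ->
  many_unrelated x y.
Proof.
move=> xO yO fx e0O e0y e0x hA.
have pe0y : psi @: e0 \notin y.
  by have [->|/eqP/hA[]] := eqVneq (psi @: e0) e0.
have [dj|ndj] := boolP [disjoint e0 & psi @: twins y]; first exact: many_disjoint dj.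
have [dj|ndj'] := boolP [disjoint psi @: e0 & psi @: twins y].
  apply: (many_disjoint xO yO fx _ pe0y _ _ dj); rewrite ?redges_psi ?psi_setK //.
  by move=> h; rewrite -h; apply: e0x.
have tn1 : 2 * t < n.-1 by move: tn; clear; lia.
move: ndj; rewrite -setI_eq0 => /set0Pn[v0 /setIP[ve0 /imsetP[z' z'Z ev]]].
move: ndj'; rewrite -setI_eq0 => /set0Pn[_ /setIP[/imsetP[z ze0 ->] /imsetP[z1 zZ /psi_inj ez]]].
rewrite -ez {ez} in zZ; rewrite ev in ve0.
have zpz' : z != psi z'.
  by apply: contraTneq zZ => ->; apply: twins_disjoint.
have e0E : e0 = [set z; psi z'].
  apply/esym/eqP; rewrite eqEcard subUset !sub1set ze0 ve0 cards2 zpz' /=.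
  by move: e0O; rewrite inE => /eqP ->.
have pe0E : psi @: e0 = [set psi z; z'] by rewrite e0E set2_perm (psiK psi2).
apply: (@many_star x y z z') => //; rewrite -?e0E //.
  by move=> zz'; apply: e0x; rewrite pe0E e0E zz' setUC.
move=> zz'; have : psi @: e0 <> e0.
  move=> /setP/(_ z); rewrite pe0E e0E !inE eqxx /=.
  have /negbTE -> : z != psi z by apply/eqP => h; have := twins_disjoint yO tn1 zZ; rewrite -h zZ.
  by move/eqP: zz' => /negbTE ->.
by move/hA => [h1 h2]; rewrite -pe0E.
Qed.

(** Complementation interchanges entering and leaving edges and thereby inverts [phi]; it reduces
    every witness to one with e0 outside [y]. *)
Lemma cube_complement phi x K : x \subset Om -> K \subset Om ->
  (Om :\: K \in pcube (phi^-1)%g (Om :\: x)) = (K \in pcube phi x).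
Proof.
move=> /subsetP xO /subsetP KO; have pO := @redges_pres n 2 phi; rewrite edge_permV.
apply/cubeP/cubeP => h e.
  have := h (edge_perm phi e); rewrite permK !in_setD pO.
  have [eO|eO] := boolP (e \in Om); first by rewrite !andbT !negbK => hh; rewrite andbC -hh andbC.
  by rewrite (contraNF (xO e) eO) (contraNF (KO (edge_perm phi e))) // pO.
have := h ((edge_perm phi)^-1 e)%g; rewrite permKV !in_setD.
have -> : ((edge_perm phi)^-1 e \in Om)%g = (e \in Om) by rewrite -pO permKV.
have [eO|eO] := boolP (e \in Om); last by rewrite !andbF.
by rewrite !andbT !negbK => hh; rewrite andbC -hh andbC.
Qed.

Lemma many_complement x y : x \subset Om -> y \subset Om ->
  many_unrelated (Om :\: x) (Om :\: y) -> many_unrelated x y.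
Proof.
move=> xO yO [k [h1 h2]]; exists k; split=> //; apply: leq_trans h2 _; rewrite leq_mul2l /=.
have psiV : (psi^-1 = psi)%g by apply: (mulgI psi); rewrite mulgV psi2.
have compK (K : graph) : K \subset Om -> Om :\: (Om :\: K) = K.
  by move=> KO; rewrite setDDr setDv set0U; apply/setIidPr.
have subO K : K \in unrelated (Om :\: x) (Om :\: y) -> K \subset Om.
  by move=> /setIdP[/(cube_sub (@redges_pres n 2 psi) (subsetDl _ _))].
rewrite -(@card_in_imset _ _ (fun K : graph => Om :\: K) (mem (unrelated (Om :\: x) (Om :\:
  y)))); last first.
  by move=> K K' /subO KO /subO K'O eqK; rewrite -(compK K) // eqK compK.
apply/subset_leq_card/subsetP => _ /imsetP[K KU ->]; have KO := subO K KU.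
move: KU => /setIdP[Kx /forallP Ky]; apply/setIdP; split.
  by rewrite -(cube_complement psi xO (subsetDl _ _)) compK // psiV.
by apply/forallP => phi; rewrite -(cube_complement phi yO (subsetDl _ _)) compK //; apply: Ky.
Qed.

(** By [full_cube], a graph [y] outside the clique either differs from [x] on a fixed edge or treats
    some non-fixed e and psi e alike. *)
Lemma many_unrelated_outside x y : x \subset Om -> y \subset Om -> full x ->
  y \notin pcube psi x -> many_unrelated x y.
Proof.
move=> xO yO fx ync.
have cO (z : graph) : Om :\: z \subset Om by apply: subsetDl.
have memC (z : graph) e : e \in Om -> (e \in Om :\: z) = (e \notin z).
  by move=> eO; rewrite in_setD eO andbT.
have fxC : full (Om :\: x) by move=> e eO pe; rewrite !memC ?redges_psi // fx.
have [/exists_inP[e eO /and3P[/eqP pe ex ey]]|noB] :=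
    boolP [exists e in Om, [&& psi @: e == e, e \in x & e \notin y]].
  by apply: (many_witness xO yO fx eO ey) => // /eqP; rewrite pe eqxx.
have [/exists_inP[e eO /and3P[/eqP pe ex ey]]|noB'] :=
    boolP [exists e in Om, [&& psi @: e == e, e \notin x & e \in y]].
  apply: many_complement => //.
  apply: (many_witness (cO x) (cO y) fxC eO) => [|_|]; rewrite ?memC ?ey //.
  by rewrite pe.
have agree e : e \in Om -> psi @: e = e -> (e \in x) = (e \in y).
  move=> eO pe; apply/idP/idP => [ex|ey].
    by apply: contraNT noB => ey; apply/exists_inP; exists e; rewrite // pe eqxx ex.
  by apply: contraNT noB' => ex; apply/exists_inP; exists e; rewrite // pe eqxx ex.
have [/exists_inP[e eO /andP[pe /eqP ey]]|noA] :=
    boolP [exists e in Om, (psi @: e != e) && ((psi @: e \in y) == (e \in y))].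
  have [ein|enin] := boolP (e \in y); last first.
    apply: (many_witness xO yO fx eO enin) => [h|_]; first by rewrite h eqxx in pe.
    by rewrite ey enin.
  apply: many_complement => //.
  apply: (many_witness (cO x) (cO y) fxC eO); rewrite ?memC ?redges_psi // ?ey ?ein //.
    by move=> h; rewrite h eqxx in pe.
  by move=> _; split=> // f fO pf; rewrite !memC // agree.
case/negP: ync; apply: full_cube => //; last by move=> e eO pe; rewrite agree.
move=> e eO pe; apply/eqP; apply: contraNT noA => h; apply/exists_inP; exists e => //.
by rewrite pe; move: h; do 2!case: (_ \in y).
Qed.
End Unrelated.

(** * Graphs: one clique contains almost all members *)

(** These are the elements wasting nothing. Passing to a subfamily enlarges link classes, so this
    set can only shrink. *)
Definition pair_classes (E : finType) (X : {set {set E}}) :=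
  [set e | ~~ const_on X e && (#|link_class X e| == 2)].

Lemma pair_classesS (E : finType) (p : {perm E}) x (X Y : {set {set E}}) :
  X \subset cube p x -> Y \subset X -> pair_classes Y \subset pair_classes X.
Proof.
move=> Xc YX; apply/subsetP => e; rewrite !inE => /andP[nc /eqP c2].
have ncX : ~~ const_on X e by apply: contra nc; apply: const_onS.
have := nonconst_class_ge2 Xc ncX; have := subset_leq_card (link_classS e YX).
by rewrite ncX c2 /= eqn_leq => -> ->.
Qed.

Section PairClasses.
Variables (E : finType) (q : {perm E}) (y : {set E}) (X : {set {set E}}).

(* If e stays in a class of size two after intersecting with a cube around y,
   then whether e belongs to y is dictated by the class of e. *)
Lemma pair_class_orientation e : e \in pair_classes X ->
  e \in pair_classes (X :&: cube q y) -> q (q e) != e ->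
  (e \in y) = (q e \in link_class X e).
Proof.
move=> eX eXy qqe; have qe : q e != e by apply: contra qqe => /eqP qe; rewrite !qe.
move: eX eXy; rewrite [e \in pair_classes X]inE [e \in pair_classes _]inE.
move=> /andP[_ /eqP c2] /andP[nc /eqP c2'].
have cls : link_class X e = link_class (X :&: cube q y) e.
  by apply/eqP; rewrite eqEcard link_classS ?subsetIl // c2 c2'.
have Yq : X :&: cube q y \subset cube q y by apply: subsetIr.
have pE := nonconst_linked Yq nc; have pN := nonconst_partner_neq Yq nc.
move: pE pN; rewrite /partner; case: ifP => ey pE pN.
  by rewrite cls inE pE.
apply/esym/negbTE/negP => qin.
have : #|[set e; q e; (q^-1)%g e]| <= #|link_class X e|.
  apply/subset_leq_card/subsetP => f; rewrite !in_setU !in_set1.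
  move=> /orP[/orP[/eqP ->|/eqP ->]|/eqP ->] //; first exact: mem_link_class.
  by rewrite cls inE.
rewrite -setUA !cardsU1 cards1 c2 !inE negb_or [e == q e]eq_sym qe [e == _]eq_sym pN /=.
by rewrite -(inj_eq (@perm_inj _ q)) permKV qqe.
Qed.
End PairClasses.

Lemma leq_expLR a b L h m : 0 < L -> a ^ L <= b ^ L * 2 ^ m -> m <= h * L -> a <= b * 2 ^ h.
Proof.
move=> L0 h1 h2; rewrite -(leq_exp2r _ _ L0) expnMn -expnM.
by apply: leq_trans h1 _; rewrite leq_mul2l leq_exp2l // h2 orbT.
Qed.

Lemma bin2E n : 2 * 'C(n, 2) = n * n.-1.
Proof. by rewrite mul2n bin2 -[RHS]odd_double_half oddM; case: n => // m /=; rewrite andNb. Qed.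

Lemma nonrigid2_arith n l f N s k : 1000 <= n -> 0 < l -> 2 * f + n./2 = N -> s = 1000 * l ^ 2 ->
  6 * k + (s * (n - 3))./2 <= 3 * N + 12 * n * l + 6 * 3 * l * (4 * (n * (l + 3))) + 4 * (n * (l
    + 3)) ->
  k + 2 * n <= f.
Proof.
move=> n1000 l0 <- ->; have -> : (1000 * l ^ 2 * (n - 3))./2 = 500 * (l ^ 2 * (n - 3)).
  by have := half_bit_double (500 * (l ^ 2 * (n - 3))) false; rewrite add0n => <-; congr _./2; lia.
rewrite -mulnn; have e1 : l * l * (n - 3) + 3 * (l * l) = l * l * n by rewrite [3 * _]mulnC
  -mulnDr; congr (_ * _); lia.
have e2 : 1000 * (l * l) <= l * l * n by rewrite mulnC leq_mul2l n1000 orbT.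
have e3 : n * l <= l * l * n by rewrite [n * l]mulnC leq_mul2r leq_pmulr ?orbT.
have e4 : n <= n * l by rewrite leq_pmulr.
have -> : 6 * 3 * l * (4 * (n * (l + 3))) = 72 * (l * l * n) + 216 * (n * l) by lia.
have -> : 4 * (n * (l + 3)) = 4 * (n * l) + 12 * n by lia.
have -> : 12 * n * l = 12 * (n * l) by lia.
move: e1 e2 e3 e4; move: (n * l) (l * l) (l * l * n) (l * l * (n - 3)) => d c b a.
by clear; lia.
Qed.

Lemma drop_arith n N f L k tau a b : 2 * f + n./2 = N ->
  f * L + a <= (tau + 3 + k) * L + b -> 6 * k <= 2 * N + a -> b <= N -> 1000 <= L ->
  1000 <= n -> 1000 * (tau + 1) <= n -> b <= a + 4 * n.
Proof.
move=> fN h1 h2 bN L1000 n1000 tn; rewrite leqNgt; apply/negP => big.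
have [d dE] : exists d, b = a + d by exists (b - a); lia.
have [g gE] : exists g, f = tau + 3 + k + g by exists (f - (tau + 3 + k)); nia.
have gd : g * L <= d by move: h1; rewrite gE dE; nia.
have h3 : 6 * f <= 3 * N - d + 6 * (tau + 3 + g) by lia.
have h4 : 1000 * g <= d by apply: leq_trans gd; rewrite mulnC leq_mul2l L1000 orbT.
by lia.
Qed.

Lemma pot_arith A B N a b : a <= N -> b <= N -> A * 2 ^ (N - a) <= B * 2 ^ (N - b) ->
  A * 2 ^ b <= B * 2 ^ a.
Proof.
move=> aN bN h; rewrite -(@leq_pmul2r (2 ^ N)) ?expn_gt0 //.
have -> : A * 2 ^ b * 2 ^ N = A * 2 ^ (N - a) * 2 ^ (a + b).
  by rewrite -!mulnA -!expnD; congr (_ * 2 ^ _); move: aN; clear; lia.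
have -> : B * 2 ^ a * 2 ^ N = B * 2 ^ (N - b) * 2 ^ (a + b).
  by rewrite -!mulnA -!expnD; congr (_ * 2 ^ _); move: bN; clear; lia.
by rewrite leq_mul2r h orbT.
Qed.

Lemma moved_arith n d : 1 < d -> d <= n -> 10 <= n -> 4 * n <= d * (2 * n - d - 3) + 10.
Proof.
move=> d2 dn n3; have [e de] : exists e, d = e + 2 by exists (d - 2); lia.
have [k nk] : exists k, n = k + e + 2 by exists (n - d); lia.
have -> : 2 * n - d - 3 = 2 * k + e - 1 by rewrite de nk; clear; lia.
rewrite de nk; case: e {de dn} nk => [|e] nk; first by lia.
have -> : 2 * k + e.+1 - 1 = 2 * k + e by lia.
by case: e nk => [|[|e]] nk; nia.
Qed.

Lemma popular_arith n d f N k S U l eta slack : 1000 <= n -> 1 < d -> d <= n ->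
  2 * f + n./2 = N -> 6 * k + 3 * S <= 3 * N -> d * (2 * n - d - 3) <= 2 * (S + U) ->
  U <= n./2 + 2 * eta -> 1000 * (l * eta) <= 10 * n -> eta <= l * eta -> 1000 * l <= n ->
  slack * 50 <= n -> k + 18 * (l * eta) + 3 * d * l + slack <= f.
Proof.
move=> n1000 d2 dn <- h1 h2 h3 h4 h5 h6 h7.
have h8 : 4 * n <= d * (2 * n - d - 3) + 10 by apply: moved_arith => //; move: n1000; clear; lia.
have h9 : d * (100 * l) <= d * (2 * n - d - 3).
  by rewrite leq_mul2l; apply/orP; right; move: n1000 dn h6; clear; lia.
have -> : 3 * d * l = 3 * (d * l) by clear; lia.
have {}h9 : 100 * (d * l) <= d * (2 * n - d - 3) by move: h9; move: (d * (2 * n - d - 3)); clear;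
  lia.
move: n1000 h1 h2 h3 h4 h5 h7 h8 h9; move: (l * eta) (d * l) (d * (2 * n - d - 3)).
by clear; lia.
Qed.

Section Graphs.
Variables (n l f : nat).
Hypotheses (nl : n <= 2 ^ l) (l0 : 0 < l) (fN : 2 * f + n./2 = 'C(n, 2)).
Local Notation graph := {set {set 'I_n}}.
Local Notation Om := (redges n 2).
Local Notation N := 'C(n, 2).
Local Notation pcube phi x := (cube (edge_perm phi) x).
Variable F : {set graph}.
Hypothesis FO : forall x, x \in F -> x \subset Om.
Hypothesis Fdiff : forall x y, x \in F -> y \in F -> exists phi, y \in pcube phi x.
Hypothesis Flarge : 2 ^ f <= 2 * #|F|.

(** Moving more than [s] vertices moves at least [s] (n-3) / 2 edges, which must outweigh the order
    n l^2 needed to record the exceptions allowed by [E0]; hence [s] of order l^2. [E0] exceeds the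
    n l bits of all permutations by 3n. A ball of radius [s] has at most 2^[tau] permutations. [L]
    weighs size against pair classes in the potential. *)
Variables (s E0 tau L : nat).
Hypotheses (sE : s = 1000 * l ^ 2) (E0E : E0 = n * (l + 3)) (tauE : tau = 3 * l * s).
Hypothesis LE : L = 1000 * l.
Hypothesis big : 1000 * (l * ((tau + 1) * L)) <= n.

Lemma L_gt0 : 0 < L. Proof. by rewrite LE muln_gt0. Qed.

Lemma big_ltau : 1000 * (l * (tau + 1)) <= n.
Proof. by apply: leq_trans big; rewrite !leq_mul2l leq_pmulr ?orbT // L_gt0. Qed.

Lemma big_tau : 1000 * (tau + 1) <= n.
Proof. by apply: leq_trans big_ltau; rewrite leq_mul2l leq_pmull. Qed.

Lemma big_l : 1000 * l <= n.
Proof. by apply: leq_trans big_ltau; rewrite leq_mul2l leq_pmulr ?addn1. Qed.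

Lemma n_ge1000 : 1000 <= n.
Proof. by apply: leq_trans big_l; rewrite leq_pmulr. Qed.

Lemma two_f_ge : 2 * n <= f.
Proof.
have := bin2E n; have := n_ge1000; have : 1000 * n.-1 <= n * n.-1 by rewrite leq_mul2r n_ge1000
  orbT.
by move: (n * n.-1) fN => a; clear; lia.
Qed.

Lemma E0N : 2 * E0 <= N.
Proof.
have h : 4 * (l + 3) <= n.-1 by have := big_l; have := n_ge1000; clear; lia.
have := bin2E n; have : n * (4 * (l + 3)) <= n * n.-1 by rewrite leq_mul2l h orbT.
by rewrite E0E mulnCA; move: (n * (l + 3)) (n * n.-1); clear; lia.
Qed.

Lemma card_ball (phi : 'S_n) : #|[set psi : 'S_n | #|supp (phi^-1 * psi)%g| <= s]| <= 2 ^ tau.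
Proof.
rewrite -(card_imset _ (mulgI (phi^-1)%g)); apply: leq_trans (_ : #|[set t : 'S_n | #|supp t| <=
  s]| <= _).
  by apply/subset_leq_card/subsetP => _ /imsetP[psi + ->]; rewrite !inE.
apply: leq_trans (card_supp_le n s) _; rewrite tauE expnM; apply: leq_expl.
apply: (@leq_trans (2 ^ l * 2 ^ l + 1)); first by rewrite leq_add2r leq_mul.
rewrite -!expnD (_ : 3 * l = l + l + l); last by clear; lia.
have h1 : 1 < 2 ^ l by rewrite -{1}[2]expn1 leq_exp2l // -expnD.
rewrite (expnD 2 (l + l)); have : 0 < 2 ^ (l + l) by rewrite expn_gt0.
by move: h1; move: (2 ^ l) (2 ^ (l + l)) => b a; clear; nia.
Qed.

Lemma card_nonrigid2 : #|[set y in F | ~~ rigid 2 s (4 * E0) y]| <= 2 ^ (f - 2 * n).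
Proof.
have n1000 := n_ge1000.
have s_n : s <= n.
  have := big_tau; rewrite tauE; have : s <= 3 * l * s by rewrite leq_pmull // muln_gt0.
  by move: (3 * l * s); clear; lia.
have [||k [hk hk2]] := @card_nonrigid_family n 2 l nl l0 F FO Fdiff s (4 * E0) (s * (n - 3))./2.
- have : s * (n - 3) <= 2 * 'C(n, 2).
    by rewrite bin2E; apply: leq_mul => //; move: n1000; clear; lia.
  by move: (s * (n - 3)); clear; lia.
- move=> t st; have h1 := moved2_ge t.
  have dn : #|supp t| <= n by rewrite -[n in _ <= n]card_ord max_card.
  have h2 : s * (n - 3) <= #|supp t| * (2 * n - #|supp t| - 3).
    by apply: leq_mul; [apply: ltnW | move: dn; clear; lia].
  by have := leq_trans h2 h1; move: (s * (n - 3)) (moved _ _); clear; lia.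
have := nonrigid2_arith n1000 l0 fN sE; rewrite -E0E => /(_ _ hk2) h.
by apply: leq_trans hk _; rewrite leq_exp2l //; move: h; clear; lia.
Qed.

Lemma card_far2 y (Z : {set graph}) : y \in F ->
  #|[set z in Z | [exists phi, ~~ near 2 E0 y phi && (z \in pcube phi y)]]| <= 2 ^ (f - 2 * n).
Proof.
move=> yF; have [k [hk hk2]] := card_far nl l0 Z E0N (FO yF).
apply: leq_trans hk _; rewrite leq_exp2l //; move: hk2; rewrite E0E -fN -(mulnA 6) mulnDr.
by move: (n * l); clear; lia.
Qed.

Lemma near_ball y phi psi : rigid 2 s (4 * E0) y -> near 2 E0 y phi -> near 2 E0 y psi ->
  psi \in [set psi : 'S_n | #|supp (phi^-1 * psi)%g| <= s].
Proof. by move=> yr h1 h2; rewrite inE; apply: near_rigid yr h1 h2. Qed.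

(** Permutations that are not near reach a negligible part of [Z]; by rigidity the near ones fill at
    most one ball, so one of them reaches a fraction 2^(-[tau]-1) of [Z]. *)
Lemma popular y (Z : {set graph}) : y \in F -> rigid 2 s (4 * E0) y -> Z \subset F ->
  2 ^ (f - 2 * n).+1 <= #|Z| ->
  exists2 phi, near 2 E0 y phi & #|Z| <= 2 ^ tau.+1 * #|Z :&: pcube phi y|.
Proof.
move=> yF yr ZF Zbig.
pose Far := [set z in Z | [exists phi, ~~ near 2 E0 y phi && (z \in pcube phi y)]].
pose Z' := Z :\: Far.
have cZ' : #|Z| <= 2 * #|Z'|.
  have := cardsID Far Z; have -> : Z :&: Far = Far by apply/setIidPr/subsetP => z;
    rewrite inE => /andP[].
  have := card_far2 Z yF; rewrite -/Far -/Z'; move: Zbig; rewrite expnS.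
  by move: #|Far| #|Z'| #|Z| (2 ^ _); clear; lia.
have Z'near z : z \in Z' -> exists2 phi, near 2 E0 y phi & z \in pcube phi y.
  rewrite in_setD => /andP[nfar zZ]; have [phi zy] := Fdiff yF (subsetP ZF z zZ).
  exists phi => //; apply: contraR nfar => np; rewrite inE zZ; apply/existsP.
  by exists phi; rewrite np.
pose col z := odflt 1%g [pick phi : 'S_n | near 2 E0 y phi && (z \in pcube phi y)].
have colP z : z \in Z' -> near 2 E0 y (col z) /\ z \in pcube (col z) y.
  move=> /Z'near[phi h1 h2]; rewrite /col; case: pickP => [psi /andP[] //|/(_ phi)].
  by rewrite h1 h2.
have Z'0 : Z' != set0.
  rewrite -card_gt0; have : 0 < 2 ^ (f - 2 * n).+1 by rewrite expn_gt0.
  by move: Zbig cZ'; move: (2 ^ _) #|Z| #|Z'|; clear; lia.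
have [phi0 _ phi0n] : exists2 phi0 : 'S_n, true & near 2 E0 y phi0.
  by have /set0Pn[z /colP[]] := Z'0; exists (col z).
have [|phi phiB hphi] := @pigeonhole _ _ Z' [set phi | near 2 E0 y phi] col _ Z'0.
  by move=> z /colP[]; rewrite inE.
exists phi; first by rewrite inE in phiB.
apply: leq_trans cZ' _; rewrite expnS -mulnA leq_mul2l /=; apply: leq_trans hphi _.
apply: leq_mul.
  apply: leq_trans (card_ball phi0); apply/subset_leq_card/subsetP => psi; rewrite inE.
  exact: near_ball.
apply/subset_leq_card/subsetP => z /setIdP[zZ' /eqP <-]; rewrite in_setI (colP z zZ').2 andbT.
by move: zZ'; rewrite in_setD => /andP[].
Qed.

(** The inverse of [phi0] is near every member of [X0], so the near permutations of all these
    members lie in one common ball. *)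
Lemma step1 : exists x0 (phi0 : 'S_n) (X0 : {set graph}), [/\ x0 \in F, X0 \subset F,
  X0 \subset pcube phi0 x0, forall y, y \in X0 -> rigid 2 s (4 * E0) y /\ near 2 E0 y (phi0^-1)%g
  & 2 ^ f <= 2 ^ (tau + 3) * #|X0|].
Proof.
pose Fr := [set y in F | rigid 2 s (4 * E0) y].
pose e0 := f - 2 * n.
have n1000 := n_ge1000; have f2n := two_f_ge.
have e0f : 16 * 2 ^ e0 <= 2 ^ f.
  by rewrite (_ : 16 = 2 ^ 4) // -expnD leq_exp2l // /e0; move: f2n n1000; clear; lia.
have cFr : #|F| <= #|Fr| + 2 ^ e0.
  rewrite -(cardsID [set y | rigid 2 s (4 * E0) y] F); apply: leq_add.
    by apply/subset_leq_card/subsetP => y; rewrite !inE.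
  by apply: leq_trans card_nonrigid2; apply/subset_leq_card/subsetP => y; rewrite !inE andbC.
pose bad y z := [exists phi : 'S_n, ~~ near 2 E0 y phi && (z \in pcube phi y)].
(* For each y few graphs are reached by permutations not near y; averaging yields an [x0] that is so
   reached from few y. *)
have [x0 x0Fr hx0] : exists2 x0, x0 \in Fr & #|[set y in Fr | bad y x0]| <= 2 ^ e0.
  apply/exists_inP; apply: contraT; rewrite negb_exists_in => /forall_inP h.
  have h1 : \sum_(z in Fr) #|[set y in Fr | bad y z]| <= #|Fr| * 2 ^ e0.
    rewrite (exchange_card Fr (fun z y => bad y z)) -sum_nat_const.
    by apply: leq_sum => y; rewrite inE => /andP[yF _]; apply: card_far2.
  have h2 : #|Fr| * (2 ^ e0).+1 <= \sum_(z in Fr) #|[set y in Fr | bad y z]|.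
    by rewrite -sum_nat_const; apply: leq_sum => z /h; rewrite -ltnNge.
  have := leq_trans h2 h1; rewrite mulnS -[X in _ <= X]add0n leq_add2r leqn0 => /eqP Fr0.
  move: cFr e0f Flarge; rewrite Fr0; have : 0 < 2 ^ e0 by rewrite expn_gt0.
  by move: #|F| (2 ^ e0) (2 ^ f); clear; lia.
have x0F : x0 \in F by move: x0Fr; rewrite inE => /andP[].
have x0r : rigid 2 s (4 * E0) x0 by move: x0Fr; rewrite inE => /andP[].
pose X1 := [set y in Fr | ~~ bad y x0 && ~~ bad x0 y].
have cX1 : #|Fr| <= #|X1| + 2 * 2 ^ e0.
  have : Fr \subset X1 :|: ([set y in Fr | bad y x0] :|: [set y in Fr | bad x0 y]).
    apply/subsetP => y yFr; rewrite !in_setU; apply/orP.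
    have [b1|b1] := boolP (bad y x0); first by right; apply/orP; left; rewrite inE yFr.
    have [b2|b2] := boolP (bad x0 y); first by right; apply/orP; right; rewrite inE yFr.
    by left; rewrite inE yFr b1 b2.
  move/subset_leq_card/leq_trans => /(_ _ (leq_card_setU _ _)) /leq_trans; apply.
  rewrite leq_add2l mul2n -addnn; apply: leq_trans (leq_card_setU _ _) _.
  by apply: leq_add => //; apply: card_far2.
pose col y := odflt 1%g [pick phi : 'S_n | y \in pcube phi x0].
have colP y : y \in X1 -> y \in pcube (col y) x0.
  rewrite inE => /andP[yFr _]; have yF : y \in F by move: yFr; rewrite inE => /andP[].
  by have [phi hphi] := Fdiff x0F yF; rewrite /col; case: pickP => // /(_ phi); rewrite hphi.
have col_near y : y \in X1 -> near 2 E0 x0 (col y) /\ near 2 E0 y (col y)^-1%g.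
  move=> yX; have yc := colP y yX; move: yX; rewrite inE => /and3P[yFr b1 b2]; split.
    by apply: contraR b2 => np; apply/existsP; exists (col y); rewrite np.
  apply: contraR b1 => np; apply/existsP; exists (col y)^-1%g; rewrite np /=.
  by rewrite edge_permV -cubeV.
have X10 : X1 != set0.
  rewrite -card_gt0; move: cX1 cFr e0f Flarge; have : 0 < 2 ^ e0 by rewrite expn_gt0.
  by move: #|X1| #|Fr| #|F| (2 ^ e0) (2 ^ f); clear; lia.
have [|phi0 phi0B hphi0] := @pigeonhole _ _ X1 [set phi | near 2 E0 x0 phi] col _ X10.
  by move=> y /col_near[]; rewrite inE.
have X1F y : y \in X1 -> y \in F /\ rigid 2 s (4 * E0) y.
  by rewrite inE => /andP[+ _]; rewrite inE => /andP[].
exists x0, phi0, [set y in X1 | col y == phi0]; split=> //.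
- by apply/subsetP => y /setIdP[/X1F[]].
- by apply/subsetP => y /setIdP[/colP + /eqP <-].
- by move=> y /setIdP[yX /eqP <-]; split; [have [] := X1F y yX | have [] := col_near y yX].
set X0 := [set y in X1 | _] in hphi0 *.
have cB : #|[set phi | near 2 E0 x0 phi]| <= 2 ^ tau.
  apply: leq_trans (card_ball phi0); apply/subset_leq_card/subsetP => psi; rewrite inE.
  by apply: near_ball => //; move: phi0B; rewrite inE.
have : #|X1| <= 2 ^ tau * #|X0| by apply: leq_trans hphi0 _; rewrite leq_mul2r cB orbT.
rewrite expnD -mulnA [2 ^ 3 * _]mulnC mulnA.
move: cX1 cFr e0f Flarge; move: #|X1| #|Fr| #|F| (2 ^ e0) (2 ^ f) (2 ^ tau * #|X0|).
by rewrite (_ : 2 ^ 3 = 8) //; clear; lia.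
Qed.

(** The bits given up by the potential maximizer, which has at most 4n fewer elements in pair
    classes than the initial family. *)
Let h := (4 * n) %/ L + 1.

Lemma hL : 4 * n <= h * L.
Proof. by rewrite /h addn1; apply/ltnW/ltn_ceil/L_gt0. Qed.

Lemma lh_le : 1000 * (l * h) <= 5 * n.
Proof.
have := leq_trunc_div (4 * n) L; rewrite {2}LE /h mulnDr muln1 mulnDr.
by have := big_l; move: (_ %/ L) => q; clear; lia.
Qed.

Lemma card_pair_classes (phi0 : 'S_n) (x0 : graph) (X : {set graph}) : x0 \subset Om ->
  X \subset pcube phi0 x0 -> #|pair_classes X| <= N /\
  exists k, #|X| <= 2 ^ k /\ 6 * k <= 2 * N + #|pair_classes X|.
Proof.
move=> x0O Xc; have pO := @redges_pres n 2 phi0.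
have PO : pair_classes X \subset Om.
  apply/subsetP => e; rewrite inE => /andP[nc _]; apply: contraR nc => eO.
  apply/const_onP => K K' /(subsetP Xc) hK /(subsetP Xc) hK'.
  by rewrite !(contraNF (subsetP (cube_sub pO x0O _) _) eO).
have cN : #|pair_classes X| <= N by rewrite -card_redges; apply: subset_leq_card.
split=> //.
have [||||e|k [hk hk2]] := @card_cube_classes _ Om (edge_perm phi0) x0 X set0 (Om :\:
  pair_classes X) pO x0O Xc.
- exact: sub0set.
- exact: subsetDl.
- by rewrite -setI_eq0 set0I.
- by move=> e; rewrite in_set0.
- rewrite in_setD inE => /andP[+ _] nc; rewrite nc /= => c2.
  by rewrite ltn_neqAle eq_sym c2 (nonconst_class_ge2 Xc nc).
exists k; split=> //; move: hk2; rewrite cards0 cardsD (setIidPr PO) card_redges.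
by move: cN; move: #|pair_classes X| N; clear; lia.
Qed.

(* X maximizes |X|^L * 2^(-|pair_classes X|), so that passing to a popular
   subset keeps almost all classes of size two. *)
Lemma extremal_family (phi0 : 'S_n) (x0 : graph) (X0 : {set graph}) : x0 \subset Om ->
  X0 \subset pcube phi0 x0 -> 2 ^ f <= 2 ^ (tau + 3) * #|X0| ->
  exists X : {set graph}, [/\ X \subset X0, 2 ^ f <= 2 ^ (tau + 3 + h) * #|X| &
    forall (Y : {set graph}) m, Y \subset X -> #|X| <= 2 ^ m * #|Y| ->
      #|pair_classes X| <= #|pair_classes Y| + m * L].
Proof.
move=> x0O X0c X0big.
pose pot (X : {set graph}) := #|X| ^ L * 2 ^ (N - #|pair_classes X|).
pose X := [arg max_(X > X0 | X \subset X0) pot X].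
have [XX0 Xmax] : X \subset X0 /\ forall Y : {set graph}, Y \subset X0 -> pot Y <= pot X.
  by rewrite /X; case: arg_maxnP.
have Xc := subset_trans XX0 X0c; have [cX [k [hk hk2]]] := card_pair_classes x0O Xc.
have [cX0 _] := card_pair_classes x0O X0c.
have max_le (Y : {set graph}) : Y \subset X0 ->
    #|Y| ^ L * 2 ^ #|pair_classes X| <= #|X| ^ L * 2 ^ #|pair_classes Y|.
  move=> YX0; have := Xmax Y YX0; rewrite /pot.
  have [cY _] := card_pair_classes x0O (subset_trans YX0 X0c).
  exact: pot_arith.
have L0 := L_gt0.
have X0pos : 0 < #|X0|.
  have f0 : 0 < 2 ^ f by rewrite expn_gt0.
  by move: (leq_trans f0 X0big); rewrite muln_gt0 => /andP[].
have Xpos : 0 < #|X|.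
  have : 0 < #|X| ^ L * 2 ^ #|pair_classes X0|.
    by apply: leq_trans (max_le X0 (subxx _)); rewrite muln_gt0 !expn_gt0 X0pos.
  by rewrite muln_gt0 expn_gt0 => /andP[/orP[//|/eqP L00]]; rewrite L00 in L0.
exists X; split=> //; last first.
  move=> Y m YX YXm; have := max_le Y (subset_trans YX XX0).
  have : #|X| ^ L <= #|Y| ^ L * 2 ^ (m * L).
    by rewrite expnM -expnMn leq_exp2r // mulnC.
  have Yp : 0 < #|Y| by move: (leq_trans Xpos YXm); rewrite muln_gt0 => /andP[].
  have YL : 0 < #|Y| ^ L by rewrite expn_gt0 Yp.
  move=> h1 h2; rewrite -(@leq_exp2l 2) // -(@leq_pmul2l _ _ _ YL); apply: leq_trans h2 _.
  apply: leq_trans (leq_mul h1 (leqnn _)) _.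
  by rewrite -mulnA leq_pmul2l // -expnD addnC.
(* A drop by d lowers the size bound by d/6 bits, hence the potential by about [L] d/6 against a
   gain of only d. As the initial family misses only [tau] + 3 bits of 2^f, this excludes d > 4n. *)
have drop : #|pair_classes X0| <= #|pair_classes X| + 4 * n.
  have h1 := max_le X0 (subxx _).
  have h2 : 2 ^ (f * L + #|pair_classes X|) <= 2 ^ ((tau + 3 + k) * L + #|pair_classes X0|).
    rewrite !expnD !expnM; apply: (@leq_trans ((2 ^ (tau + 3) * #|X0|) ^ L * 2 ^ #|pair_classes
      X|)).
      by rewrite leq_mul2r leq_exp2r // X0big orbT.
    rewrite expnMn -mulnA; apply: leq_trans (leq_mul (leqnn _) h1) _.
    by rewrite mulnA leq_mul2r -expnMn leq_exp2r // (expnD 2 (tau + 3)) leq_mul2l hk !orbT.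
  move: h2; rewrite leq_exp2l // => h2.
  have L12 : 1000 <= L by rewrite LE leq_pmulr.
  have := big_tau; have := n_ge1000.
  apply: drop_arith fN h2 hk2 cX0 L12.
apply: leq_trans X0big _; rewrite [tau + 3 + h]addnC [in X in _ <= X]expnD [2 ^ h * _]mulnC
  -mulnA leq_mul2l.
rewrite [2 ^ h * _]mulnC (@leq_expLR _ _ L h (4 * n)) ?orbT //; last exact: hL.
rewrite -(@leq_pmul2r (2 ^ #|pair_classes X|)) ?expn_gt0 //.
apply: leq_trans (max_le X0 (subxx _)) _.
by rewrite -mulnA -expnD leq_mul2l leq_exp2l // addnC drop orbT.
Qed.

Lemma popular_involution : exists (psi : 'S_n) y, [/\ (psi * psi = 1)%g, y \in F,
  rigid 2 s (4 * E0) y, near 2 E0 y psi & 2 ^ f <= 2 ^ (2 * tau + h + 4) * #|F :&: pcube psi y|].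
Proof.
have [x0 [phi0 [X0 [x0F X0F X0c X0r X0big]]]] := step1.
have x0O := FO x0F.
have [X [XX0 Xbig Xpairs]] := extremal_family x0O X0c X0big.
have Xc := subset_trans XX0 X0c; have XF := subset_trans XX0 X0F.
have f2n := two_f_ge; have n1000 := n_ge1000; have bt := big_tau; have lh := lh_le.
have hl : 1000 * h <= 5 * n by apply: leq_trans lh; rewrite !leq_mul2l leq_pmull ?orbT.
have Xbig1 : 2 ^ (f - 2 * n).+1 <= #|X|.
  rewrite -(@leq_pmul2l (2 ^ (tau + 3 + h))) ?expn_gt0 // -expnD.
  by apply: leq_trans Xbig; rewrite leq_exp2l //; move: f2n n1000 bt hl; clear; lia.
have X_0 : X != set0 by rewrite -card_gt0; apply: leq_trans Xbig1; rewrite expn_gt0.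
have Xpop y : y \in X -> exists phi : 'S_n, near 2 E0 y phi && (#|X| <= 2 ^ tau.+1 * #|X :&:
  pcube phi y|).
  move=> yX; have [yr _] := X0r y (subsetP XX0 y yX).
  have [phi h1 h2] := popular (subsetP XF y yX) yr XF Xbig1.
  by exists phi; rewrite h1.
pose col y := odflt 1%g [pick phi : 'S_n | near 2 E0 y phi && (#|X| <= 2 ^ tau.+1 * #|X :&: pcube
  phi y|)].
have colP y : y \in X -> near 2 E0 y (col y) /\ #|X| <= 2 ^ tau.+1 * #|X :&: pcube (col y) y|.
  move=> /Xpop[phi hphi]; rewrite /col; case: pickP => [psi /andP[] //|/(_ phi)].
  by rewrite hphi.
pose Ball := [set psi : 'S_n | #|supp ((phi0^-1)^-1 * psi)%g| <= s].
have [|phi _ hphi] := @pigeonhole _ _ X Ball col _ X_0.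
  by move=> y yX; have [h1 h2] := X0r y (subsetP XX0 y yX); apply: near_ball h1 h2 (colP y yX).1.
set Y := [set y in X | _] in hphi.
have YX : Y \subset X by apply/subsetP => y /setIdP[].
have Ybig : #|X| <= 2 ^ tau * #|Y|.
  by apply: leq_trans hphi _; rewrite leq_mul2r card_ball orbT.
have YP y : y \in Y -> near 2 E0 y phi /\ #|X| <= 2 ^ tau.+1 * #|X :&: pcube phi y|.
  by move=> /setIdP[yX /eqP <-]; apply: colP.
pose q := edge_perm phi.
pose S := [set e in pair_classes X | q (q e) != e].
pose G := [set e | q e \in link_class X e].
pose delta := tau.+1 * L.
have PO : pair_classes X \subset Om.
  apply/subsetP => e; rewrite inE => /andP[nc _]; apply: contraR nc => eO.
  apply/const_onP => K K' /(subsetP Xc) hK /(subsetP Xc) hK'.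
  by rewrite !(contraNF (subsetP (cube_sub (@redges_pres n 2 phi0) x0O _) _) eO).
have SO : S \subset Om by apply: subset_trans PO; apply/subsetP => e /setIdP[].
(* By extremality all but [delta] elements of pair classes keep a class of size two among the graphs
   related to y by [phi]; on those moved by the square of [phi], y must agree with [G], which does
   not depend on y. *)
have [|Y' [Y'Y Y'big Y'c]] := @fiber_prescribed _ Om Y S G delta SO.
  move=> y yY; apply: (@leq_trans #|pair_classes X :\: pair_classes (X :&: pcube phi y)|).
    apply/subset_leq_card/subsetP => e /setIdP[/setIdP[eX qqe] ne].
    rewrite in_setD eX andbT; apply: contra ne => eXy.
    by rewrite (pair_class_orientation eX eXy qqe) [e \in G]in_set eqxx.
  have := Xpairs (X :&: pcube phi y) tau.+1 (subsetIl _ _) (YP y yY).2.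
  have sub := pair_classesS Xc (subsetIl X (pcube phi y)).
  rewrite cardsD (setIidPr sub) leq_subLR; exact.
have Y'X := subset_trans Y'Y YX.
(* Otherwise each edge moved by phi * phi is constant on [Y'] or in a class of size at least three.
   These at least 2n - 5 edges outweigh the gap 3 (n/2) between 3N and 6f, so [Y'] would be too
   small. *)
have phi2 : (phi * phi = 1)%g.
  apply/eqP; apply: contraT => phi2.
  have Y'cc := subset_trans Y'X Xc.
  pose Bd := [set e in Om | edge_perm (phi * phi)%g e != e].
  have [||||e|k [hk hk2]] := @card_cube_classes _ Om (edge_perm phi0) x0 Y' set0 Bd
    (@redges_pres n 2 phi0) x0O Y'cc.
  - exact: sub0set.
  - by apply/subsetP => e /setIdP[].
  - by rewrite -setI_eq0 set0I.
  - by move=> e; rewrite in_set0.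
  - move=> /setIdP[eO]; rewrite edge_permM permM => qqe nc.
    have ncX : ~~ const_on X e by apply: contra nc; apply: const_onS Y'X.
    apply: leq_trans (subset_leq_card (link_classS e Y'X)).
    rewrite ltn_neqAle (nonconst_class_ge2 Xc ncX) andbT eq_sym.
    apply: contra nc => c2; apply: Y'c; apply/setIdP; split=> //.
    by rewrite inE ncX.
  have mv := moved2_ge (phi * phi)%g; have d2 := card_supp_gt1 phi2.
  have dn : #|supp (phi * phi)%g| <= n by rewrite -[n in _ <= n]card_ord max_card.
  have mv2 : 2 * n <= #|Bd| + 5.
    have d4 : 4 * n <= #|supp (phi * phi)%g| * (2 * n - #|supp (phi * phi)%g| - 3) + 10.
      by apply: moved_arith => //; move: n1000; clear; lia.
    by rewrite -/(moved Om (edge_perm (phi * phi)%g));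
      move: (leq_trans d4 (leq_add mv (leqnn _))); clear; lia.
  have chain : 2 ^ f <= 2 ^ (tau + 3 + h + (tau + (3 * l * delta + k))).
    apply: leq_trans Xbig _; rewrite (expnD 2 (tau + 3 + h)) leq_mul2l; apply/orP; right.
    apply: leq_trans Ybig _; rewrite expnD leq_mul2l; apply/orP; right.
    apply: leq_trans Y'big _; rewrite expnD expnM card_redges; apply: leq_mul => //.
    by apply: leq_expl; apply: bin_succ_le.
  move: chain; rewrite leq_exp2l // => chain.
  have ldelta : 1000 * (l * delta) <= n by move: big; rewrite /delta addn1.
  move: hk2; rewrite cards0 card_redges.
  have := chain; have := mv2; have := fN; rewrite -(mulnA 3).
  move: ldelta bt hl n1000; move: (l * delta) #|Bd| 'C(n, 2) h; clear; lia.
have [y yY] : exists y, y \in Y.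
  apply/set0Pn; rewrite -card_gt0; have : 0 < #|X| by rewrite card_gt0.
  by move/leq_trans => /(_ _ Ybig); rewrite muln_gt0 => /andP[].
have [ny hy] := YP y yY; have yX := subsetP YX y yY.
exists phi, y; split=> //; first exact: subsetP yX.
  by have [] := X0r y (subsetP XX0 y yX).
apply: leq_trans Xbig _; have -> : 2 * tau + h + 4 = (tau + 3 + h) + tau.+1 by clear; lia.
rewrite (expnD 2 (tau + 3 + h)) -mulnA leq_mul2l; apply/orP; right; apply: leq_trans hy _.
by rewrite leq_mul2l subset_leq_card ?orbT // setSI.
Qed.

(** * Members outside the popular clique *)

Section Outside.
Variables (psi : 'S_n) (y0 : graph).
Hypotheses (psi2 : (psi * psi = 1)%g) (y0F : y0 \in F).
Hypotheses (y0r : rigid 2 s (4 * E0) y0) (y0n : near 2 E0 y0 psi).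
Let A := F :&: pcube psi y0.
Hypothesis Abig : 2 ^ f <= 2 ^ (2 * tau + h + 4) * #|A|.

(** The total deficiency in bits: 2 [tau] + h + 4 for [A] and [tau] + 1 for a popular part of it. *)
Let eta := 3 * tau + h + 5.
Let U := [set e in Om | (e \in y0) == (edge_perm psi e \in y0)].
Let Popular phi0 phi := [set b in F | (b \in pcube phi0 y0) &&
  (#|A| <= 2 ^ tau.+1 * #|A :&: pcube phi b|)].

Lemma U_ge : n./2 <= #|U|.
Proof.
apply: leq_trans (fixed_edges2_ge psi2) _; apply/subset_leq_card/subsetP => e.
by move=> /setIdP[eO /eqP pe]; apply/setIdP; rewrite edge_permE pe.
Qed.

Lemma U_le : #|U| <= n./2 + 2 * eta.
Proof.
have [k [hk hk2]] := card_cube_defect (@redges_pres n 2 psi) (FO y0F) (subsetIr F (pcube psi y0)).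
have h1 : f <= 2 * tau + h + 4 + k.
  by rewrite -(@leq_exp2l 2) // expnD; apply: leq_trans Abig _; rewrite leq_mul2l hk orbT.
move: hk2; rewrite card_redges -fN /defect -/U /eta.
by move: h1; move: h #|U|; clear; lia.
Qed.

Lemma A_const e : e \in U -> const_on A e.
Proof.
move=> /setIdP[eO /eqP eU]; apply: (cube_const (subsetIr F (pcube psi y0))).
by rewrite partner_invo // eU edge_permE.
Qed.

(** On an edge e of b the partner under [phi] is phi e; if this differs from psi e, a class of size
    at least three results. A large part of [A] is related to b by [phi], so b has few such
    edges. *)
Lemma few_popular_edges phi0 phi b : b \in Popular phi0 phi ->
  #|[set e in [set e in Om | phi @: e != psi @: e] :\: U | (e \in b) != (e \in set0)]| <= 6 * eta.
Proof.
move=> /setIdP[bF /andP[_ bpop]]; set Bd := [set e in _ | _].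
have UO : U \subset Om by apply/subsetP => e /setIdP[].
have sub1 : A :&: pcube phi b \subset pcube psi y0.
  by apply/subsetP => z /setIP[/setIP[]].
have [||||k [hk hk2]] := card_cross_cube psi2 (FO y0F) sub1 (subsetIr A _) UO (Bd := Bd).
- by apply/subsetP => e /setIdP[/setDP[/setIdP[]]].
- rewrite -setI_eq0; apply/eqP/setP => e; rewrite in_set0; apply/negP => /setIP[eU].
  by move=> /setIdP[/setDP[_]]; rewrite eU.
- by move=> e /A_const; apply: const_onS; apply: subsetIl.
- move=> e /setIdP[/setDP[/setIdP[_ ne] _]]; rewrite in_set0 eqbF_neg negbK => eb _.
  by rewrite /partner eb edge_permE.
have chain : f <= 2 * tau + h + 4 + (tau.+1 + k).
  rewrite -(@leq_exp2l 2) // !(expnD 2 (2 * tau + h + 4)); apply: leq_trans Abig _.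
  rewrite leq_mul2l; apply/orP; right; apply: leq_trans bpop _.
  by rewrite expnD leq_mul2l hk orbT.
move: hk2; rewrite -fN /eta; have := U_ge.
by move: chain; move: h #|Bd| #|U|; clear; lia.
Qed.

Let slack := n %/ 50.

(** Popular graphs are almost empty where [phi] and [psi] differ off [U]. After recording the
    exceptions they are constant on about 3n/2 or more edges, at half a bit each, which beats the
    cost of exceptions and of summing over [phi]. *)
Lemma card_popular phi0 phi : phi != psi ->
  #|Popular phi0 phi| * 2 ^ (3 * #|supp (phi * psi^-1)%g| * l) <= 2 ^ (f - slack).
Proof.
move=> neq; set d := #|supp _|.
have d2 : 1 < d.
  by apply: card_supp_gt1; apply: contraNneq neq => h1; rewrite -[phi](mulgKV psi) h1 mul1g.
have dn : d <= n by rewrite -[n in _ <= n]card_ord max_card.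
pose S := [set e in Om | phi @: e != psi @: e] :\: U.
have SO : S \subset Om by apply/subsetP => e /setDP[/setIdP[]].
have [//|B [BP Bbig Bc]] := fiber_prescribed SO (Y := Popular phi0 phi) (G := set0) (Er := 6 * eta).
  by move=> b; apply: few_popular_edges.
have Bcube : B \subset pcube phi0 y0.
  by apply: subset_trans BP _; apply/subsetP => b /setIdP[_ /andP[]].
have [||||k [hk hk2]] := card_cube_classes (@redges_pres n 2 phi0) (FO y0F) Bcube SO (Bd := set0).
- exact: sub0set.
- by rewrite -setI_eq0 setI0.
- exact: Bc.
- by move=> e; rewrite in_set0.
rewrite cards0 addn0 card_redges in hk2.
have cS : moved Om (edge_perm (phi * psi^-1)%g) <= #|S| + #|U|.
  rewrite /moved -(cardsID U) addnC leq_add //; last by apply/subset_leq_card/subsetIr.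
  apply/subset_leq_card/subsetP => e /setDP[/setIdP[eO ne] eU].
  apply/setDP; split=> //; apply/setIdP; split=> //.
  apply: contra ne => /eqP pe; rewrite edge_permM permM edge_permV !edge_permE pe -edge_permE.
  by rewrite permK.
have mv : d * (2 * n - d - 3) <= 2 * (#|S| + #|U|).
  by apply: leq_trans (moved2_ge _) _; rewrite leq_mul2l cS orbT.
have final : k + 18 * (l * eta) + 3 * d * l + slack <= f.
  have := leq_trunc_div n 50; rewrite -/slack => sl.
  have hle : 1000 * (l * eta) <= 10 * n.
    have -> : l * eta = 3 * (l * tau) + l * h + 5 * l by rewrite /eta; clear; lia.
    have := lh_le; have := big_ltau; rewrite mulnDr muln1.
    by move: (l * h) (l * tau) => a b; clear; lia.
  have he : eta <= l * eta by rewrite leq_pmull.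
  have := popular_arith n_ge1000 d2 dn fN hk2 mv U_le hle he big_l sl.
  by [].
have chain : #|Popular phi0 phi| <= 2 ^ (k + 18 * (l * eta)).
  apply: leq_trans Bbig _; rewrite card_redges (addnC k) expnD; apply: leq_mul => //.
  have -> : 18 * (l * eta) = 3 * l * (6 * eta) by clear; lia.
  by rewrite (expnM 2 (3 * l)); apply: leq_expl; apply: bin_succ_le.
apply: leq_trans (leq_mul chain (leqnn _)) _; rewrite -expnD leq_exp2l //.
by move: final; clear; lia.
Qed.

Lemma card_outside : #|F :\: pcube psi y0| * 2 ^ slack <= 2 ^ (f + tau + 2).
Proof.
have f2n := two_f_ge; have n1000 := n_ge1000.
have sl : slack <= n by apply: leq_div.
pose Nr := [set y in F | ~~ rigid 2 s (4 * E0) y].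
pose Far := [set z in F | [exists phi, ~~ near 2 E0 y0 phi && (z \in pcube phi y0)]].
have Abig1 : 2 ^ (f - 2 * n).+1 <= #|A|.
  rewrite -(@leq_pmul2l (2 ^ (2 * tau + h + 4))) ?expn_gt0 // -expnD.
  apply: leq_trans Abig; rewrite leq_exp2l //.
  have hl : 1000 * h <= 5 * n by apply: leq_trans lh_le; rewrite !leq_mul2l leq_pmull ?orbT.
  by move: f2n n1000 big_tau hl; clear; lia.
pose Main := \bigcup_(phi0 in [set phi | near 2 E0 y0 phi])
  \bigcup_(phi | predT phi && (phi != psi)) Popular phi0 phi.
have cov : F :\: pcube psi y0 \subset Nr :|: (Far :|: Main).
  apply/subsetP => b /setDP[bF bnc]; rewrite in_setU.
  have [br|br] := boolP (rigid 2 s (4 * E0) b); last by apply/orP; left; apply/setIdP.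
  apply/orP; right; rewrite in_setU; have [phi0 hb] := Fdiff y0F bF.
  have [np|np] := boolP (near 2 E0 y0 phi0); last first.
    by apply/orP; left; apply/setIdP; split=> //; apply/existsP; exists phi0; rewrite np.
  apply/orP; right; have [phi _ hphi] := popular bF br (subsetIl F (pcube psi y0)) Abig1.
  apply/bigcupP; exists phi0; first by rewrite inE.
  apply/bigcupP; exists phi; last by apply/setIdP; rewrite hb.
  (* If [psi] itself were popular for b, then b would share a cube of [psi] with a member of [A] and
     hence lie in the clique. *)
  apply: contraNneq bnc => phiE; rewrite phiE in hphi.
  have : 0 < #|A :&: pcube psi b|.
    have : 0 < #|A| by apply: leq_trans Abig1; rewrite expn_gt0.
    by move/leq_trans => /(_ _ hphi); rewrite muln_gt0 => /andP[].
  rewrite card_gt0 => /set0Pn[z /setIP[/setIP[_ zy] zb]].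
  have pinv := edge_perm_invo psi2.
  by rewrite (cube_sym pinv) in zb; apply: (cube_trans pinv zy).
have cM : #|Main| <= 2 ^ tau * 2 ^ (f - slack).
  apply: leq_trans (leq_card_bigcup _ _) _.
  apply: (@leq_trans (\sum_(phi0 in [set phi | near 2 E0 y0 phi]) 2 ^ (f - slack))).
    apply: leq_sum => phi0 _; apply: leq_trans (leq_card_bigcup _ _) _.
    by apply: (sum_over_perms nl l0) => phi _; apply: card_popular.
  rewrite sum_nat_const leq_mul2r; apply/orP; right.
  apply: leq_trans (card_ball psi); apply/subset_leq_card/subsetP => phi; rewrite inE.
  exact: near_ball.
have := leq_trans (subset_leq_card cov) (leq_trans (leq_card_setU _ _) (leq_add (leqnn _)
  (leq_card_setU _ _))).
have cN : #|Nr| <= 2 ^ tau * 2 ^ (f - slack).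
  apply: leq_trans card_nonrigid2 _; rewrite -expnD leq_exp2l //.
  by move: f2n sl; clear; lia.
have cF : #|Far| <= 2 ^ tau * 2 ^ (f - slack).
  apply: leq_trans (card_far2 F y0F) _; rewrite -expnD leq_exp2l //.
  by move: f2n sl; clear; lia.
move=> tot; have : #|F :\: pcube psi y0| <= 4 * (2 ^ tau * 2 ^ (f - slack)).
  by move: tot cN cF cM; move: #|Nr| #|Far| #|Main| (2 ^ tau * _) #|_ :\: _|; clear; lia.
move=> {}tot; apply: leq_trans (leq_mul tot (leqnn _)) _.
rewrite (_ : 4 = 2 ^ 2) // -!expnD leq_exp2l //.
by move: f2n sl; clear; lia.
Qed.
End Outside.

Lemma almost_clique : exists (psi : 'S_n) y, [/\ (psi * psi = 1)%g, y \in F &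
  #|F :\: pcube psi y| * 2 ^ (n %/ 50) <= 2 ^ (f + tau + 2)].
Proof.
have [psi [y [psi2 yF yr yn ybig]]] := popular_involution.
by exists psi, y; split=> //; apply: card_outside yr yn ybig.
Qed.
End Graphs.

(** * The two cases *)

Lemma half_pairs n : exists f, 2 * f + n./2 = 'C(n, 2).
Proof.
exists (if odd n then n./2 * n./2 else n./2 * (n./2).-1).
move: (bin2E n) (odd_double_half n); move: 'C(n, 2) n./2 => c k.
case: (odd n) => h e; move: h; rewrite -e -muln2 /=; first by nia.
by case: k {e} => [|k] /=; nia.
Qed.

Lemma small_uniformity : exists n0, forall n (F : {set {set {set 'I_n}}}), n0 <= n ->
  (forall x, x \in F -> x \subset redges n 2) ->
  (forall x y, x \in F -> y \in F -> exists phi : 'S_n, y \in cube (edge_perm phi) x) ->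
  (forall (psi : 'S_n) x, (psi * psi = 1)%g -> x \in F -> ~~ (F \subset cube (edge_perm psi) x)) ->
  exists f P, [/\ 2 * f + n./2 = 'C(n, 2), P * P <= n, P <= f & #|F| + 2 ^ (f - P) <= 2 ^ f].
Proof.
have [n1 hn1] := polylog_le (4000 * 1000 * 1000 * 1000) 6.
exists (n1 + 1000) => n F hn FO Fdiff Fncl.
have nl := up_log2_bound n.
have l0 : 0 < up_log 2 n by rewrite up_log_gt0; move: hn; clear; lia.
have {}hn1 := hn1 n (leq_trans (leq_addr _ _) hn).
move: (up_log 2 n) nl l0 hn1 => l nl l0 hbig.
have [f fN] := half_pairs n.
pose s := 1000 * l ^ 2; pose tau := 3 * l * s; pose L := 1000 * l.
(* Prescribing at most 4t + 2 edges costs 2t + 1 bits; the two further bits pay for the unrelated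
   half and for the members outside the clique. *)
pose t := 1800 * l ^ 2 + 20; pose P := 2 * t + 3.
have big : 1000 * (l * ((tau + 1) * L)) <= n.
  apply: leq_trans hbig.
  have -> : l ^ 6 = l ^ 2 * l ^ 4 by rewrite -expnD.
  have -> : 1000 * (l * ((tau + 1) * L)) = 1000 * 1000 * (l ^ 2 * (tau + 1)).
    by rewrite /L -mulnn; clear; lia.
  have h1 : tau + 1 <= 4000 * l ^ 4.
    have -> : tau = 3000 * l ^ 3 by rewrite /tau /s !expnS; clear; lia.
    have h3 : l ^ 3 <= l ^ 4 by rewrite leq_pexp2l.
    have h4 : 0 < l ^ 3 by rewrite expn_gt0 l0.
    by move: h3 h4; move: (l ^ 3) (l ^ 4); clear; lia.
  apply: (@leq_trans (1000 * 1000 * (l ^ 2 * (4000 * l ^ 4))));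
    first by rewrite !leq_mul2l h1 !orbT.
  by move: (l ^ 2) (l ^ 4) => a b; clear; nia.
have n1000 := n_ge1000 l0 (erefl L) big.
have f2n := two_f_ge l0 fN (erefl L) big.
have btau := big_tau l0 (erefl L) big.
have tau_s : s <= tau by rewrite /tau leq_pmull // muln_gt0.
have t2 : 1000 * t <= 3 * n.
  have sE : 1800 * l ^ 2 + 20 <= 2 * s.
    have : 0 < l ^ 2 by rewrite expn_gt0 l0.
    by rewrite /s; move: (l ^ 2); clear; lia.
  by rewrite /t; move: btau tau_s n1000 sE; clearbody tau s; clear; lia.
have P2n : P * P <= n.
  apply: leq_trans hbig; have l2 : 1 <= l ^ 2 by rewrite expn_gt0 l0.
  apply: (@leq_trans (4000 * l ^ 2 * (4000 * l ^ 2))).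
    by apply: leq_mul; rewrite /P /t; move: l2; move: (l ^ 2); clear; lia.
  apply: (@leq_trans (4000 * 1000 * 1000 * 1000 * (l ^ 2 * l ^ 2))).
    by move: (l ^ 2) => a; clear; lia.
  by rewrite leq_mul2l -expnD leq_pexp2l ?orbT.
have Pf : P.+3 <= f by rewrite /P; move: t2 f2n n1000; clear; lia.
exists f, P; split=> //; first by apply: leq_trans Pf; rewrite -[P in P <= _]addn0 -addn3 leq_add2l.
have [small|large] := ltnP (2 * #|F|) (2 ^ f).
  have [g fg] : exists g, f = g.+1 by exists f.-1; move: Pf; clear; lia.
  rewrite fg expnS ltn_pmul2l // in small.
  have h1 : 2 ^ (f - P) <= 2 ^ g by rewrite leq_exp2l // fg /P; clear; lia.
  rewrite [X in _ <= 2 ^ X]fg expnS; move: small h1.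
  by move: (2 ^ (f - P)) (2 ^ g) #|F|; clear; lia.
have [psi [x [psi2 xF Bsmall]]] := almost_clique nl l0 fN FO Fdiff large
  (erefl s) (erefl (n * (l + 3))) (erefl tau) (erefl L) big.
pose C := cube (edge_perm psi) x.
have cB : #|F :\: C| <= 2 ^ (f - P.+1).
  rewrite -(@leq_pmul2r (2 ^ (n %/ 50))) ?expn_gt0 //; apply: leq_trans Bsmall _.
  rewrite -expnD leq_exp2l //; have := ltn_ceil n (isT : 0 < 50).
  by rewrite /P; move: btau t2 Pf n1000; rewrite /P; clearbody tau t; clear; lia.
have FE : #|F| = #|F :&: C| + #|F :\: C| by rewrite cardsID.
have pow1 : 2 ^ (f - P) = 2 * 2 ^ (f - P.+1).
  by rewrite -expnS; congr (2 ^ _); move: Pf; clear; lia.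
have pow2 : 2 ^ f.-1 = 2 ^ P * 2 ^ (f - P.+1).
  by rewrite -expnD; congr (2 ^ _); move: Pf; clear; lia.
have pow3 : 2 ^ f = 2 * 2 ^ f.-1 by rewrite -expnS; congr (2 ^ _); move: Pf; clear; lia.
have P8 : 4 <= 2 ^ P by rewrite (_ : 4 = 2 ^ 2) // leq_exp2l // /P; clear; lia.
have [k [Ck hk]] := card_cube_defect (@redges_pres n 2 psi) (FO x xF) (subxx C).
rewrite card_redges -fN in hk.
set U := defect _ _ _ in hk.
(* One defect edge above the minimum n/2 already halves the cube. Otherwise the defect edges are
   exactly the fixed ones, which makes x full and the fixed edges a matching. *)
have [Ubig|Usmall] := ltnP n./2 U.
  have kf : k <= f.-1 by move: hk Ubig Pf; clear; lia.
  have h1 : #|F :&: C| <= 2 ^ f.-1.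
    apply: leq_trans (subset_leq_card (subsetIr F C)) _; apply: leq_trans Ck _.
    by rewrite leq_exp2l.
  have h2 : 4 * 2 ^ (f - P.+1) <= 2 ^ f.-1 by rewrite pow2 leq_mul2r P8 orbT.
  rewrite FE pow1 pow3; move: h1 h2 cB.
  by move: #|F :&: C| #|F :\: C| (2 ^ f.-1) (2 ^ (f - P.+1)); clear; lia.
have fixU : fixed_edges psi 2 = [set e in redges n 2 | (e \in x) == (edge_perm psi e \in x)].
  apply/eqP; rewrite eqEcard; apply/andP; split.
    by apply/subsetP => e /setIdP[eO /eqP pe]; apply/setIdP; rewrite edge_permE pe.
  by apply: leq_trans Usmall (fixed_edges2_ge psi2).
have cfix : #|fixed_edges psi 2| <= n./2 by rewrite fixU.
have fullx : full psi x.
  move=> e eO pe; have : e \notin fixed_edges psi 2 by apply: contra pe => /setIdP[].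
  by rewrite fixU inE eO edge_permE /=; do 2!case: (_ \in x).
have [y yF yC] : exists2 y, y \in F & y \notin C by have /subsetPn[y] := Fncl psi x psi2 xF;
  exists y.
have fdisj e e' : e \in fixed_edges psi 2 -> e' \in fixed_edges psi 2 -> e != e' -> [disjoint e &
  e'].
  exact: fixed_edges2_disjoint.
have tn6 : 6 * t + 10 <= n by move: t2 n1000; clear; lia.
have [k2 [hk2 hU]] := many_unrelated_outside nl l0 psi2 fdisj (leqnn t) tn6 (FO x xF) (FO y yF)
  fullx yC.
have sub : [disjoint F :&: C & unrelated psi x y].
  rewrite -setI_eq0; apply/eqP/setP => z; rewrite in_set0; apply/negP.
  move=> /setIP[/setIP[zF _] /setIdP[_ /forallP zy]].
  by have [phi hphi] := Fdiff y z yF zF; rewrite (negbTE (zy phi)) in hphi.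
have tot : #|F :&: C| + #|unrelated psi x y| <= 2 ^ f.
  have <- : #|(F :&: C) :|: unrelated psi x y| = #|F :&: C| + #|unrelated psi x y|.
    by apply/eqP; rewrite leq_card_setU.
  apply: leq_trans (_ : #|C| <= _).
    apply: subset_leq_card; rewrite subUset subsetIr.
    by apply/subsetP => z /setIdP[].
  have Uge : n./2 <= U by rewrite /U /defect -fixU fixed_edges2_ge.
  by apply: leq_trans Ck _; rewrite leq_exp2l //; move: hk Uge; clear; lia.
have hk3 : 2 * (2 * 2 ^ (f - P)) <= 2 ^ k2.
  rewrite -!expnS leq_exp2l // /P; move: hk2 cfix Pf; rewrite -fN /P.
  by clearbody t; clear; lia.
rewrite FE; move: cB tot hk3 hU pow1.
move: #|F :&: C| #|F :\: C| #|unrelated psi x y| (2 ^ f) (2 ^ (f - P)) (2 ^ (f - P.+1)) (2 ^ k2).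
by clear; lia.
Qed.

(** * Passage from integer exponents to the real bounds *)

Section RealBounds.
Variable R : realType.
Local Open Scope ring_scope.
Import Order.TTheory GRing.Theory Num.Theory.

Lemma fexpE r n : fexp R r n = ('C(n, r) - min_fixed n r)%:R / 2.
Proof.
rewrite /fexp /min_fixed; case: ifP => odd_rn; first by rewrite subn0.
rewrite natrB //; apply: (@leq_trans #|fixed_edges (1 : 'S_n)%g r|).
  by have := @fixed_edges_ge n 1%g (mulg1 _) r; rewrite /min_fixed odd_rn.
by rewrite -card_redges; apply/subset_leq_card/subsetP => e /setIdP[].
Qed.

(** The saving 2^(-g/6) with g >= c / K is rewritten in base e; raising to the sixth power reduces
    the claim to the integer inequality. *)
Lemma large_bound (a g K b c : nat) : (0 < K)%N -> (a ^ 6 * 2 ^ g <= 2 ^ (3 * b))%N ->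
  (c <= K * g)%N ->
  a%:R <= expR (- (ln 2 / (6 * K)%:R * c%:R)) * 2 `^ (b%:R / 2) :> R.
Proof.
move=> K0 h1 h2; have ln2 : 0 < ln 2 :> R by rewrite ln_gt0 // ltr1n.
rewrite -(@ler_pXn2r _ 6) ?nnegrE ?ler0n //; last by rewrite mulr_ge0 ?expR_ge0 ?powR_ge0.
rewrite exprMn -expRM_natl -[X in _ <= _ * X]powR_mulrn ?powR_ge0 // -powRrM.
have -> : b%:R / 2 * 6%:R = (3 * b)%:R :> R by rewrite natrM; lra.
rewrite powR_mulrn // mulrN expRN ler_pdivlMl ?expR_gt0 //.
apply: (@le_trans _ _ (2 ^+ g * a%:R ^+ 6)); last first.
  by rewrite -!natrX -natrM ler_nat mulnC.
rewrite ler_wpM2r ?exprn_ge0 // -[X in _ <= X ^+ g](@lnK R 2) ?posrE // -expRM_natl ler_expR.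
have -> : 6%:R * (ln 2 / (6 * K)%:R * c%:R) = c%:R / K%:R * ln 2 :> R.
  by rewrite natrM; field; rewrite pnatr_eq0 -lt0n.
by rewrite ler_wpM2r ?(ltW ln2) // ler_pdivrMr ?ltr0n // -natrM ler_nat mulnC.
Qed.

(** Since 2^P <= 2^sqrt(n) <= n^sqrt(n), the constant C = 1 suffices. *)
Lemma small_bound (n a f P : nat) : (2 <= n)%N -> (P * P <= n)%N -> (P <= f)%N ->
  (a + 2 ^ (f - P) <= 2 ^ f)%N ->
  a%:R <= (1 - n%:R `^ (- (1 * Num.sqrt n%:R))) * 2 `^ f%:R :> R.
Proof.
move=> n2 Pn Pf h; rewrite mul1r powR_mulrn // mulrBl mul1r lerBrDr.
apply: (@le_trans _ _ (a + 2 ^ (f - P))%:R); last by rewrite -natrX ler_nat.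
rewrite natrD lerD2l natrX powRN ler_pdivrMl ?powR_gt0 ?ltr0n ?(ltn_trans _ n2) //.
apply: (@le_trans _ _ (2 ^+ P * 2 ^+ (f - P))); first by rewrite -exprD subnKC.
rewrite ler_wpM2r ?exprn_ge0 // -powR_mulrn //.
apply: (@le_trans _ _ (2 `^ Num.sqrt n%:R)).
  rewrite ler_powR ?ler1n // (_ : P%:R = Num.sqrt (P%:R ^+ 2)); last by rewrite sqrtr_sqr ger0_norm.
  by rewrite ler_sqrt // -natrX ler_nat expnS expn1.
by rewrite ge0_ler_powR ?sqrtr_ge0 ?nnegrE ?ler0n // ler_nat.
Qed.
End RealBounds.

Lemma cube_arrow n (phi : 'S_n) (G H : hypergraph n) :
  arrow phi G H <-> H \in cube (edge_perm phi) G.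
Proof.
rewrite inE; have -> : edge_perm phi @: (G :\: H) = perm_graph phi (G :\: H).
  by apply: eq_imset => e; rewrite edge_permE.
by split=> /eqP.
Qed.

(** * Difference-isomorphic families in terms of cubes *)

Section Hypergraphs.
Variables (r n : nat) (F : {set hypergraph n}).

Lemma uniform_sub : (forall G : hypergraph n, G \in F -> uniform r G) ->
  forall x, x \in F -> x \subset redges n r.
Proof. by move=> h x /h u; apply/subsetP => e /u; rewrite inE => ->. Qed.

Lemma diff_iso_cube : difference_isomorphic F ->
  forall x y, x \in F -> y \in F -> exists phi : 'S_n, y \in cube (edge_perm phi) x.
Proof. by move=> h x y xF yF; have [phi] := h x y xF yF; exists phi; apply/cube_arrow. Qed.

(** Cubes of an involution are equivalence classes, so a family inside the cube at one of its
    members would be a clique. *)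
Lemma not_clique_cube : ~ involution_clique F ->
  forall (psi : 'S_n) x, (psi * psi = 1)%g -> x \in F -> ~~ (F \subset cube (edge_perm psi) x).
Proof.
move=> h psi x psi2 xF; apply/negP => /subsetP sub; apply: h; exists psi => // G G' GF G'F.
by apply/cube_arrow; rewrite (cube_eq (edge_perm_invo psi2) (sub G GF)) sub.
Qed.
End Hypergraphs.

Unset Implicit Arguments.
Import Order.TTheory GRing.Theory Num.Theory.
Local Open Scope ring_scope.

Theorem theorem2p7 (R : realType) (r : nat) (hr : (2 <= r)%N) :
  exists (n0 : nat) (C c : R), 0 < C /\ 0 < c /\
    forall (n : nat) (F : {set hypergraph n}),
      (n0 <= n)%N ->
      (forall G : hypergraph n, G \in F -> uniform r G) ->
      difference_isomorphic F ->
      ~ involution_clique F ->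
      #|F|%:R <=
        if r == 2%N
        then (1 - n%:R `^ (- (C * Num.sqrt n%:R))) * 2 `^ fexp R r n
        else expR (- (c * n%:R ^+ (r - 2))) * 2 `^ fexp R r n.
Proof.
have [-> /=|r2] := eqVneq r 2%N.
  have [n0 hn0] := small_uniformity.
  exists (n0 + 2)%N, 1, 1; split=> //; split=> // n F hn Fu Fd Fc.
  have [|f [P [fN Pn Pf h]]] := hn0 n F _ (uniform_sub Fu) (diff_iso_cube Fd) (not_clique_cube Fc).
    exact: leq_trans (leq_addr _ _) hn.
  have -> : fexp R 2 n = f%:R.
    by rewrite /fexp /= -fN bin1 natrD addrK natrM mulrAC mulfV ?mul1r // pnatr_eq0.
  exact: small_bound (leq_trans (leq_addl _ _) hn) Pn Pf h.
have r3 : (3 <= r)%N by rewrite ltn_neqAle eq_sym r2.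
have [n0 [K [K0 hn0]]] := large_uniformity r3.
exists n0, 1, (ln 2 / (6 * K)%:R); split=> //; split.
  by rewrite divr_gt0 ?ln_gt0 ?ltr1n // ltr0n muln_gt0.
move=> n F hn Fu Fd Fc.
have [g [h1 h2]] := hn0 n F hn (uniform_sub Fu) (diff_iso_cube Fd) (not_clique_cube Fc).
by rewrite fexpE -natrX; apply: large_bound K0 h1 h2.
Qed.
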